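(* Let $\mathcal{H}_0$ be a separable Hilbert space, $\epsilon=(\epsilon_t)_{t\in\mathbb{Z}}$ a centered $\mathcal{H}_0$-valued white noise on $(\Omega,\mathcal{F},\mathbb{P})$, and $N$ a bounded normal operator on $\mathcal{H}_0$ with singular value function $\mathrm{n}$ and decomposition operator $U$ on $\mathcal{G}_0:=L^2(\mathsf{V},\mathcal{V},\xi)$. Assume that $$\mathrm{h}>\tfrac12\ \ \xi\text{-a.e.}\qquad\text{and}\qquad\int_{\mathsf{V}}\frac{\sigma_W^2(v)}{2\mathrm{h}(v)-1}\,\xi(\mathrm{d}v)<\infty ,$$ where $\mathrm{h}:v\mapsto\Re(\mathrm{n}(v))$ and $\sigma_W^2:v\mapsto\mathbb{E}[|W(v,\cdot)|^2]$ with $W=U\epsilon_0$. Define $Y=(Y_t)_{t\in\mathbb{Z}}$ by $$Y_t=\sum_{k=0}^\infty(k+1)^{-N}\epsilon_{t-k},\qquad t\in\mathbb{Z},$$ and let $D=\mathrm{Id}_{\mathcal{H}_0}-N$. Then there exist $C\in\mathcal{L}_b(\mathcal{H}_0)$ and $(\Delta_k)_{k\in\mathbb{N}}\in\mathcal{L}_b(\mathcal{H}_0)^{\mathbb{N}}$ with $\sum_{k=0}^\infty\|\Delta_k\|_\infty<\infty$ such that $$F_{\mathrm{FI}_D}(\epsilon)=C\,Y+Z ,$$ where $Z$ is the short memory process defined, for all $t\in\mathbb{Z}$, by $Z_t=\sum_{k=0}^\infty\Delta_k\epsilon_{t-k}$.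
   Context: Hilbert spaces are complex; $\mathcal{L}_b(\mathcal{H}_0)$ is the space of bounded operators with operator norm $\|\cdot\|_\infty$; $\mathrm{P}^{\mathsf{H}}$ is the adjoint; $\|\cdot\|_1$ the trace norm; $\mathbb{N}=\{0,1,\dots\}$; $\mathbb{T}=\mathbb{R}/2\pi\mathbb{Z}$. $\mathcal{M}(\Omega,\mathcal{F},\mathcal{H}_0,\mathbb{P})$ is the space of centered elements of $L^2(\Omega,\mathcal{F},\mathcal{H}_0,\mathbb{P})$. A white noise is a centered weakly stationary process with constant spectral operator density: $\mathrm{Cov}(\epsilon_t,\epsilon_s)=0$ for $s\ne t$ and $\mathrm{Cov}(\epsilon_t,\epsilon_t)=\Sigma$ for all $t$, for a positive trace-class $\Sigma$. Here $\langle\mathrm{Cov}(X,Y)y,x\rangle=\mathrm{Cov}(\langle X,x\rangle,\langle Y,y\rangle)$. Singular value decomposition: $(\mathsf{V},\mathcal{V},\xi)$ is a $\sigma$-finite measure space, $\mathrm{n}\in L^\infty(\mathsf{V},\mathcal{V},\xi)$, $U:\mathcal{H}_0\to L^2(\mathsf{V},\mathcal{V},\xi)$ is unitary, and $UNU^{\mathsf{H}}$ is the multiplication operator $f\mapsto\mathrm{n}\times f$. In the definition of $\sigma_W^2$, $W$ is represented by a jointly measurable version on $\mathsf{V}\times\Omega$. $(k+1)^{-N}=\exp(-N\ln(k+1))$. Under the assumed condition the series defining $Y_t$ converges in $\mathcal{M}(\Omega,\mathcal{F},\mathcal{H}_0,\mathbb{P})$. Fractional integration filter: $(1-z)^D=\exp(D\ln(1-z))$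 for $z\in\mathbb{C}\setminus[1,\infty)$ with the principal logarithm; $\mathrm{FI}_D(\lambda)=(1-e^{-i\lambda})^{-D}$ for $\lambda\ne0$ and $\mathrm{FI}_D(0)=0$. For a centered weakly stationary $X$ with spectral operator density $g_X$ with respect to $\mu$ (i.e. $\mathrm{Cov}(X_h,X_0)=\int e^{ih\lambda}g_X(\lambda)\,\mu(\mathrm{d}\lambda)$), and $\Phi:\mathbb{T}\to\mathcal{L}_b(\mathcal{H}_0)$ such that $\lambda\mapsto\Phi(\lambda)x$ is measurable for all $x$ and $\int\|\Phi g_X\Phi^{\mathsf{H}}\|_1\mathrm{d}\mu<\infty$, the integral $\int\Phi\,\mathrm{d}\hat X\in\mathcal{M}(\Omega,\mathcal{F},\mathcal{H}_0,\mathbb{P})$ is given by the unique linear map on the space of such $\Phi$ satisfying $\mathbb{E}\|\int\Phi\,\mathrm{d}\hat X\|^2=\int\|\Phi g_X\Phi^{\mathsf{H}}\|_1\mathrm{d}\mu$ and $\int e^{it\lambda}\mathrm{P}\,\hat X(\mathrm{d}\lambda)=\mathrm{P}X_t$ for all $t\in\mathbb{Z}$, $\mathrm{P}\in\mathcal{L}_b(\mathcal{H}_0)$. The filtered process is $F_\Phi(X)=\big(\int e^{it\lambda}\Phi(\lambda)\hat X(\mathrm{d}\lambda)\big)_{t\in\mathbb{Z}}$. Under the assumed condition, $F_{\mathrm{FI}_D}(\epsilon)$ is well defined. *)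

(* Defs.v *)
From HB Require Import structures.
From mathcomp Require Import all_boot all_order all_algebra.
From mathcomp Require Import complex.
From mathcomp Require Import all_classical all_reals all_analysis.
Set Implicit Arguments.
Unset Strict Implicit.
Unset Printing Implicit Defensive.
Import Order.TTheory GRing.Theory Num.Theory.
Import numFieldNormedType.Exports.
Local Open Scope classical_set_scope.
Local Open Scope ring_scope.

(* The norm of an R[i]-normed module takes its values in R[i]; [hnorm] is the
   same norm as an element of R. *)
Definition hnorm (R : realType) (H : normedModType R[i]) (x : H) : R :=
  complex.Re `|x|.

(* Inner products [ip : {dot H for Num.conj}] are linear in the first argument.
   Together with the completeness of H, this says that H is a Hilbert space. *)
Definition induces_norm (R : realType) (H : normedModType R[i])
    (ip : {dot H for Num.conj}) :=
  forall x : H, ip x x = `|x| ^+ 2.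

Definition separable (T : topologicalType) :=
  exists2 D : set T, countable D & dense D.

Section Operators.
Variables (R : realType) (H : completeNormedModType R[i]).
Implicit Types A B : H -> H.

Definition bounded_op A :=
  linear A /\ exists M : R, forall x, hnorm (A x) <= M * hnorm x.

Definition opnorm A : \bar R :=
  ereal_sup [set (hnorm (A x))%:E | x in [set x | hnorm x <= 1]].

(* exp(A) = sum_k A^k / k!; for bounded A the series converges in operator norm,
   so its sum can be computed pointwise. *)
Definition opexp A : H -> H := fun x =>
  limn (series (fun k : nat => ((k`!)%:R : R[i])^-1 *: iter k A x)).

Variable ip : {dot H for Num.conj}.

Definition is_adjoint A B := bounded_op B /\ forall x y, ip (A x) y = ip x (B y).

Definition adjoint A : H -> H := get (is_adjoint A).

Definition normal_op A := A \o adjoint A = adjoint A \o A.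

Definition positive_op A := bounded_op A /\ forall x, 0 <= ip (A x) x.

(* |A| = (A^H A)^(1/2) *)
Definition absop A : H -> H :=
  get [set B | positive_op B /\ B \o B = adjoint A \o A].

Definition is_onb (E : set H) :=
  (forall e f, E e -> E f -> ip e f = (e == f)%:R) /\
  (forall x, (forall e, E e -> ip x e = 0) -> x = 0).

(* The trace of a positive operator, which does not depend on the basis. *)
Definition trace A : \bar R :=
  (\esum_(e in get is_onb) (complex.Re (ip (A e) e))%:E)%E.

Definition trace_norm A : \bar R := trace (absop A).

Definition trace_class A := bounded_op A /\ (trace_norm A < +oo)%E.

End Operators.

Section ComplexFunctions.
Variable R : realType.

Definition expi (x : R) : R[i] := (cos x +i* sin x)%C.

Definition cmod (z : R[i]) : R := complex.Re `|z|.

(* The principal argument, in ]-pi, pi]. *)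
Definition carg (z : R[i]) : R :=
  if 0 <= complex.Im z then acos (complex.Re z / cmod z)
  else - acos (complex.Re z / cmod z).

Definition cln (z : R[i]) : R[i] := (ln (cmod z) +i* carg z)%C.

Definition cmeasurable d (T : measurableType d) (f : T -> R[i]) :=
  measurable_fun setT (fun x => complex.Re (f x)) /\
  measurable_fun setT (fun x => complex.Im (f x)).

Definition cintegral d (T : measurableType d) (mu : {measure set T -> \bar R})
    (D : set T) (f : T -> R[i]) : R[i] :=
  ((\int[mu]_(x in D) complex.Re (f x)) +i*
   (\int[mu]_(x in D) complex.Im (f x)))%C.

(* Elements of the complex L^2 and L^oo spaces are represented by functions;
   equality in these spaces is equality almost everywhere. *)
Definition in_L2 d (T : measurableType d) (mu : {measure set T -> \bar R})
    (f : T -> R[i]) :=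
  cmeasurable f /\ (\int[mu]_x ((cmod (f x)) ^+ 2)%:E < +oo)%E.

Definition in_Linfty d (T : measurableType d) (mu : {measure set T -> \bar R})
    (f : T -> R[i]) :=
  cmeasurable f /\ exists M : R, {ae mu, forall x, cmod (f x) <= M}.

End ComplexFunctions.

Section SingularValueDecomposition.
Variables (R : realType) (H : completeNormedModType R[i]).
Variable ip : {dot H for Num.conj}.
Variables (d : measure_display) (V : measurableType d).
Variable xi : {measure set V -> \bar R}.

Definition unitary_onto_L2 (U : H -> V -> R[i]) :=
  [/\ forall x, in_L2 xi (U x),
      forall a x y, {ae xi, forall v, U (a *: x + y) v = a * U x v + U y v},
      forall x y, ip x y = cintegral xi setT (fun v => U x v * Num.conj (U y v)) &
      forall f, in_L2 xi f -> exists x, {ae xi, forall v, U x v = f v}].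

(* U N U^H f = n f for all f in L^2, where U^H = U^-1. *)
Definition sv_decomposition (N : H -> H) (n : V -> R[i]) (U : H -> V -> R[i]) :=
  [/\ in_Linfty xi n,
      unitary_onto_L2 U &
      forall f x, in_L2 xi f -> {ae xi, forall v, U x v = f v} ->
        {ae xi, forall v, U (N x) v = n v * f v}].

(* W is a jointly measurable version of the random element U X of L^2. *)
Definition joint_version dO (Om : measurableType dO) (P : probability Om R)
    (U : H -> V -> R[i]) (X : Om -> H) (W : V * Om -> R[i]) :=
  cmeasurable W /\
  {ae P, forall w, {ae xi, forall v, W (v, w) = U (X w) v}}.

Definition sigma2 dO (Om : measurableType dO) (P : probability Om R)
    (W : V * Om -> R[i]) (v : V) : \bar R :=
  (\int[P]_w ((cmod (W (v, w))) ^+ 2)%:E)%E.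

End SingularValueDecomposition.

Section Processes.
Variables (R : realType) (H : completeNormedModType R[i]).
Variable ip : {dot H for Num.conj}.
Variables (d : measure_display) (Om : measurableType d) (P : probability Om R).
Implicit Types (X Y : Om -> H) (S : H -> H).

Definition hmeasurable dT (T : measurableType dT) (D : set T) (f : T -> H) :=
  measurable_fun D (f : T -> g_sigma_algebraType (@open H)).

Definition cexpectation (f : Om -> R[i]) : R[i] := cintegral P setT f.

Definition ccov (f g : Om -> R[i]) : R[i] :=
  cexpectation (fun w => (f w - cexpectation f) * Num.conj (g w - cexpectation g)).

(* Representatives of the elements of M(Om, H, P).  The expectation of X is the
   vector m such that <m, x> = E <X, x> for all x. *)
Definition in_M X :=
  [/\ hmeasurable setT X,
      (\int[P]_w ((hnorm (X w)) ^+ 2)%:E < +oo)%E &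
      forall x, cexpectation (fun w => ip (X w) x) = 0].

Definition as_eq X Y := {ae P, forall w, X w = Y w}.

(* The series of the u k converges in M(Om, H, P), with sum Y. *)
Definition M_sum (u : nat -> Om -> H) Y :=
  [/\ forall k, in_M (u k), in_M Y &
      (\int[P]_w ((hnorm (\sum_(0 <= k < m) u k w - Y w)) ^+ 2)%:E)%E
        @[m --> \oo] --> 0%E].

Definition is_cov X Y S :=
  bounded_op S /\
  forall x y, ip (S y) x = ccov (fun w => ip (X w) x) (fun w => ip (Y w) y).

Definition weakly_stationary (X : int -> Om -> H) :=
  (forall t, in_M (X t)) /\
  exists Gamma : int -> H -> H,
    forall t h, is_cov (X (t + h)) (X t) (Gamma h).

Definition white_noise (X : int -> Om -> H) S :=
  [/\ weakly_stationary X,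
      positive_op ip S /\ trace_class ip S,
      forall t s, s != t -> is_cov (X t) (X s) (fun _ => 0) &
      forall t, is_cov (X t) (X t) S].

End Processes.

Section SpectralIntegral.
Variables (R : realType) (H : completeNormedModType R[i]).
Variable ip : {dot H for Num.conj}.
Variables (d : measure_display) (Om : measurableType d) (P : probability Om R).
Implicit Types (Phi Psi g : R -> H -> H) (X : int -> Om -> H).
Variable mu : {measure set (measurableTypeR R) -> \bar R}.

(* Fundamental domain of R / 2 pi Z: functions on the torus are represented by
   functions on R of which only the values on this interval matter. *)
Definition torus : set (measurableTypeR R) := `]- pi, pi]%classic.

Definition spectral_density X g :=
  [/\ forall l, torus l -> positive_op ip (g l) /\ trace_class ip (g l),
      forall x, hmeasurable torus (fun l : measurableTypeR R => g l x),
      (\int[mu]_(l in torus) trace_norm ip (g l) < +oo)%E &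
      forall h x y,
        ccov P (fun w => ip (X h w) x) (fun w => ip (X 0 w) y) =
        cintegral mu torus (fun l => expi (h%:~R * l) * ip (g l y) x)].

Definition sandwich Phi g (l : R) : H -> H :=
  Phi l \o g l \o adjoint ip (Phi l).

Definition admissible g Phi :=
  [/\ forall l, torus l -> bounded_op (Phi l),
      forall x, hmeasurable torus (fun l : measurableTypeR R => Phi l x) &
      (\int[mu]_(l in torus) trace_norm ip (sandwich Phi g l) < +oo)%E].

(* [I Phi] is the integral of Phi with respect to the random spectral measure
   of X; these properties determine it up to almost sure equality for every
   admissible Phi, and nothing is assumed on the other Phi. *)
Definition spectral_integral X g (I : (R -> H -> H) -> Om -> H) :=
  [/\ weakly_stationary ip P X /\ spectral_density X g,
      forall Phi, admissible g Phi -> in_M ip P (I Phi),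
      forall a Phi Psi, admissible g Phi -> admissible g Psi ->
        as_eq P (I (fun l x => a *: Phi l x + Psi l x))
                (fun w => a *: I Phi w + I Psi w),
      forall Phi, admissible g Phi ->
        (\int[P]_w ((hnorm (I Phi w)) ^+ 2)%:E =
         \int[mu]_(l in torus) trace_norm ip (sandwich Phi g l))%E &
      forall (t : int) (A : H -> H), bounded_op A ->
        as_eq P (I (fun l x => expi (t%:~R * l) *: A x)) (fun w => A (X t w))].

Definition filtered (I : (R -> H -> H) -> Om -> H) Phi (t : int) : Om -> H :=
  I (fun l x => expi (t%:~R * l) *: Phi l x).

End SpectralIntegral.

Section Filters.
Variables (R : realType) (H : completeNormedModType R[i]).

(* (k + 1)^(- N) *)
Definition nat_pow_opp (N : H -> H) (k : nat) : H -> H :=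
  opexp (fun x => - ((ln (k.+1%:R : R))%:C)%C *: N x).

(* The constant density of a white noise with covariance operator S, with
   respect to the Lebesgue measure of the torus, whose total mass is 2 pi. *)
Definition noise_density (S : H -> H) : R -> H -> H :=
  fun _ x => (((2 * pi)^-1 : R)%:C)%C *: S x.

(* (1 - z)^D *)
Definition one_minus_pow (z : R[i]) (D : H -> H) : H -> H :=
  opexp (fun x => cln (1 - z) *: D x).

(* A real l represents 0 in the torus iff exp(- i l) = 1. *)
Definition FI (D : H -> H) (l : R) : H -> H :=
  if expi (- l) == 1 then fun _ => 0
  else one_minus_pow (expi (- l)) (fun x => - D x).

End Filters.

(* Main.v *)
(* Let b_k be the coefficients of (1 - z)^(-D) = (1 - z)^(N - 1). The singular value decomposition and h > 1/2 give
   Re <N x, x> >= |x|^2 / 2, hence |(k + 1)^(-N)| <= (k + 1)^(-1/2). Comparing b_(k + 1) (k + 2)^N with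
   b_k (k + 1)^N shows that b_k (k + 1)^N converges to an operator C at speed O(1 / k), so that
   Delta_k = b_k - C (k + 1)^(-N) is O(k^(-3/2)) in norm.
   On the spectral side, b_k -> 0 implies that the partial sums S_p of sum_k b_k e^(-i k l) converge strongly to
   FI_D(l) for every l <> 0. Uncorrelatedness of the noise turns the convergence of Y into
   sum_k E|b_k eps_0|^2 < oo, and by Fatou's lemma and orthogonality of the characters the integral of the trace
   norms associated with FI_D - S_p is at most sum_(k >= p) E|b_k eps_0|^2. The isometry property of the spectral
   integral then identifies the filtered process with sum_k b_k eps_(t - k). *)
Require Import Defs.
From HB Require Import structures.
From mathcomp Require Import all_boot all_order all_algebra.
From mathcomp Require Import complex.
From mathcomp Require Import all_classical all_reals all_analysis.
From mathcomp Require Import measurable_realfun.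
From mathcomp Require Import ring lra.
Set Implicit Arguments.
Unset Strict Implicit.
Unset Printing Implicit Defensive.
Import Order.TTheory GRing.Theory Num.Theory.
Import numFieldNormedType.Exports.
Local Open Scope classical_set_scope.
Local Open Scope ring_scope.

(** * Norms and bounded operators *)

(** The norms of the b_k are only known to be O(k^(-1/2)), so the series of FI_D(l) need not
    converge absolutely, and it is evaluated on the boundary of the disc. Truncations are used
    throughout: with L_m(r) and G_m(r) the truncated series of ln(1 - r w) and of sum_k (r w)^k b_k
    x, the vector exp(L_m(r) D) G_m(r) makes sense up to r = 1 and equals x at r = 0. In its
    derivative everything cancels except terms of top degree, so its increment over [0, 1] is
    controlled by a Cesaro mean of |b_k x| and the next term; this is why b_k x -> 0 suffices. The
    trace norm rests on a chosen square root and a chosen orthonormal basis, and its measurability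
    in l is not at hand. It is compared with (2 pi)^(-1) E|Phi(l) eps_0|^2, which Fatou's lemma can
    handle and which is an explicit trigonometric polynomial in l when Phi is a partial sum.
    Bessel's inequality is enough for this comparison; the converse bound, needed to read
    summability off the convergence of Y, is extracted from the isometry of the spectral
    integral. *)

Section Norms.
Variable R : realType.
Implicit Types (z : R[i]).

Lemma normCE z : `|z| = (cmod z)%:C%C.
Proof. by rewrite /cmod normc_def. Qed.

Lemma cmodE z : cmod z = Num.sqrt (complex.Re z ^+ 2 + complex.Im z ^+ 2).
Proof. by rewrite /cmod normc_def. Qed.

Lemma cmod_ge0 z : 0 <= cmod z.
Proof. by rewrite cmodE sqrtr_ge0. Qed.

Lemma cmod_sqr z : cmod z ^+ 2 = complex.Re z ^+ 2 + complex.Im z ^+ 2.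
Proof. by rewrite cmodE sqr_sqrtr // addr_ge0 // sqr_ge0. Qed.

Lemma cmodM z z' : cmod (z * z') = cmod z * cmod z'.
Proof. by apply: complexI; rewrite rmorphM /= -!normCE normrM. Qed.

Lemma cmod_real (x : R) : cmod x%:C%C = `|x|.
Proof. by rewrite cmodE /= expr0n addr0 sqrtr_sqr. Qed.

Lemma cmod0 : cmod (0 : R[i]) = 0. Proof. by rewrite /cmod normr0. Qed.

Lemma cmod1 : cmod (1 : R[i]) = 1. Proof. by rewrite /cmod normr1. Qed.

Lemma cmodV z : cmod z^-1 = (cmod z)^-1.
Proof. by apply: complexI; rewrite fmorphV /= -!normCE normfV. Qed.

Lemma cmodX z k : cmod (z ^+ k) = cmod z ^+ k.
Proof. by elim: k => [|k IH]; rewrite ?expr0 ?cmod1 // !exprS cmodM IH. Qed.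

Lemma cmod_nat k : cmod (k%:R : R[i]) = k%:R.
Proof. by apply: complexI; rewrite -normCE normr_nat rmorph_nat. Qed.

Lemma ler_cmodD z z' : cmod (z + z') <= cmod z + cmod z'.
Proof. by rewrite -lecR rmorphD /= -!normCE ler_normD. Qed.

Lemma cmodN z : cmod (- z) = cmod z. Proof. by rewrite /cmod normrN. Qed.

Lemma cmod_eq0 z : (cmod z == 0) = (z == 0).
Proof. by rewrite -(normr_eq0 z) normCE (inj_eq (@complexI R) _ 0). Qed.

Lemma Re_le_cmod z : `|complex.Re z| <= cmod z.
Proof. by rewrite -lecR -normCE normc_ge_Re. Qed.

Lemma Im_le_cmod z : `|complex.Im z| <= cmod z.
Proof.
by rewrite cmodE -(sqrtr_sqr (complex.Im z)) ler_sqrt ?lerDr ?sqr_ge0 // addr_ge0 // sqr_ge0.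
Qed.

Lemma ReD z z' : complex.Re (z + z') = complex.Re z + complex.Re z'.
Proof. by case: z z' => [a b] [c d]. Qed.

Lemma ReN z : complex.Re (- z) = - complex.Re z.
Proof. by case: z. Qed.

Lemma ReM_real (x : R) z : complex.Re (x%:C%C * z) = x * complex.Re z.
Proof. by case: z => a b /=; rewrite mul0r subr0. Qed.

Lemma Re_conj z : complex.Re (Num.conj z) = complex.Re z.
Proof. by case: z. Qed.

Lemma Re_sum (I : Type) (r : seq I) (p : pred I) (F : I -> R[i]) :
  complex.Re (\sum_(i <- r | p i) F i) = \sum_(i <- r | p i) complex.Re (F i).
Proof. by apply: (big_morph _ ReD). Qed.

Variable H : normedModType R[i].
Implicit Types x y : H.

Lemma hnormE x : `|x| = (hnorm x)%:C%C.
Proof.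
by rewrite /hnorm RRe_real // ger0_real // normr_ge0.
Qed.

Lemma hnorm_ge0 x : 0 <= hnorm x.
Proof. by rewrite -lecR -hnormE normr_ge0. Qed.

Lemma hnormZ (a : R[i]) x : hnorm (a *: x) = cmod a * hnorm x.
Proof. by apply: complexI; rewrite rmorphM /= -hnormE -normCE -hnormE normrZ. Qed.

Lemma hnormZr (a : R) x : hnorm (a%:C%C *: x) = `|a| * hnorm x.
Proof. by rewrite hnormZ cmod_real. Qed.

Lemma ler_hnormD x y : hnorm (x + y) <= hnorm x + hnorm y.
Proof. by rewrite -lecR rmorphD /= -!hnormE ler_normD. Qed.

Lemma hnormN x : hnorm (- x) = hnorm x. Proof. by rewrite /hnorm normrN. Qed.

Lemma ler_hnormB x y : hnorm (x - y) <= hnorm x + hnorm y.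
Proof. by rewrite -(hnormN y) ler_hnormD. Qed.

Lemma hnormBC x y : hnorm (x - y) = hnorm (y - x).
Proof. by rewrite -hnormN opprB. Qed.

Lemma hnorm0 : hnorm (0 : H) = 0. Proof. by rewrite /hnorm normr0. Qed.

Lemma hnorm_eq0 x : (hnorm x == 0) = (x == 0).
Proof. by rewrite -(normr_eq0 x) hnormE (inj_eq (@complexI R) _ 0). Qed.

Lemma ler_hnorm_triangle y x t : hnorm (x - t) <= hnorm (x - y) + hnorm (y - t).
Proof. by rewrite -(subrKA y) ler_hnormD. Qed.

Lemma ler_hnorm_sum (I : Type) (r : seq I) (p : pred I) (F : I -> H) :
  hnorm (\sum_(i <- r | p i) F i) <= \sum_(i <- r | p i) hnorm (F i).
Proof.
elim/big_rec2: _ => [|i b a _ le]; first by rewrite hnorm0.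
by apply: le_trans (ler_hnormD _ _) _; rewrite lerD2l.
Qed.

Lemma hcvgP (u : nat -> H) x :
  u @ \oo --> x <-> hnorm (u k - x) @[k --> \oo] --> (0 : R).
Proof.
split=> [/cvgrPdist_lt cu|/cvgrPdist_lt cu].
  apply/cvgrPdist_lt => e e0.
  have e0' : 0 < e%:C%C by rewrite ltcR.
  near=> k; rewrite sub0r normrN ger0_norm ?hnorm_ge0 // -ltcR -hnormE distrC.
  by near: k; apply: cu.
(* Positivity in [R[i]] forces the imaginary part to vanish, so the radius is a real number. *)
apply/cvgrPdist_lt => -[e e'] /[dup] e0; rewrite ltcE /= => /andP[/eqP -> e0'].
near=> k; rewrite distrC hnormE ltcR.
have : `|0 - hnorm (u k - x)| < e by near: k; apply: cu.
by rewrite sub0r normrN ger0_norm ?hnorm_ge0.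
Unshelve. all: by end_near. Qed.

Lemma ler_dist_hnorm x y : `|hnorm x - hnorm y| <= hnorm (x - y).
Proof.
rewrite ler_norml lerBlDr -{3}(subrK y x) ler_hnormD andbT.
by rewrite lerNl opprB lerBlDr hnormBC -{1}(subrK x y) ler_hnormD.
Qed.

Lemma hnorm_continuous : continuous (@hnorm R H).
Proof.
move=> x; apply/cvgrPdist_lt => e e0.
have e0' : 0 < e%:C%C by rewrite ltcR.
near=> y.
have : hnorm (x - y) < e.
  by rewrite -ltcR -hnormE; near: y; apply: (@cvgr_dist_lt _ _ _ (nbhs x) _ id).
apply: le_lt_trans; exact: ler_dist_hnorm.
Unshelve. all: by end_near. Qed.

End Norms.

Section BoundedOperators.
Variables (R : realType) (H : completeNormedModType R[i]).
Implicit Types (A B : H -> H) (x y : H).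

(** The bound is explicit so that rates can be followed through compositions and limits. Its sign
    has to be recorded: on the zero space a negative constant satisfies the inequality. *)
Definition bop A (K : R) :=
  [/\ linear A, 0 <= K & forall x, hnorm (A x) <= K * hnorm x].

Section Linear.
Variables (A : H -> H) (lA : linear A).

Let f : {linear H -> H} := HB.pack A (GRing.isLinear.Build _ _ _ _ A lA).

Lemma linD : {morph A : x y / x + y}. Proof. exact: (linearD f). Qed.

Lemma linB : {morph A : x y / x - y}. Proof. exact: (linearB f). Qed.

Lemma linN : {morph A : x / - x}. Proof. exact: (linearN f). Qed.

Lemma linZ a : {morph A : x / a *: x}. Proof. exact: (linearZ_LR f). Qed.

Lemma lin_sum (I : Type) (r : seq I) (p : pred I) (F : I -> H) :
  A (\sum_(i <- r | p i) F i) = \sum_(i <- r | p i) A (F i).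
Proof. exact: (linear_sum f). Qed.

End Linear.

Lemma bounded_op_bop A : bounded_op A <-> exists K, bop A K.
Proof.
split=> [[lA [K AK]]|[K [lA _ AK]]]; last by split => //; exists K.
exists (Num.max 0 K); split=> // [|x]; first by rewrite le_max lexx.
by apply: le_trans (AK x) _; rewrite ler_wpM2r ?hnorm_ge0 // le_max lexx orbT.
Qed.

Lemma bop_bounded A K : bop A K -> bounded_op A.
Proof. by move=> h; apply/bounded_op_bop; exists K. Qed.

Lemma bop_lin A K : bop A K -> linear A. Proof. by case. Qed.

Lemma bop_le A K K' : K <= K' -> bop A K -> bop A K'.
Proof.
move=> KK' [lA K0 AK]; split=> // [|x]; first exact: le_trans KK'.
by apply: le_trans (AK x) _; rewrite ler_wpM2r ?hnorm_ge0.
Qed.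

Lemma bop_id : bop (fun x => x) 1.
Proof. by split=> // x; rewrite mul1r. Qed.

Lemma bop_zero : bop (fun=> 0) 0.
Proof. by split=> [a u v||x] //; rewrite ?scaler0 ?addr0 // hnorm0 mul0r. Qed.

Lemma bop_comp A B K L : bop A K -> bop B L -> bop (fun x => A (B x)) (K * L).
Proof.
move=> [lA K0 AK] [lB L0 BL]; split=> [a u v||x].
- by rewrite lB lA.
- exact: mulr_ge0.
- by apply: le_trans (AK _) _; rewrite -mulrA ler_wpM2l.
Qed.

Lemma bop_add A B K L : bop A K -> bop B L -> bop (fun x => A x + B x) (K + L).
Proof.
move=> [lA K0 AK] [lB L0 BL]; split=> [a u v||x].
- by rewrite lB lA scalerDr addrACA.
- exact: addr_ge0.
- by apply: le_trans (ler_hnormD _ _) _; rewrite mulrDl lerD.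
Qed.

Lemma bop_scale a A K : bop A K -> bop (fun x => a *: A x) (cmod a * K).
Proof.
move=> [lA K0 AK]; split=> [b u v||x].
- by rewrite lA scalerDr !scalerA mulrC.
- by rewrite mulr_ge0 ?cmod_ge0.
- by rewrite hnormZ -mulrA ler_wpM2l ?cmod_ge0.
Qed.

Lemma bop_opp A K : bop A K -> bop (fun x => - A x) K.
Proof.
move=> [lA K0 AK]; split=> [b u v||x] //; last by rewrite hnormN.
by rewrite lA opprD scalerN.
Qed.

Lemma bop_sub A B K L : bop A K -> bop B L -> bop (fun x => A x - B x) (K + L).
Proof. by move=> hA /bop_opp; exact: bop_add. Qed.

Lemma bop_iter A K k : bop A K -> bop (iter k A) (K ^+ k).
Proof.
move=> hA; elim: k => [|k IH]; first exact: bop_id.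
by rewrite exprS; apply: bop_comp.
Qed.

Lemma bop_sum (F : nat -> H -> H) (K : nat -> R) m :
  (forall k, bop (F k) (K k)) ->
  bop (fun x => \sum_(0 <= k < m) F k x) (\sum_(0 <= k < m) K k).
Proof.
move=> hF; elim: m => [|m IH].
  rewrite big_nil; have := bop_zero; congr (bop _ _).
  by apply/funext => x; rewrite big_nil.
rewrite big_nat_recr //=; have := bop_add IH (hF m); congr (bop _ _).
by apply/funext => x; rewrite big_nat_recr.
Qed.

Lemma bop_limit (F : nat -> H -> H) B K :
  (forall k, bop (F k) K) -> (forall x, F k x @[k --> \oo] --> B x) -> bop B K.
Proof.
move=> hF FB; split=> [a u v||x].
- have h1 := FB (a *: u + v).
  have h2 : F k (a *: u + v) @[k --> \oo] --> a *: B u + B v.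
    rewrite (_ : (fun k => _) = fun k => a *: F k u + F k v); last first.
      by apply/funext => k; have [-> _ _] := hF k.
    by apply: cvgD; [apply: cvgZr|]; apply: FB.
  exact: cvg_unique h1 h2.
- by have [] := hF 0%N.
- have h1 : hnorm (F k x) @[k --> \oo] --> hnorm (B x).
    by apply: continuous_cvg; [exact: hnorm_continuous|exact: FB].
  rewrite -(cvg_lim _ h1) //; apply: limr_le; first by apply/cvg_ex; eexists; exact: h1.
  by apply: nearW => k; have [_ _ ->] := hF k.
Qed.

Lemma bop_continuous A K : bop A K -> continuous A.
Proof.
move=> [lA K0 AK] x; apply/cvgrPdist_lt => -[e e'].
rewrite ltcE /= => /andP[/eqP -> e0].
have d0 : 0 < (e / (K + 1))%:C%C by rewrite ltcR divr_gt0 // ltr_wpDl.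
near=> y; rewrite -(linB lA) hnormE ltcR.
apply: le_lt_trans (AK _) _.
have : hnorm (x - y) < e / (K + 1).
  rewrite -ltcR -hnormE; near: y; exact: (@cvgr_dist_lt _ _ _ (nbhs x) _ id).
rewrite ltr_pdivlMr ?ltr_wpDl // mulrC; apply: le_lt_trans.
by rewrite ler_wpM2r ?hnorm_ge0 // lerDl.
Unshelve. all: by end_near. Qed.

End BoundedOperators.

(** * The operator exponential: convergence, Taylor bounds, functional equation *)

Section Series.
Variables (R : realType) (H : completeNormedModType R[i]).
Implicit Types (A B : H -> H) (x y : H).

(** The bound on later increments passes to the limit, so a rate comes with the convergence: scalar
    tails for the exponential, speed 1 / k for the operator C. *)
Lemma hcauchy_cvg (u : nat -> H) (s : nat -> R) :
  (forall n m, (n <= m)%N -> hnorm (u m - u n) <= s n) ->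
  s @ \oo --> (0 : R) ->
  exists l, u @ \oo --> l /\ forall n, hnorm (l - u n) <= s n.
Proof.
move=> us s0.
have cu : cvgn u.
  apply/cauchy_cvgP/cauchyP => -[e e']; rewrite ltcE /= => /andP[/eqP -> e0].
  have [N _ HN] : \forall n \near \oo, `|s n| < e.
    by move/cvgrPdist_lt : s0 => /(_ e e0); apply: filterS => n; rewrite sub0r normrN.
  exists (u N), N => // n /= Nn; rewrite -ball_normE /= distrC hnormE ltcR.
  apply: le_lt_trans (us _ _ Nn) _; apply: le_lt_trans (ler_norm _) (HN N _).
  by rewrite /=.
exists (limn u); split=> // n.
have h1 : hnorm (u k - u n) @[k --> \oo] --> hnorm (limn u - u n).
  by apply: continuous_cvg; [exact: hnorm_continuous|apply: cvgB => //; exact: cvg_cst].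
rewrite -(cvg_lim _ h1) //; apply: limr_le; first by apply/cvg_ex; eexists; exact: h1.
by near=> k; apply: us; near: k; exact: nbhs_infty_ge.
Unshelve. all: by end_near. Qed.

Lemma exp_coeff_tail_ge0 (K : R) n : 0 <= K -> series (exp_coeff K) n <= expR K.
Proof.
move=> K0; apply: nondecreasing_cvgn_le; last exact: is_cvg_series_exp_coeff.
by apply: nondecreasing_series => k _ _; rewrite exp_coeff_ge0.
Qed.

Definition exp_part A (m : nat) x := \sum_(0 <= k < m) ((k`!)%:R : R[i])^-1 *: iter k A x.

(** The k-th term is at most K^k / k! times |x|, so the remainder is dominated by that of the real
    exponential series. The cases m = 1 and m = 2 give the Taylor bounds. *)
Lemma opexp_approx A (K : R) x : bop A K ->
  exp_part A m x @[m --> \oo] --> opexp A x /\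
  forall m, hnorm (opexp A x - exp_part A m x) <=
            (expR K - series (exp_coeff K) m) * hnorm x.
Proof.
move=> hA; have [lA K0 AK] := hA.
have [||l [cl hl]] := @hcauchy_cvg (exp_part A ^~ x)
    (fun m => (expR K - series (exp_coeff K) m) * hnorm x).
- move=> n m nm; rewrite /exp_part (@big_cat_nat _ _ _ n 0 m) //= [X in hnorm X]addrAC subrr add0r.
  apply: le_trans (ler_hnorm_sum _ _ _) _.
  apply: (@le_trans _ _ ((series (exp_coeff K) m - series (exp_coeff K) n) * hnorm x)).
    rewrite sub_series_geq // mulr_suml; apply: ler_sum => k _.
    rewrite hnormZ cmodV cmod_nat /exp_coeff /= [X in _ <= X * _]mulrC -mulrA ler_wpM2l //.
    by have [_ _] := bop_iter k hA; apply.
  by rewrite ler_wpM2r ?hnorm_ge0 // lerB // exp_coeff_tail_ge0.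
- rewrite -(mul0r (hnorm x)) -(subrr (expR K)); apply: cvgMl.
  by apply: cvgB; [exact: cvg_cst|exact: is_cvg_series_exp_coeff].
- suff -> : opexp A x = l by [].
  by apply: cvg_lim.
Qed.

Lemma opexp_cvg A (K : R) x : bop A K -> exp_part A m x @[m --> \oo] --> opexp A x.
Proof. by move=> /(opexp_approx x)[]. Qed.

Arguments opexp_cvg {A K} x _.

Lemma bop_exp_part A (K : R) m : bop A K -> bop (exp_part A m) (expR K).
Proof.
move=> hA; have [_ K0 _] := hA; apply: bop_le (exp_coeff_tail_ge0 m K0) _.
rewrite /exp_part /series /=; apply: bop_sum => k.
have := bop_scale ((k`!)%:R : R[i])^-1 (bop_iter k hA).
by rewrite cmodV cmod_nat mulrC.
Qed.

Lemma bop_opexp A (K : R) : bop A K -> bop (opexp A) (expR K).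
Proof.
move=> hA; apply: bop_limit => [m|x]; first exact: bop_exp_part hA.
exact: (opexp_cvg _ hA).
Qed.

Lemma opexp_comm A B (K L : R) x : bop A K -> bop B L ->
  (forall y, A (B y) = B (A y)) -> B (opexp A x) = opexp A (B x).
Proof.
move=> hA hB AB.
have h1 : B (exp_part A m x) @[m --> \oo] --> B (opexp A x).
  apply: continuous_cvg; first exact: (bop_continuous hB).
  exact: (opexp_cvg _ hA).
have h2 : B (exp_part A m x) @[m --> \oo] --> opexp A (B x).
  rewrite (_ : (fun m => _) = exp_part A ^~ (B x)); first exact: (opexp_cvg _ hA).
  apply/funext => m; rewrite /exp_part (lin_sum (bop_lin hB)).
  apply: eq_bigr => k _; rewrite (linZ (bop_lin hB)); congr (_ *: _).
  by elim: k => //= k <-; rewrite AB.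
exact: cvg_unique h1 h2.
Qed.

Lemma opexp_taylor1 A (K : R) x : bop A K ->
  hnorm (opexp A x - x - A x) <= K ^+ 2 * expR K * hnorm x.
Proof.
move=> hA; have [lA K0 AK] := hA.
have [_ /(_ 2%N)] := opexp_approx x hA.
rewrite /exp_part /series /= !big_nat_recr //= !big_nil !add0r.
rewrite /exp_coeff /= !fact0 (_ : 1`! = 1%N) // !invr1 !scale1r expr0 expr1 !mulr1.
rewrite opprD addrA; move/le_trans; apply; rewrite ler_wpM2r ?hnorm_ge0 //.
(* Multiplied by 1 + K, this bounds exp K - 1 - K by K^2 exp K. *)
have e1 : (1 - K) * expR K <= 1.
  by rewrite -[leRHS]expR0 -(addNr K) expRD ler_wpM2r ?expR_ge0 // expR_ge1Dx.
have : (1 + K) * ((1 - K) * expR K) <= (1 + K) * 1 by rewrite ler_wpM2l // addr_ge0.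
nra.
Qed.

End Series.
Arguments opexp_cvg {R H A K} x _.

(** Newton's formula turns the truncated exponential of a + b into the triangle i + j < m of a
    double sum. Values lie in an arbitrary module because the identity serves both the vectors
    [iter k A x] and the scalar majorant, where f is constantly 1. *)
Lemma exp_binomial_split (F : numFieldType) (V : lmodType F) (f : nat -> V) (a b : F) m :
  \sum_(0 <= k < m) ((k`!)%:R^-1 * (a + b) ^+ k) *: f k =
  \sum_(0 <= i < m) \sum_(0 <= j < m | (i + j < m)%N)
    ((i`!)%:R^-1 * a ^+ i * ((j`!)%:R^-1 * b ^+ j)) *: f (i + j)%N.
Proof.
pose g i j := ((i`!)%:R^-1 * a ^+ i * ((j`!)%:R^-1 * b ^+ j)) *: f (i + j)%N.
have -> : \sum_(0 <= k < m) ((k`!)%:R^-1 * (a + b) ^+ k) *: f k =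
          \sum_(0 <= k < m) \sum_(0 <= i < m | (i <= k)%N) g i (k - i)%N.
  apply: eq_big_nat => k /andP[_ km].
  rewrite [a + b]addrC exprDn mulr_sumr scaler_suml.
  rewrite -(big_mkord xpredT (fun i => ((k`!)%:R^-1 * (b ^+ (k - i) * a ^+ i *+ 'C(k, i))) *: f k)).
  rewrite [RHS](@big_cat_nat _ _ _ k.+1) //=.
  rewrite [X in _ = _ + X]big_nat_cond [X in _ = _ + X]big1 ?addr0; last first.
    by move=> i /andP[/andP[ki _]]; rewrite leqNgt ki.
  rewrite [RHS]big_mkcond; apply: eq_big_nat => i /andP[_]; rewrite ltnS => ik.
  rewrite ik /g subnKC //; congr (_ *: _).
  have fk : (k`!)%:R = ('C(k, i))%:R * ((i`!)%:R * ((k - i)`!)%:R) :> F.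
    by rewrite -!natrM bin_fact.
  have n0 (l : nat) : (l`!)%:R != 0 :> F by rewrite pnatr_eq0 -lt0n fact_gt0.
  have c0 : ('C(k, i))%:R != 0 :> F by rewrite pnatr_eq0 -lt0n bin_gt0.
  by rewrite fk -mulr_natr; field; rewrite !n0 c0.
rewrite (exchange_big_dep_nat xpredT) //=; apply: eq_big_nat => i /andP[_ im].
rewrite [LHS]big_mkcond /= (@big_cat_nat _ _ _ i) //=; last exact: ltnW.
rewrite big_nat big1 ?add0r; last by move=> k /andP[_ ki]; rewrite leqNgt ki.
rewrite -{1}(add0n i) big_addn [RHS]big_mkcond /= [RHS](@big_cat_nat _ _ _ (m - i)) ?leq_subr //=.
rewrite [X in _ = _ + X]big_nat [X in _ = _ + X]big1 ?addr0; last first.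
  by move=> j /andP[mj _]; rewrite ltnNge -leq_subLR mj.
apply: eq_big_nat => j /andP[_ jm].
by rewrite leq_addl addnK -ltn_subRL jm.
Qed.

Section OpexpD.
Variables (R : realType) (H : completeNormedModType R[i]).
Variables (A : H -> H) (K : R).
Hypothesis hA : bop A K.
Implicit Types (a b : R[i]) (x : H).

Lemma iter_scale a k x : iter k (fun x => a *: A x) x = a ^+ k *: iter k A x.
Proof.
elim: k => [|k IH]; first by rewrite expr0 scale1r.
by rewrite !iterS IH (linZ (bop_lin hA)) scalerA exprS.
Qed.

Lemma exp_partE a m x : exp_part (fun x => a *: A x) m x =
  \sum_(0 <= k < m) ((k`!)%:R^-1 * a ^+ k) *: iter k A x.
Proof. by apply: eq_bigr => k _; rewrite iter_scale scalerA. Qed.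

(** What remains is the part i + j >= m of the square, bounded term by term by its scalar analogue.
    The latter tends to 0 because the real exponential is multiplicative. *)
Lemma exp_partD a b m x :
  hnorm (exp_part (fun x => a *: A x) m (exp_part (fun x => b *: A x) m x) -
         exp_part (fun x => (a + b) *: A x) m x) <=
  (series (exp_coeff (cmod a * K)) m * series (exp_coeff (cmod b * K)) m -
   series (exp_coeff (cmod a * K + cmod b * K)) m) * hnorm x.
Proof.
have [lA K0 AK] := hA.
rewrite !exp_partE.
pose g i j := ((i`!)%:R^-1 * a ^+ i * ((j`!)%:R^-1 * b ^+ j)) *: iter (i + j) A x.
have -> : \sum_(0 <= k < m) (k`!%:R^-1 * a ^+ k) *:
     iter k A (\sum_(0 <= k0 < m) (k0`!%:R^-1 * b ^+ k0) *: iter k0 A x) =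
   \sum_(0 <= i < m) \sum_(0 <= j < m) g i j.
  apply: eq_bigr => i _.
  have li := bop_lin (bop_iter i hA).
  rewrite (lin_sum li) scaler_sumr; apply: eq_bigr => j _.
  by rewrite (linZ li) scalerA -iterD.
rewrite exp_binomial_split -sumrB.
pose h i j := (i`!)%:R^-1 * (cmod a * K) ^+ i * ((j`!)%:R^-1 * (cmod b * K) ^+ j).
have -> : series (exp_coeff (cmod a * K)) m * series (exp_coeff (cmod b * K)) m -
   series (exp_coeff (cmod a * K + cmod b * K)) m =
   \sum_(0 <= i < m) \sum_(0 <= j < m | ~~ (i + j < m)%N) h i j.
  have -> : series (exp_coeff (cmod a * K + cmod b * K)) m =
      \sum_(0 <= i < m) \sum_(0 <= j < m | (i + j < m)%N) h i j.
    have := exp_binomial_split (fun=> 1 : R^o) (cmod a * K) (cmod b * K) m.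
    move=> e; apply: etrans (etrans _ e) _.
      by apply: eq_bigr => k _; rewrite /exp_coeff /= mulrC; exact/esym/mulr1.
    by apply: eq_bigr => i _; apply: eq_bigr => j _; exact: mulr1.
  rewrite /series /= mulr_suml -sumrB; apply: eq_bigr => i _.
  rewrite mulr_sumr [X in X - _](bigID (fun j => (i + j < m)%N)) /= addrAC.
  have -> : \sum_(0 <= j < m | (i + j < m)%N) exp_coeff (cmod a * K) i * exp_coeff (cmod b * K) j =
     \sum_(0 <= j < m | (i + j < m)%N) h i j.
    by apply: eq_bigr => j _; rewrite /h /exp_coeff /= mulrC [_ / _]mulrC mulrC [_ / _]mulrC.
  rewrite subrr add0r.
  by apply: eq_bigr => j _; rewrite /h /exp_coeff /= mulrC [_ / _]mulrC mulrC [_ / _]mulrC.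
rewrite mulr_suml; apply: le_trans (ler_hnorm_sum _ _ _) _; apply: ler_sum => i _.
rewrite [X in X - _](bigID (fun j => (i + j < m)%N)) /= [X in hnorm X]addrAC subrr add0r.
rewrite mulr_suml; apply: le_trans (ler_hnorm_sum _ _ _) _; apply: ler_sum => j _.
rewrite /g /h hnormZ !cmodM !cmodV !cmod_nat !cmodX.
have [_ _ hi] := bop_iter (i + j) hA.
apply: le_trans (ler_wpM2l _ (hi x)) _.
  by rewrite !mulr_ge0 // ?invr_ge0 ?exprn_ge0 ?cmod_ge0.
by rewrite !exprMn exprD le_eqVlt; apply/orP; left; apply/eqP; ring.
Qed.

Lemma opexpD a b x : opexp (fun x => (a + b) *: A x) x =
  opexp (fun x => a *: A x) (opexp (fun x => b *: A x) x).
Proof.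
have [lA K0 AK] := hA.
have ha := bop_scale a hA; have hb := bop_scale b hA.
have hab := bop_scale (a + b) hA.
set Aa := fun x => a *: A x in ha *; set Ab := fun x => b *: A x in hb *.
have h1 : exp_part Aa m (exp_part Ab m x) @[m --> \oo] --> opexp Aa (opexp Ab x).
  apply/hcvgP.
  have z1 := (hcvgP _ _).1 (opexp_cvg (opexp Ab x) ha).
  have z2 := (hcvgP _ _).1 (opexp_cvg x hb).
  have z3 : expR (cmod a * K) * hnorm (exp_part Ab m x - opexp Ab x) +
     hnorm (exp_part Aa m (opexp Ab x) - opexp Aa (opexp Ab x)) @[m --> \oo] --> (0 : R).
    rewrite -(addr0 0) -{1}(mulr0 (expR (cmod a * K))); apply: cvgD => //.
    by apply: cvgMr.
  apply: (squeeze_cvgr _ (cvg_cst 0) z3); apply: nearW => m; rewrite hnorm_ge0 /=.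
  apply: le_trans (ler_hnorm_triangle (exp_part Aa m (opexp Ab x)) _ _) _.
  have [lm _ hm] := bop_exp_part m ha.
  by rewrite lerD2r -(linB lm).
have h2 : exp_part Aa m (exp_part Ab m x) @[m --> \oo] -->
    opexp (fun x => (a + b) *: A x) x.
  apply/hcvgP.
  have z1 := (hcvgP _ _).1 (opexp_cvg x hab).
  have z3 : (series (exp_coeff (cmod a * K)) m * series (exp_coeff (cmod b * K)) m -
     series (exp_coeff (cmod a * K + cmod b * K)) m) * hnorm x +
     hnorm (exp_part (fun x => (a + b) *: A x) m x - opexp (fun x => (a + b) *: A x) x)
     @[m --> \oo] --> (0 : R).
    rewrite -(addr0 0) -{1}(mul0r (hnorm x)) -{1}(subrr (expR (cmod a * K) * expR (cmod b * K))).
    apply: cvgD => //; apply: cvgMl; rewrite -{2}expRD; apply: cvgB; last exact: is_cvg_series_exp_coeff.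
    by apply: cvgM; exact: is_cvg_series_exp_coeff.
  apply: (squeeze_cvgr _ (cvg_cst 0) z3); apply: nearW => m; rewrite hnorm_ge0 /=.
  apply: le_trans (ler_hnorm_triangle (exp_part (fun x => (a + b) *: A x) m x) _ _) _.
  by rewrite lerD2r; exact: exp_partD.
exact: cvg_unique h2 h1.
Qed.

Lemma opexp0 x : opexp (fun x => 0 *: A x) x = x.
Proof.
have h0 := bop_scale 0 hA.
apply: (cvg_unique _ (opexp_cvg x h0)); first exact: norm_hausdorff.
apply/cvgrPdist_lt => e e0; near=> m.
rewrite exp_partE; have -> : m = m.-1.+1 by rewrite prednK //; near: m; exact: nbhs_infty_gt.
rewrite big_nat_recl //= fact0 invr1 expr0 mul1r scale1r big1 ?addr0 ?subrr ?normr0 //.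
by move=> i _; rewrite expr0n mulr0 scale0r.
Unshelve. all: by end_near. Qed.

Lemma opexpK a x : opexp (fun x => - a *: A x) (opexp (fun x => a *: A x) x) = x.
Proof. by rewrite -opexpD addNr opexp0. Qed.

Lemma opexpM (a : R[i]) k x :
  opexp (fun x => (k%:R * a) *: A x) x = iter k (opexp (fun x => a *: A x)) x.
Proof.
elim: k => [|k IH]; first by rewrite mul0r opexp0.
by rewrite iterS -IH -opexpD -{2}[a]mul1r -mulrDl -natr1 addrC.
Qed.

End OpexpD.

(** * Exponentials of accretive operators *)

Section InnerProduct.
Variables (R : realType) (H : completeNormedModType R[i]).
Variables (ip : {dot H for Num.conj}) (hip : induces_norm ip).
Implicit Types (x y z : H) (a : R[i]).

Lemma ipC x y : ip x y = Num.conj (ip y x).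
Proof. by rewrite hermC /= expr0 mul1r. Qed.

Lemma ipZl a x y : ip (a *: x) y = a * ip x y.
Proof. by rewrite linearZl_LR. Qed.

Lemma ipZr a x y : ip x (a *: y) = Num.conj a * ip x y.
Proof. by rewrite linearZr_LR. Qed.

Lemma ipDl x y z : ip (x + y) z = ip x z + ip y z. Proof. exact: linearDl. Qed.

Lemma ipDr x y z : ip x (y + z) = ip x y + ip x z. Proof. exact: linearDr. Qed.

Lemma ipNl x y : ip (- x) y = - ip x y. Proof. exact: linearNl. Qed.

Lemma ipNr x y : ip x (- y) = - ip x y. Proof. exact: linearNr. Qed.

Lemma ipBl x y z : ip (x - y) z = ip x z - ip y z. Proof. by rewrite ipDl ipNl. Qed.

Lemma ipBr x y z : ip x (y - z) = ip x y - ip x z. Proof. by rewrite ipDr ipNr. Qed.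

Lemma ip0l x : ip 0 x = 0. Proof. exact: linear0l. Qed.

Lemma ip0r x : ip x 0 = 0. Proof. exact: linear0r. Qed.

Lemma ip_suml (I : Type) (r : seq I) (F : I -> H) y :
  ip (\sum_(i <- r) F i) y = \sum_(i <- r) ip (F i) y.
Proof. by apply: (big_morph (ip^~ y)) => [u v|]; rewrite ?ipDl ?ip0l. Qed.

Lemma ip_sumr (I : Type) (r : seq I) (F : I -> H) y :
  ip y (\sum_(i <- r) F i) = \sum_(i <- r) ip y (F i).
Proof. by apply: (big_morph (ip y)) => [u v|]; rewrite ?ipDr ?ip0r. Qed.

Lemma Re_ipC x y : complex.Re (ip x y) = complex.Re (ip y x).
Proof. by rewrite ipC Re_conj. Qed.

Lemma ipxx x : ip x x = (hnorm x ^+ 2)%:C%C.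
Proof. by rewrite hip hnormE rmorphXn. Qed.

Lemma hnorm_sqr x : hnorm x ^+ 2 = complex.Re (ip x x).
Proof. by rewrite ipxx. Qed.

Lemma hnorm_sqrD x y :
  hnorm (x + y) ^+ 2 = hnorm x ^+ 2 + hnorm y ^+ 2 + 2 * complex.Re (ip x y).
Proof.
rewrite !hnorm_sqr linearDl !linearDr !ReD (Re_ipC y x).
by ring.
Qed.

Lemma hnorm_sqrB x y :
  hnorm (x - y) ^+ 2 = hnorm x ^+ 2 + hnorm y ^+ 2 - 2 * complex.Re (ip x y).
Proof. by rewrite hnorm_sqrD hnormN linearNr ReN mulrN. Qed.

Lemma parallelogram x y :
  hnorm (x + y) ^+ 2 + hnorm (x - y) ^+ 2 = 2 * hnorm x ^+ 2 + 2 * hnorm y ^+ 2.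
Proof. by rewrite hnorm_sqrD hnorm_sqrB; ring. Qed.

Lemma Re_mul_conj (c : R[i]) : complex.Re (c * Num.conj c) = cmod c ^+ 2.
Proof. by rewrite cmod_sqr; case: c => a b /=; ring. Qed.

Lemma ip_le x y : cmod (ip x y) <= hnorm x * hnorm y.
Proof.
have [->|y0] := eqVneq y 0; first by rewrite linear0r cmod0 hnorm0 mulr0.
have N0 : 0 < hnorm y ^+ 2 by rewrite exprn_gt0 // lt_def hnorm_eq0 y0 hnorm_ge0.
rewrite -ler_sqr ?nnegrE ?mulr_ge0 ?hnorm_ge0 ?cmod_ge0 // exprMn -subr_ge0.
rewrite -(pmulr_rge0 _ N0).
set c := ip x y; set N := hnorm y ^+ 2.
(* Cauchy-Schwarz without division: multiplied by N = |y|^2, the defect is the squared norm of N x -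
   c y. *)
suff -> : N * (hnorm x ^+ 2 * N - cmod c ^+ 2) = hnorm (N%:C%C *: x - c *: y) ^+ 2.
  exact: sqr_ge0.
rewrite hnorm_sqrB ipZl ipZr -/c [Num.conj c * c]mulrC ReM_real Re_mul_conj.
rewrite !hnormZ cmod_real !exprMn -/N ger0_norm ?ltW //.
by ring.
Qed.

Lemma Re_ip_le x y : complex.Re (ip x y) <= hnorm x * hnorm y.
Proof. apply: le_trans (ip_le _ _); apply: le_trans (Re_le_cmod _); exact: ler_norm. Qed.

Lemma ip_continuousl y : continuous (fun x => complex.Re (ip x y)).
Proof.
move=> x; apply/cvgrPdist_lt => e e0.
have d0 : 0 < (e / (hnorm y + 1))%:C%C by rewrite ltcR divr_gt0 // ltr_wpDl ?hnorm_ge0.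
near=> z; rewrite -ReN -ReD -linearBl.
apply: le_lt_trans (Re_le_cmod _) _; apply: le_lt_trans (ip_le _ _) _.
have : hnorm (x - z) < e / (hnorm y + 1).
  rewrite -ltcR -hnormE; near: z; exact: (@cvgr_dist_lt _ _ _ (nbhs x) _ id).
rewrite ltr_pdivlMr ?ltr_wpDl ?hnorm_ge0 //; apply: le_lt_trans.
by rewrite ler_wpM2l ?hnorm_ge0 // lerDl.
Unshelve. all: by end_near. Qed.

End InnerProduct.

(* Only a second-order local error bound is required, so that no derivative of a vector-valued function
   has to be formed. *)
Lemma mean_value_le (R : realType) (H : normedModType R[i]) (v : R -> H) (phi : R -> R) (K : R) :
  (forall r s, 0 <= r -> r <= s -> s <= 1 ->
     hnorm (v s - v r) <= phi s - phi r + K * (s - r) ^+ 2) ->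
  hnorm (v 1 - v 0) <= phi 1 - phi 0.
Proof.
move=> h.
have step n (i : nat) : (i <= n.+1)%N -> hnorm (v (i%:R / n.+1%:R) - v 0) <=
    phi (i%:R / n.+1%:R) - phi 0 + i%:R * (K / n.+1%:R ^+ 2).
  elim: i => [|i IH] lin; first by rewrite !mul0r !subrr hnorm0 addr0.
  apply: le_trans (ler_hnorm_triangle (v (i%:R / n.+1%:R)) _ _) _.
  have n0 : 0 < n.+1%:R :> R by rewrite ltr0n.
  have i1 : i.+1%:R / n.+1%:R - i%:R / n.+1%:R = n.+1%:R^-1 :> R.
    by rewrite -mulrBl -natr1 addrAC subrr add0r mul1r.
  apply: le_trans (lerD (h _ _ _ _ _) (IH (ltnW lin))) _.
  - by rewrite divr_ge0.
  - by rewrite -subr_ge0 i1 invr_ge0 ltW.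
  - by rewrite ler_pdivrMr // mul1r ler_nat.
  rewrite i1 -natr1 mulrDl mul1r exprVn le_eqVlt; apply/orP; left; apply/eqP; ring.
apply/ler_addgt0Pl => e e0.
have [n ne] : exists n, K / n.+1%:R <= e.
  exists (Num.truncn (`|K| / e)); rewrite ler_pdivrMr ?ltr0n //.
  apply: le_trans (ler_norm _) _; rewrite mulrC -ler_pdivrMr //.
  by apply: ltW; rewrite Num.Theory.truncnS_gt // divr_ge0 // ltW.
have := step n n.+1 (leqnn _); rewrite divff ?pnatr_eq0 //.
move=> /le_trans; apply; rewrite addrC lerD2r; apply: le_trans ne.
by rewrite expr2 invfM mulrCA mulVKf ?pnatr_eq0.
Qed.

Section Accretive.
Variables (R : realType) (H : completeNormedModType R[i]).
Variables (ip : {dot H for Num.conj}) (hip : induces_norm ip).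
Variables (A : H -> H) (K c : R) (hA : bop A K) (c0 : 0 <= c).
Hypothesis acc : forall x, c * hnorm x ^+ 2 <= complex.Re (ip (A x) x).

(** The second-order loss of one step. K^2 / 2 comes from |h A x|^2; the other term is the Taylor
    remainder of the exponential, where exp c compensates a factor exp t with t >= - c. *)
Let L := K ^+ 2 / 2 + K ^+ 2 * expR K * expR c.

(** Accretivity enters through |x - h A x|^2 = |x|^2 - 2 h Re <A x, x> + h^2 |A x|^2. The errors of
    order h^2 are absorbed into the exponent by 1 + u <= exp u. *)
Lemma accretive_step (h : R) x : 0 <= h -> h <= 1 ->
  hnorm (opexp (fun x => - (h%:C)%C *: A x) x) <= expR (- (h * c) + h ^+ 2 * L) * hnorm x.
Proof.
move=> h0 h1; have [lA K0 AK] := hA.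
have hhA := bop_scale (- h%:C%C) hA.
have ch : cmod (- h%:C%C) = h by rewrite cmodN cmod_real ger0_norm.
have := opexp_taylor1 x hhA; rewrite ch; set E := opexp _ x => tay.
have a1 : hnorm (x - h%:C%C *: A x) <= expR (- (h * c) + h ^+ 2 * (K ^+ 2 / 2)) * hnorm x.
  rewrite -ler_sqr ?nnegrE ?mulr_ge0 ?hnorm_ge0 ?expR_ge0 // exprMn.
  rewrite (hnorm_sqrB hip) hnormZr ger0_norm // Re_ipC ipZl ReM_real.
  rewrite -expRM_natl.
  apply: (@le_trans _ _ ((1 + 2%:R * (- (h * c) + h ^+ 2 * (K ^+ 2 / 2))) * hnorm x ^+ 2)).
    have e1 : h * (c * hnorm x ^+ 2) <= h * complex.Re (ip (A x) x) by rewrite ler_wpM2l.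
    have e2 : (h * hnorm (A x)) ^+ 2 <= h ^+ 2 * (K ^+ 2 * hnorm x ^+ 2).
      rewrite exprMn -[K ^+ 2 * _]exprMn ler_wpM2l ?sqr_ge0 //.
      by rewrite ler_sqr ?nnegrE ?mulr_ge0 ?hnorm_ge0.
    nra.
  by rewrite ler_wpM2r ?sqr_ge0 // expR_ge1Dx.
have -> : E = (x - h%:C%C *: A x) + (E - x - (- h%:C%C *: A x)).
  by rewrite scaleNr opprK [RHS]addrC -addrA [X in _ = _ + X]addrCA subrr addr0 subrK.
apply: le_trans (ler_hnormD _ _) _; apply: le_trans (lerD a1 tay) _.
rewrite -mulrDl ler_wpM2r ?hnorm_ge0 //.
set t := - (h * c) + h ^+ 2 * (K ^+ 2 / 2).
have -> : - (h * c) + h ^+ 2 * L = t + h ^+ 2 * (K ^+ 2 * expR K * expR c).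
  by rewrite /t /L; ring.
rewrite [leRHS]expRD.
apply: (@le_trans _ _ (expR t * (1 + h ^+ 2 * (K ^+ 2 * expR K * expR c)))); last first.
  by rewrite ler_wpM2l ?expR_ge0 // expR_ge1Dx.
rewrite mulrDr mulr1 lerD2l.
have e3 : expR (h * K) <= expR K by rewrite ler_expR ler_piMl.
have e4 : 1 <= expR t * expR c.
  rewrite -expRD -expR0 ler_expR /t addrAC -{2}[c]mul1r addrC -mulNr -mulrDl.
  by rewrite addr_ge0 ?mulr_ge0 ?sqr_ge0 ?invr_ge0 // ?subr_ge0 // addrC subr_ge0.
have -> : expR t * (h ^+ 2 * (K ^+ 2 * expR K * expR c)) =
    (h * K) ^+ 2 * (expR K * (expR t * expR c)) by ring.
rewrite ler_wpM2l ?sqr_ge0 //; apply: le_trans e3 _.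
by rewrite ler_peMr ?expR_ge0.
Qed.

(* exp(- s A) is the m-th power of exp(- (s / m) A), each factor being controlled by [accretive_step]. *)
Lemma accretive_exp_le (s : R) x : 0 <= s ->
  hnorm (opexp (fun x => - (s%:C)%C *: A x) x) <= expR (- (s * c)) * hnorm x.
Proof.
move=> s0; apply/ler_addgt0Pl => e e0.
have pn n : s <= n.+1%:R -> hnorm (opexp (fun x => - (s%:C)%C *: A x) x) <=
    expR (- (s * c) + s ^+ 2 * L * n.+1%:R^-1) * hnorm x.
  move=> sn; have n0 : 0 < n.+1%:R :> R by rewrite ltr0n.
  set h := s / n.+1%:R.
  have h0 : 0 <= h by rewrite divr_ge0.
  have h1 : h <= 1 by rewrite ler_pdivrMr // mul1r.
  have -> : (fun x => - (s%:C)%C *: A x) = (fun x => (n.+1%:R * (- (h%:C)%C)) *: A x).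
    apply/funext => y; congr (_ *: _); rewrite mulrN; congr (- _).
    by rewrite -(rmorph_nat (real_complex R)) -rmorphM /= mulrC divfK // gt_eqF.
  rewrite (opexpM hA).
  have it k : hnorm (iter k (opexp (fun x => - h%:C%C *: A x)) x) <=
      expR (- (h * c) + h ^+ 2 * L) ^+ k * hnorm x.
    elim: k => [|k IH]; first by rewrite expr0 mul1r.
    rewrite iterS exprS -mulrA; apply: le_trans (accretive_step _ h0 h1) _.
    by rewrite ler_wpM2l ?expR_ge0.
  apply: le_trans (it _) _; rewrite -expRM_natl.
  suff -> : n.+1%:R * (- (h * c) + h ^+ 2 * L) = - (s * c) + s ^+ 2 * L * n.+1%:R^-1 by [].
  by rewrite /h; field; rewrite gt_eqF.
have lim : expR (- (s * c) + s ^+ 2 * L * n.+1%:R^-1) * hnorm x @[n --> \oo] -->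
    expR (- (s * c)) * hnorm x.
  apply: cvgMl; apply: continuous_cvg; first exact: continuous_expR.
  rewrite -[X in _ --> X]addr0 -[X in _ --> _ + X](mulr0 (s ^+ 2 * L)).
  by apply: cvgD; [exact: cvg_cst|apply: cvgMr; exact: cvg_harmonic].
have [m _ Hm] : \forall n \near \oo,
    expR (- (s * c) + s ^+ 2 * L * n.+1%:R^-1) * hnorm x < expR (- (s * c)) * hnorm x + e.
  by apply: (cvgr_lt _ lim); rewrite ltrDl.
pose n := maxn m (Num.truncn s).
rewrite addrC; apply: le_trans (pn n _) (ltW (Hm n _)); last by rewrite /= leq_maxl.
apply/ltW/(lt_le_trans (Num.Theory.truncnS_gt s)).
by rewrite ler_nat ltnS leq_maxr.
Qed.

End Accretive.

(** * The binomial series on the unit circle *)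

Section RealTaylor.
Variable R : realType.

(** The lower bound, a tangent inequality, makes r^(m + 1) usable as a majorant in the mean value
    inequality; the upper bound is the second-order error which that inequality requires of
    polynomials. *)
Lemma expr_taylor1 (r s : R) k : 0 <= r -> r <= s -> s <= 1 ->
  0 <= s ^+ k.+1 - r ^+ k.+1 - (s - r) * (k.+1%:R * r ^+ k) <= k.+1%:R ^+ 2 * (s - r) ^+ 2.
Proof.
move=> r0 rs s1; have s0 := le_trans r0 rs.
elim: k => [|k /andP[IH1 IH2]].
  by rewrite !expr1 expr0 mulr1 mulr1 subrr lexx mulr_ge0 ?sqr_ge0.
set p := (X in 0 <= X) in IH1 IH2.
have -> : s ^+ k.+2 - r ^+ k.+2 - (s - r) * (k.+2%:R * r ^+ k.+1) =
    s * p + (s - r) ^+ 2 * (k.+1%:R * r ^+ k).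
  by rewrite /p !exprS -!natr1; ring.
have rk0 : 0 <= r ^+ k by rewrite exprn_ge0.
have rk1 : r ^+ k <= 1 by rewrite exprn_ile1 // (le_trans rs).
have q0 : 0 <= (s - r) ^+ 2 by rewrite sqr_ge0.
have k0 : 0 <= k%:R :> R by [].
rewrite addr_ge0 ?(mulr_ge0 s0) ?(mulr_ge0 q0) ?mulr_ge0 //=.
apply: (@le_trans _ _ (k.+1%:R ^+ 2 * (s - r) ^+ 2 + (s - r) ^+ 2 * k.+1%:R)).
  apply: lerD; first by rewrite (le_trans _ IH2) // ler_piMl.
  by rewrite ler_wpM2l // ler_piMr.
rewrite -[in leRHS]natr1 mulrC -mulrDr [leRHS]mulrC ler_wpM2l //.
have : 0 <= k.+1%:R :> R by [].
nra.
Qed.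

Lemma lipschitz_deriv_taylor1 (f df : R -> R) (K r s : R) : 0 <= K -> 0 <= r -> r <= s -> s <= 1 ->
  (forall x : R, 0 <= x <= 1 -> is_derive x 1 f (df x)) ->
  (forall x y, 0 <= x <= 1 -> 0 <= y <= 1 -> `|df x - df y| <= K * `|x - y|) ->
  `|f s - f r - (s - r) * df r| <= K * (s - r) ^+ 2.
Proof.
move=> K0 r0 rs s1 fd dl.
have sub x : x \in `[r, s]%R -> 0 <= x <= 1.
  by rewrite in_itv /= => /andP[rx xs]; rewrite (le_trans r0 rx) (le_trans xs s1).
have [||c crs ->] := @MVT_segment R f df r s rs.
- move=> x xrs; apply: fd; apply: sub; exact: subset_itv_oo_cc.
- apply: derivable_within_continuous => x xrs.
  by have [] := fd x (sub _ xrs).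
rewrite mulrC -mulrBr normrM expr2 mulrA [leRHS]mulrC [`|s - r|]ger0_norm ?subr_ge0 //.
rewrite ler_wpM2l ?subr_ge0 //; apply: le_trans (dl _ _ (sub _ crs) _) _.
  by rewrite r0 (le_trans rs).
move: crs; rewrite in_itv /= => /andP[rc cs].
by rewrite ger0_norm ?subr_ge0 // ler_wpM2l // lerD2r.
Qed.

End RealTaylor.

(** * The principal logarithm on the segment from 1 to 1 - w, for w on the unit circle *)

Section PrincipalLog.
Variable R : realType.

(** The points 1 - r w stay in the right half-plane, where the arctangent is smooth, whereas the
    arccosine is singular on the real axis. *)
Lemma carg_atan (z : R[i]) : 0 < complex.Re z -> carg z = atan (complex.Im z / complex.Re z).
Proof.
case: z => x y /= x0; rewrite /carg /= cmodE /=.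
have q0 : 0 < x ^+ 2 + y ^+ 2 by rewrite ltr_wpDr ?sqr_ge0 // exprn_gt0.
have e : x / Num.sqrt (x ^+ 2 + y ^+ 2) = cos (atan (y / x)).
  have -> : x ^+ 2 + y ^+ 2 = x ^+ 2 * (1 + (y / x) ^+ 2).
    by field; rewrite gt_eqF.
  rewrite cos_atan sqrtrM ?sqr_ge0 // sqrtr_sqr gtr0_norm // invfM mulrA divff ?mul1r //.
  by rewrite gt_eqF.
have pi2 : 0 < pi / 2 :> R by rewrite divr_gt0 ?pi_gt0.
have pi2' : pi / 2 <= pi :> R by rewrite ler_pdivrMr // ler_peMr ?pi_ge0 // ler1n.
have ag := atan_gtNpi2 (y / x); have al := atan_ltpi2 (y / x).
rewrite e; case: ifPn => y0.
  rewrite cosK // in_itv /= (le_trans (ltW al)) // andbT -atan0.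
  by apply: le_atan; rewrite divr_ge0 // ltW.
rewrite cosKN ?opprK // (le_trans _ (ltW ag)) ?lerN2 //=.
by rewrite -atan0; apply: le_atan; rewrite ler_pdivrMr // mul0r ltW // ltNge.
Qed.

Variables (w : R[i]) (w1 : cmod w = 1) (wn1 : w != 1).
Let a := complex.Re w.
Let b := complex.Im w.
(** A lower bound of Re (1 - r w) on the whole segment: the minimum is that of 1 and 1 - a, and half
    of 1 - a lies below both because a >= -1. *)
Let c : R := (1 - a) / 2.

Let ab : a ^+ 2 + b ^+ 2 = 1.
Proof. by rewrite -cmod_sqr w1 expr1n. Qed.

Let a1 : a < 1.
Proof.
have a_le : a <= 1 by rewrite -w1 (le_trans (ler_norm _)) // Re_le_cmod.
rewrite lt_neqAle a_le andbT; apply/eqP => ae; move/eqP: wn1; apply.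
have b0 : b = 0.
  by apply/eqP; rewrite -sqrf_eq0 -(addKr (a ^+ 2) (b ^+ 2)) ab ae expr1n addNr.
by move: ae b0; rewrite /a /b; case: (w) => x y /= -> ->.
Qed.

Let aN1 : -1 <= a.
Proof. by move: (Re_le_cmod w); rewrite w1 ler_norml => /andP[]. Qed.

Lemma cdist_gt0 : 0 < c.
Proof. by rewrite divr_gt0 // subr_gt0. Qed.

Let re_ge (r : R) : 0 <= r <= 1 -> c <= 1 - r * a.
Proof. move=> /andP[r0 r1]; rewrite /c; move: a1 aN1; nra. Qed.

(** The squared modulus of 1 - r w. *)
Let q (r : R) : R := (1 - r * a) ^+ 2 + (r * b) ^+ 2.

Let qE r : q r = 1 - 2 * a * r + r ^+ 2.
Proof.
have -> : q r = 1 - 2 * a * r + r ^+ 2 * (a ^+ 2 + b ^+ 2) by rewrite /q; ring.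
by rewrite ab mulr1.
Qed.

Let q_ge r : 0 <= r <= 1 -> c ^+ 2 <= q r.
Proof.
move=> hr; rewrite /q ler_wpDr ?sqr_ge0 // ler_sqr ?nnegrE ?re_ge // ?(ltW cdist_gt0) //.
exact: le_trans (ltW cdist_gt0) (re_ge hr).
Qed.

Lemma cmod_1Mr_ge (r : R) : 0 <= r <= 1 -> c <= cmod (1 - r%:C%C * w).
Proof.
move=> hr; apply: le_trans (re_ge hr) _; apply: le_trans (Re_le_cmod _).
apply: le_trans (ler_norm _) _; rewrite ReD ReN ReM_real /=; exact: lexx.
Qed.

(** The difference is (y - x) (x + y - 2 a) / (q(x) q(y)), where |x + y - 2 a| <= 4 and q >= c^2. *)
Let q_lip x y : 0 <= x <= 1 -> 0 <= y <= 1 -> `|(q x)^-1 - (q y)^-1| <= 4 / c ^+ 4 * `|x - y|.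
Proof.
move=> hx hy; have c0 := cdist_gt0; have a0 : 0 < 1 - a by rewrite subr_gt0.
have qx : 0 < q x by apply: lt_le_trans (q_ge hx); rewrite exprn_gt0.
have qy : 0 < q y by apply: lt_le_trans (q_ge hy); rewrite exprn_gt0.
have -> : (q x)^-1 - (q y)^-1 = (y - x) * (x + y - 2 * a) * ((q x)^-1 * (q y)^-1).
  have -> : (y - x) * (x + y - 2 * a) = q y - q x by rewrite !qE; ring.
  by field; rewrite !gt_eqF.
rewrite !normrM distrC [leRHS]mulrC -mulrA ler_wpM2l //.
apply: ler_pM => //; rewrite ?mulr_ge0 //.
  rewrite ler_norml; move: hx hy a1 aN1 => /andP[? ?] /andP[? ?] ? ?.
  apply/andP; split; lra.
rewrite -normrM -invfM gtr0_norm ?invr_gt0 ?mulr_gt0 // lef_pV2 ?posrE ?mulr_gt0 ?exprn_gt0 //.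
rewrite (exprD c 2 2); apply: ler_pM; rewrite ?sqr_ge0 ?q_ge //.
Qed.

Let dq (r : R) : is_derive r 1 (q : R -> R) (2 * (r - a)).
Proof.
have -> : q = fun r => 1 - 2 * a * r + r ^+ 2 by apply/funext => r'; exact: qE.
apply: is_derive_eq; rewrite /GRing.scale /=; ring.
Qed.

(** The real and imaginary parts are ln(q) / 2 and an arctangent, with Lipschitz derivatives (r - a)
    / q and - b / q; these are the two components of - w / (1 - r w). *)
Lemma cln_taylor1 : exists2 K : R, 0 <= K & forall r s, 0 <= r -> r <= s -> s <= 1 ->
  cmod (cln (1 - s%:C%C * w) - cln (1 - r%:C%C * w) - (s - r)%:C%C * (- w / (1 - r%:C%C * w)))
   <= K * (s - r) ^+ 2.
Proof.
have c0 := cdist_gt0.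
(* [K1] and [K2] are Lipschitz constants of the two derivatives. In [K1], the factor 2 bounds |y -
   a| in front of the variation of 1 / q. *)
pose K1 := (c ^+ 2)^-1 + 2 * (4 / c ^+ 4).
pose K2 := 4 / c ^+ 4.
have K20 : 0 <= K2 by rewrite divr_ge0 // exprn_ge0 // ltW.
have K10 : 0 <= K1 by rewrite addr_ge0 ?mulr_ge0 // invr_ge0 exprn_ge0 // ltW.
exists (K1 + K2); first exact: addr_ge0.
move=> r s r0 rs s1.
have hr : 0 <= r <= 1 by rewrite r0 (le_trans rs).
have hs : 0 <= s <= 1 by rewrite s1 (le_trans r0).
have qp x : 0 <= x <= 1 -> 0 < q x.
  by move=> hx; apply: lt_le_trans (q_ge hx); rewrite exprn_gt0.
have rp x : 0 <= x <= 1 -> 0 < 1 - x * a by move=> /re_ge; apply: lt_le_trans.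
have Re1 x : complex.Re (1 - x%:C%C * w) = 1 - x * a by rewrite ReD ReN ReM_real.
have Im1 x : complex.Im (1 - x%:C%C * w) = - (x * b).
  by rewrite /b; case: (w) => u v /=; rewrite mul0r addr0 sub0r.
have cmq x : cmod (1 - x%:C%C * w) = Num.sqrt (q x).
  by rewrite cmodE Re1 Im1 sqrrN.
have clnE x : 0 <= x <= 1 ->
    cln (1 - x%:C%C * w) = (2^-1 * ln (q x) +i* atan (- (x * b) / (1 - x * a)))%C.
  move=> hx; rewrite /cln carg_atan ?Re1 ?rp // Im1; congr (_ +i* _)%C.
  rewrite cmq; have sq : 0 < Num.sqrt (q x) by rewrite sqrtr_gt0 qp.
  have -> : ln (q x) = ln (Num.sqrt (q x) ^+ 2) by rewrite sqr_sqrtr // ltW // qp.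
  by rewrite lnXn // -[ln _ *+ 2]mulr_natl mulrA mulVf ?mul1r.
have re : `|2^-1 * ln (q s) - 2^-1 * ln (q r) - (s - r) * ((r - a) * (q r)^-1)| <= K1 * (s - r) ^+ 2.
  apply: (@lipschitz_deriv_taylor1 _ (fun x => 2^-1 * ln (q x)) (fun x => (x - a) * (q x)^-1)) => //.
    move=> x hx; have h1 := is_derive1_ln (qp x hx).
    have h2 := is_derive1_comp h1 (dq x).
    apply: is_derive_eq; rewrite /GRing.scale /=; field; rewrite gt_eqF // qp //.
  move=> x y hx hy.
  have -> : (x - a) * (q x)^-1 - (y - a) * (q y)^-1 =
     (x - y) * (q x)^-1 + (y - a) * ((q x)^-1 - (q y)^-1) by ring.
  apply: le_trans (ler_normD _ _) _; rewrite /K1 [leRHS]mulrDl !normrM; apply: lerD.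
    rewrite mulrC ler_wpM2r // gtr0_norm ?invr_gt0 ?qp //.
    by rewrite lef_pV2 ?posrE ?q_ge ?qp ?exprn_gt0.
  rewrite -mulrA; apply: ler_pM => //; last exact: q_lip.
  rewrite ler_norml; move: hy a1 aN1 => /andP[? ?] ? ?; apply/andP; split; lra.
have im : `|atan (- (s * b) / (1 - s * a)) - atan (- (r * b) / (1 - r * a)) - (s - r) * (- b * (q r)^-1)|
    <= K2 * (s - r) ^+ 2.
  apply: (@lipschitz_deriv_taylor1 _ (fun x => atan (- (x * b) / (1 - x * a)))
     (fun x => - b * (q x)^-1)) => //.
    move=> x hx.
    have n0 : 1 - x * a != 0 by rewrite gt_eqF // rp.
    have h1 : is_derive x 1 (fun x : R => - (x * b) / (1 - x * a)) (- b / (1 - x * a) ^+ 2).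
      apply: is_derive_eq; rewrite /GRing.scale /=; field; rewrite n0 //.
    have := @is_derive1_comp _ atan (fun x : R => - (x * b) / (1 - x * a)) x _ _
      (is_derive1_atan _) h1.
    move=> h3; apply: (is_derive_eq h3); rewrite /q; field.
    by rewrite n0 gt_eqF // qp.
  move=> x y hx hy; rewrite -mulrBr normrM normrN.
  apply: le_trans (q_lip hx hy); rewrite ler_piMl //.
  by rewrite -w1 Im_le_cmod.
have -> : - w / (1 - r%:C%C * w) = ((r - a) * (q r)^-1 +i* (- b * (q r)^-1))%C.
  have w0 : 1 - r%:C%C * w != 0.
    by rewrite -cmod_eq0 gt_eqF // (lt_le_trans c0) ?cmod_1Mr_ge.
  apply: (mulIf w0); rewrite divfK //.
  have qn : q r != 0 by rewrite gt_eqF // qp.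
  rewrite (_ : 1 - r%:C%C * w = ((1 - r * a) +i* (- (r * b)))%C); last first.
    by apply/eqP; rewrite eq_complex Re1 Im1 !eqxx.
  rewrite (_ : - w = (- a +i* - b)%C); last by rewrite /a /b; case: (w).
  apply/eqP; rewrite eq_complex /=; apply/andP; split; apply/eqP; apply: (mulIf qn).
    have -> : ((r - a) / q r * (1 - r * a) - - b / q r * - (r * b)) * q r =
        - a * q r + r * (1 - (a ^+ 2 + b ^+ 2)).
      rewrite [in RHS]qE; field; exact: qn.
    by rewrite ab subrr mulr0 addr0.
  have -> : ((r - a) / q r * - (r * b) + - b / q r * (1 - r * a)) * q r = - b * q r.
    rewrite [in RHS]qE; field; exact: qn.
  by [].
rewrite !clnE //.
set z := (X in cmod X).
have -> : z = ((2^-1 * ln (q s) - 2^-1 * ln (q r) - (s - r) * ((r - a) * (q r)^-1))%:C%C +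
   'i%C * (atan (- (s * b) / (1 - s * a)) - atan (- (r * b) / (1 - r * a)) - (s - r) * (- b * (q r)^-1))%:C%C).
  by rewrite [LHS]complexE /z /=; congr (_%:C%C + 'i%C * _%:C%C); ring.
apply: le_trans (ler_cmodD _ _) _; rewrite cmodM !cmod_real.
have -> : cmod ('i%C : R[i]) = 1 by rewrite cmodE /= expr0n add0r expr1n sqrtr1.
by rewrite mul1r [leRHS]mulrDl lerD.
Qed.

End PrincipalLog.

Lemma mean_value_le_at (R : realType) (H : normedModType R[i]) (v : R -> H) (phi : R -> R) (K t : R) :
  0 <= t <= 1 ->
  (forall r s, 0 <= r -> r <= s -> s <= 1 ->
     hnorm (v s - v r) <= phi s - phi r + K * (s - r) ^+ 2) ->
  hnorm (v t - v 0) <= phi t - phi 0.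
Proof.
move=> /andP[t0 t1] h.
have := @mean_value_le _ _ (fun s => v (t * s)) (fun s => phi (t * s)) (K * t ^+ 2).
rewrite !mulr1 !mulr0; apply => r s r0 rs s1.
rewrite -mulrA -exprMn mulrBr; apply: h.
- exact: mulr_ge0.
- by rewrite ler_wpM2l.
- by rewrite mulr_ile1 // (le_trans r0).
Qed.

Section LogPartialSums.
Variables (R : realType) (w : R[i]).

(** The truncated series of ln(1 - r w), as a polynomial in r; [dlog_part] is its derivative in
    r. *)
Definition log_part (m : nat) (r : R) : R[i] :=
  - \sum_(0 <= k < m) (r ^+ k.+1 / k.+1%:R)%:C%C * w ^+ k.+1.

Definition dlog_part (m : nat) (r : R) : R[i] :=
  - \sum_(0 <= k < m) (r ^+ k)%:C%C * w ^+ k.+1.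

Lemma dlog_partE m r : (1 - r%:C%C * w) * dlog_part m r = - w * (1 - (r%:C%C * w) ^+ m).
Proof.
elim: m => [|m IH]; first by rewrite /dlog_part big_nil oppr0 mulr0 expr0 subrr mulr0.
have -> : dlog_part m.+1 r = dlog_part m r - (r ^+ m)%:C%C * w ^+ m.+1.
  by rewrite /dlog_part big_nat_recr //= opprD.
rewrite [LHS]mulrDr IH.
by rewrite rmorphXn /= !exprS !exprMn; ring.
Qed.

Hypotheses (w1 : cmod w = 1) (wn1 : w != 1).

Lemma log_part_taylor1 m (r s : R) : 0 <= r -> r <= s -> s <= 1 ->
  cmod (log_part m s - log_part m r - (s - r)%:C%C * dlog_part m r) <=
  (\sum_(0 <= k < m) k.+1%:R) * (s - r) ^+ 2.
Proof.
move=> r0 rs s1.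
have -> : log_part m s - log_part m r - (s - r)%:C%C * dlog_part m r =
    - \sum_(0 <= k < m) ((s ^+ k.+1 / k.+1%:R)%:C%C * w ^+ k.+1 -
       (r ^+ k.+1 / k.+1%:R)%:C%C * w ^+ k.+1 -
       (s - r)%:C%C * ((r ^+ k)%:C%C * w ^+ k.+1)).
  by rewrite /log_part /dlog_part !sumrB -mulr_sumr; ring.
rewrite cmodN mulr_suml.
apply: le_trans (@ler_hnorm_sum R (R[i]^o) _ _ _ _) _; apply: ler_sum => k _.
set p := s ^+ k.+1 - r ^+ k.+1 - (s - r) * (k.+1%:R * r ^+ k).
have -> : (s ^+ k.+1 / k.+1%:R)%:C%C * w ^+ k.+1 - (r ^+ k.+1 / k.+1%:R)%:C%C * w ^+ k.+1
   - (s - r)%:C%C * ((r ^+ k)%:C%C * w ^+ k.+1) = (p / k.+1%:R)%:C%C * w ^+ k.+1.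
  rewrite mulrA -!mulrBl -rmorphM -!rmorphB /=; congr (_%:C%C * _).
  by rewrite /p; field; rewrite ?nat1r ?natr1 pnatr_eq0.
have /andP[p0 p1] := expr_taylor1 k r0 rs s1.
rewrite [hnorm _]cmodM cmodX w1 expr1n mulr1 cmod_real ger0_norm ?divr_ge0 //.
by rewrite ler_pdivrMr ?ltr0n // (le_trans p1) // expr2 mulrAC.
Qed.

Let c : R := (1 - complex.Re w) / 2.
Let c0 : 0 < c := cdist_gt0 w1 wn1.

(** The difference vanishes at 0 and has derivative w (r w)^m / (1 - r w), of modulus at most r^m /
    c; a primitive of this bound is the majorant r^(m + 1) / ((m + 1) c). The estimate includes t =
    1, a boundary point of the disc of convergence. *)
Lemma log_part_cln m t : 0 <= t <= 1 ->
  cmod (log_part m t - cln (1 - t%:C%C * w)) <= (m.+1%:R * c)^-1.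
Proof.
move=> ht; have [K K0 hK] := cln_taylor1 w1 wn1.
have := @mean_value_le_at R (R[i]^o) (fun t => log_part m t - cln (1 - t%:C%C * w))
  (fun r => r ^+ m.+1 / (m.+1%:R * c)) (\sum_(0 <= k < m) k.+1%:R + K) t ht.
rewrite [log_part m 0 - _](_ : _ = 0); last first.
  rewrite mul0r subr0 /cln cmod1 ln1 /carg /= lexx cmod1 divr1 acos1 subr0.
  rewrite /log_part big1 ?oppr0 // => k _.
  by rewrite expr0n mul0r mul0r.
rewrite expr0n mul0r !subr0 => h; apply: le_trans (h _) _; last first.
  move: ht => /andP[t0 t1].
  by rewrite ler_piMl ?invr_ge0 ?exprn_ile1 // mulr_ge0 // ltW.
move=> {h ht t} r s r0 rs s1.
have hr : 0 <= r <= 1 by rewrite r0 (le_trans rs).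
have cr := cmod_1Mr_ge w1 wn1 hr.
set z := 1 - r%:C%C * w in cr *.
have z0 : z != 0 by rewrite -cmod_eq0 gt_eqF // (lt_le_trans c0).
set u := (s - r)%:C%C.
have -> : log_part m s - cln (1 - s%:C%C * w) - (log_part m r - cln z) =
   (log_part m s - log_part m r - u * dlog_part m r) -
   (cln (1 - s%:C%C * w) - cln z - u * (- w / z)) +
   u * (dlog_part m r - (- w / z)) by ring.
apply: le_trans (@ler_hnormD R (R[i]^o) _ _) _; rewrite [leRHS]addrC; apply: lerD.
  apply: le_trans (@ler_hnormB R (R[i]^o) _ _) _; rewrite mulrDl; apply: lerD.
    exact: log_part_taylor1.
  exact: hK.
have -> : dlog_part m r - (- w / z) = w * (r%:C%C * w) ^+ m / z.
  by apply: (mulfI z0); rewrite mulrBr dlog_partE -/z; field.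
rewrite [hnorm _]cmodM /u cmod_real ger0_norm ?subr_ge0 //.
rewrite !cmodM !cmodX cmodM w1 mul1r mulr1 cmod_real cmodV ger0_norm //.
apply: (@le_trans _ _ ((s - r) * r ^+ m / c)).
  rewrite -mulrA ler_wpM2l ?subr_ge0 // ler_wpM2l ?exprn_ge0 //.
  by rewrite lef_pV2 ?posrE // (lt_le_trans c0).
rewrite -mulrBl [(m.+1%:R * c)^-1]invfM [leRHS]mulrA ler_wpM2r ?invr_ge0 ?(ltW c0) //.
rewrite ler_pdivlMr ?ltr0n // -mulrA [_ * m.+1%:R]mulrC.
by have /andP[] := expr_taylor1 m r0 rs s1; rewrite subr_ge0.
Qed.

Lemma log_part_le m t : 0 <= t <= 1 -> cmod (log_part m t) <= 2 / c.
Proof.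
(* For m = 0 the partial sum is empty, so the logarithm itself is bounded by 1 / c. *)
move=> ht; have h0 := log_part_cln 0 ht.
rewrite /log_part big_nil oppr0 sub0r cmodN mul1r in h0.
have := log_part_cln m ht => h1.
rewrite -[log_part m t](subrK (cln (1 - t%:C%C * w))).
apply: le_trans (ler_cmodD _ _) _; rewrite mulr_natl mulr2n; apply: lerD => //.
apply: le_trans h1 _; rewrite invfM ler_piMl ?invr_ge0 ?(ltW c0) //.
by rewrite invf_le1 ?ltr0n // ler1n.
Qed.

Lemma cvg_log_part :
  cmod (log_part m 1 - cln (1 - w)) @[m --> \oo] --> (0 : R).
Proof.
have h : (m.+1%:R)^-1 / c @[m --> \oo] --> (0 : R).
  by rewrite -(mul0r c^-1); apply: cvgMl; exact: cvg_harmonic.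
apply: (squeeze_cvgr _ (cvg_cst 0) h); apply: nearW => m; rewrite cmod_ge0 /= -invfM.
by rewrite -{1}[w]mul1r; apply: log_part_cln; rewrite ler01 lexx.
Qed.

End LogPartialSums.

(** * Summation of the vector-valued binomial series at a boundary point other than 1 *)

Section BinomialSeries.
Variables (R : realType) (H : completeNormedModType R[i]).
Variables (D : H -> H) (KD : R) (hD : bop D KD).

Let E (a : R[i]) := opexp (fun x => a *: D x).

Lemma opexp_taylor0 (A : H -> H) (K : R) x : bop A K ->
  hnorm (opexp A x - x) <= (expR K - 1) * hnorm x.
Proof.
move=> hA; have [_ /(_ 1%N)] := opexp_approx x hA.
by rewrite /exp_part /series /= !big_nat1 /exp_coeff /= fact0 invr1 scale1r expr0 divr1.
Qed.

Lemma E_bop a : bop (E a) (expR (cmod a * KD)).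
Proof. by apply: bop_opexp; apply: bop_scale. Qed.

(** The product rule for exp(al(r) D) G(r), whose derivative would be exp(al D) (al' D G + G'), with
    a quadratic error in place of differentiability. *)
Lemma exp_product_taylor1 (al dal : R -> R[i]) (G dG : R -> H) (M K1 K2 L1 L2 g : R) :
  0 <= L1 ->
  (forall r, 0 <= r <= 1 -> expR (cmod (al r) * KD) <= M) ->
  (forall r s, 0 <= r -> r <= s -> s <= 1 ->
    [/\ cmod (al s - al r - (s - r)%:C%C * dal r) <= K1 * (s - r) ^+ 2,
        hnorm (G s - G r - (s - r)%:C%C *: dG r) <= K2 * (s - r) ^+ 2,
        cmod (al s - al r) <= L1 * (s - r) &
        hnorm (G s - G r) <= L2 * (s - r)]) ->
  (forall r, 0 <= r <= 1 -> hnorm (G r) <= g) ->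
  exists K, forall r s, 0 <= r -> r <= s -> s <= 1 ->
    hnorm (E (al s) (G s) - E (al r) (G r)) <=
      M * (s - r) * hnorm (dal r *: D (G r) + dG r) + K * (s - r) ^+ 2.
Proof.
move=> L10 hM hT hg; have [lD KD0 BD] := hD.
(* One summand for each error: the Taylor remainder of exp(u D), the variation of G, the remainder
   of al, the remainder of G. M bounds the common factor exp(al(r) D). *)
exists (M * ((L1 * KD) ^+ 2 * expR (L1 * KD) * g + L1 * KD * L2 + K1 * KD * g + K2)).
move=> r s r0 rs s1; set h := s - r.
have hr : 0 <= r <= 1 by rewrite r0 (le_trans rs).
have hs : 0 <= s <= 1 by rewrite s1 (le_trans r0).
have h0 : 0 <= h by rewrite subr_ge0.
have h1 : h <= 1 by rewrite lerBlDr (le_trans s1) // lerDl.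
have [t1 t2 t3 t4] := hT r s r0 rs s1; rewrite -/h in t1 t2 t3 t4.
set u := al s - al r in t1 t3.
have -> : E (al s) (G s) = E (al r) (E u (G s)).
  by rewrite /E -(opexpD hD) /u addrC subrK.
rewrite -(linB (bop_lin (E_bop (al r)))).
have [_ _ hE] := E_bop (al r).
apply: le_trans (hE _) _.
apply: le_trans (ler_wpM2r (hnorm_ge0 _) (hM r hr)) _.
rewrite -!mulrA -mulrDr ler_wpM2l ?(le_trans (expR_ge0 _) (hM r hr)) //.
clearbody u; have -> : E u (G s) - G r =
   (E u (G s) - G s - u *: D (G s)) + u *: D (G s - G r) + (u - h%:C%C * dal r) *: D (G r)
   + (G s - G r - h%:C%C *: dG r) + h%:C%C *: (dal r *: D (G r) + dG r).
  rewrite (linB lD) scalerBr scalerBl scalerDr scalerA.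
  move: (u *: D (G s)) (u *: D (G r)) ((h%:C%C * dal r) *: D (G r)) (h%:C%C *: dG r) (E u (G s)).
  move=> a b p q e; rewrite !subrKA [e - _ - p]addrAC -[G s - G r - q]addrA subrKA.
  by rewrite -opprD [e - p - _]addrAC subrKA opprD addrA subrK.
have Lu : 0 <= L1 * h by apply: le_trans (cmod_ge0 _) t3.
have L2h : 0 <= L2 * h by apply: le_trans (hnorm_ge0 _) t4.
have g0 : 0 <= g by apply: le_trans (hnorm_ge0 _) (hg r hr).
rewrite addrC; apply: le_trans (ler_hnormD _ _) _; apply: lerD.
  by rewrite hnormZr ger0_norm.
rewrite !mulrDl; apply: le_trans (ler_hnormD _ _) _; apply: lerD => //.
apply: le_trans (ler_hnormD _ _) _; apply: lerD; last first.
  rewrite hnormZ; apply: le_trans (ler_pM _ _ t1 (BD _)) _; rewrite ?cmod_ge0 ?hnorm_ge0 //.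
  have K1h : 0 <= K1 * h ^+ 2 by apply: le_trans (cmod_ge0 _) t1.
  apply: (@le_trans _ _ (K1 * h ^+ 2 * (KD * g))).
    by rewrite ler_wpM2l // ler_wpM2l // hg.
  rewrite le_eqVlt; apply/orP; left; apply/eqP; ring.
apply: le_trans (ler_hnormD _ _) _; apply: lerD; last first.
  rewrite hnormZ; apply: (@le_trans _ _ ((L1 * h) * (KD * (L2 * h)))).
    apply: ler_pM; rewrite ?cmod_ge0 ?hnorm_ge0 //.
    by apply: le_trans (BD _) _; rewrite ler_wpM2l.
  rewrite le_eqVlt; apply/orP; left; apply/eqP; ring.
apply: le_trans (opexp_taylor1 (G s) (bop_scale u hD)) _.
have uL : cmod u * KD <= L1 * KD * h by rewrite [leRHS]mulrAC ler_wpM2r.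
have uL0 : 0 <= cmod u * KD by rewrite mulr_ge0 ?cmod_ge0.
apply: (@le_trans _ _ ((L1 * KD * h) ^+ 2 * expR (L1 * KD) * g)); last first.
  rewrite le_eqVlt; apply/orP; left; apply/eqP; ring.
apply: ler_pM; rewrite ?mulr_ge0 ?expR_ge0 ?sqr_ge0 ?hnorm_ge0 ?cmod_ge0 ?hg //.
apply: ler_pM; rewrite ?sqr_ge0 ?expR_ge0 //.
  by rewrite ler_sqr ?nnegrE // (le_trans uL0).
rewrite ler_expR; apply: le_trans uL _.
by rewrite ler_piMr // mulr_ge0.
Qed.

Variables (w : R[i]) (w1 : cmod w = 1) (wn1 : w != 1).
Variable y : nat -> H.
(** This is the recurrence of the coefficients of (1 - z)^(-D) applied to [y 0], that is, the
    equation (1 - z) G' = D G for their generating function. *)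
Hypothesis yS : forall k, k.+1%:R *: y k.+1 = k%:R *: y k + D (y k).
Hypothesis y0 : y k @[k --> \oo] --> 0.

Let G m (r : R) := \sum_(0 <= k < m.+1) ((r ^+ k)%:C%C * w ^+ k) *: y k.
Let dG m (r : R) := \sum_(0 <= k < m) ((k.+1%:R * r ^+ k)%:C%C * w ^+ k.+1) *: y k.+1.

Let G_taylor1 m r s : 0 <= r -> r <= s -> s <= 1 ->
  hnorm (G m s - G m r - (s - r)%:C%C *: dG m r) <=
  (\sum_(0 <= k < m) k.+1%:R ^+ 2 * hnorm (y k.+1)) * (s - r) ^+ 2.
Proof.
move=> r0 rs s1.
have -> : G m s - G m r - (s - r)%:C%C *: dG m r = \sum_(0 <= k < m)
   ((s ^+ k.+1 - r ^+ k.+1 - (s - r) * (k.+1%:R * r ^+ k))%:C%C * w ^+ k.+1) *: y k.+1.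
  rewrite /G /dG !(@big_nat_recl _ _ _ m 0) //= !expr0 opprD addrACA subrr add0r scaler_sumr -!sumrB.
  apply: eq_bigr => k _.
  by rewrite scalerA -2!scalerBl [_%:C%C * (_ * _)]mulrA -!mulrBl -rmorphM -!rmorphB.
rewrite mulr_suml; apply: le_trans (ler_hnorm_sum _ _ _) _; apply: ler_sum => k _.
have /andP[p0 p1] := expr_taylor1 k r0 rs s1.
rewrite hnormZ cmodM cmodX w1 expr1n mulr1 cmod_real ger0_norm //.
by rewrite [leRHS]mulrAC ler_wpM2r ?hnorm_ge0.
Qed.

(** The truncated form of (1 - r w) G' = w D G: the recurrence makes all degrees cancel except the
    last, which leaves the boundary term in [y m.+1]. *)
Let dG_eq m r : (1 - r%:C%C * w) *: dG m r =
  w *: D (G m r) - (m.+1%:R * r ^+ m)%:C%C *: (w ^+ m.+1 *: y m.+1).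
Proof.
have lD := bop_lin hD.
elim: m => [|m IH].
  rewrite /G /dG big_nil scaler0 big_nat1 !expr0 mulr1 scale1r mulr1.
  by have := yS 0; rewrite scale0r add0r => <-; rewrite expr1 !scale1r subrr.
have -> : dG m.+1 r = dG m r + ((m.+1%:R * r ^+ m)%:C%C * w ^+ m.+1) *: y m.+1.
  by rewrite /dG big_nat_recr.
have -> : G m.+1 r = G m r + ((r ^+ m.+1)%:C%C * w ^+ m.+1) *: y m.+1.
  by rewrite /G big_nat_recr.
rewrite scalerDr IH (linD lD) (linZ lD).
have -> : D (y m.+1) = m.+2%:R *: y m.+2 - m.+1%:R *: y m.+1 by rewrite yS addrC addKr.
rewrite scalerDr -!addrA; congr (_ + _).
rewrite !scalerBr !scalerA [RHS]addrAC -[_ *: y m.+2 - _]scalerBl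
  -[X in X + _ = _]scaleNr -[LHS]scalerDl.
rewrite !rmorphM /= !rmorph_nat.
set r1 := (r ^+ m.+1)%:C%C; have -> : r1 = r%:C%C * (r ^+ m)%:C%C by rewrite /r1 exprS rmorphM.
set r2 := (r ^+ m)%:C%C.
rewrite (_ : _ - _ * w ^+ m.+2 = 0 :> R[i]); last by rewrite !exprS; ring.
rewrite scale0r sub0r -[RHS]scaleNr; congr (_ *: _).
have : - (m.+1%:R * r2 * w ^+ m.+1) + (1 - r%:C%C * w) * (m.+1%:R * r2 * w ^+ m.+1) =
  - (w * (r%:C%C * r2 * w ^+ m.+1) * m.+1%:R) :> R[i] by ring.
exact.
Qed.

Let g m := \sum_(0 <= k < m.+1) hnorm (y k).

Let G_le m r : 0 <= r <= 1 -> hnorm (G m r) <= g m.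
Proof.
move=> /andP[r0 r1]; apply: le_trans (ler_hnorm_sum _ _ _) _; apply: ler_sum => k _.
rewrite hnormZ cmodM cmodX w1 expr1n mulr1 cmod_real ger0_norm ?exprn_ge0 //.
by rewrite ler_piMl ?hnorm_ge0 ?exprn_ile1.
Qed.

Let c : R := (1 - complex.Re w) / 2.
Let c0 : 0 < c := cdist_gt0 w1 wn1.
Let M := expR (2 / c * KD).
(** Bounds the derivative of the product, freed of its exponential factor, after division by (m + 1)
    r^m. The first term holds the Cesaro mean of |y_0|, ..., |y_m|, so [eta] tends to 0 as soon as y
    does. *)
Let eta m := (KD * (m.+1%:R^-1 * g m) + hnorm (y m.+1)) / c.

Let KD0 : 0 <= KD. Proof. by case: hD. Qed.

Let M_ge m r : 0 <= r <= 1 -> expR (cmod (log_part w m r) * KD) <= M.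
Proof. by move=> hr; rewrite ler_expR ler_wpM2r // log_part_le. Qed.

(* Mean value inequality on [0, 1] for r |-> exp(log_part m r *: D) (G m r), whose derivative is small because
   the power series G satisfies (1 - r w) G' = w D G up to its last terms. *)
Let exp_binomial_le m :
  hnorm (E (log_part w m 1) (\sum_(0 <= k < m.+1) w ^+ k *: y k) - y 0) <= M * eta m.
Proof.
pose K1 : R := \sum_(0 <= k < m) k.+1%:R.
pose K2 : R := \sum_(0 <= k < m) k.+1%:R ^+ 2 * hnorm (y k.+1).
have K10 : 0 <= K1 by apply: sumr_ge0.
have K20 : 0 <= K2 by apply: sumr_ge0 => k _; rewrite mulr_ge0 ?sqr_ge0 ?hnorm_ge0.
pose A1 : R := \sum_(0 <= k < m) 1.
have A10 : 0 <= A1 by apply: sumr_ge0.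
pose A2 : R := \sum_(0 <= k < m) k.+1%:R * hnorm (y k.+1).
have d1 r : 0 <= r <= 1 -> cmod (dlog_part w m r) <= A1.
  move=> /andP[r0 r1]; rewrite /dlog_part cmodN.
  apply: le_trans (@ler_hnorm_sum R (R[i]^o) _ _ _ _) _; apply: ler_sum => k _.
  rewrite [hnorm _]cmodM cmodX w1 expr1n mulr1 cmod_real ger0_norm ?exprn_ge0 //.
  exact: exprn_ile1.
have d2 r : 0 <= r <= 1 -> hnorm (dG m r) <= A2.
  move=> /andP[r0 r1]; rewrite /dG.
  apply: le_trans (ler_hnorm_sum _ _ _) _; apply: ler_sum => k _.
  rewrite hnormZ cmodM cmodX w1 expr1n mulr1 cmod_real ger0_norm ?mulr_ge0 ?exprn_ge0 //.
  by rewrite ler_wpM2r ?hnorm_ge0 // ler_piMr // exprn_ile1.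
have lip (V : normedModType R[i]) (a b : V) (h K A : R) : 0 <= h -> h <= 1 -> 0 <= K ->
    hnorm (a - h%:C%C *: b) <= K * h ^+ 2 -> hnorm b <= A -> hnorm a <= (A + K) * h.
  move=> h0 h1 K0 ab bA; rewrite -[a](subrK (h%:C%C *: b)).
  apply: le_trans (ler_hnormD _ _) _; rewrite addrC mulrDl; apply: lerD.
    by rewrite hnormZr ger0_norm // mulrC ler_wpM2r.
  by apply: le_trans ab _; rewrite ler_wpM2l // expr2 ler_piMl.
have [||K hK] := @exp_product_taylor1 (log_part w m) (dlog_part w m) (G m) (dG m) M K1 K2
    (A1 + K1) (A2 + K2) (g m) _ (@M_ge m) _ (@G_le m).
- exact: addr_ge0.
- move=> r s r0 rs s1.
  have hr : 0 <= r <= 1 by rewrite r0 (le_trans rs).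
  have h0 : 0 <= s - r by rewrite subr_ge0.
  have h1 : s - r <= 1 by rewrite lerBlDr (le_trans s1) // lerDl.
  have t1 := log_part_taylor1 w1 m r0 rs s1.
  have t2 := G_taylor1 m r0 rs s1.
  split=> //.
  + by apply: (lip (R[i]^o) _ _ _ _ _ h0 h1 K10 t1); apply: d1.
  + by apply: (lip _ _ _ _ _ _ h0 h1 K20 t2); apply: d2.
have := @mean_value_le R H (fun r => E (log_part w m r) (G m r)) (fun r => M * eta m * r ^+ m.+1) K.
have -> : G m 1 = \sum_(0 <= k < m.+1) w ^+ k *: y k.
  by apply: eq_bigr => k _; rewrite expr1n mul1r.
have -> : G m 0 = y 0.
  rewrite /G big_nat_recl // expr0 mul1r scale1r big1 ?addr0 // => k _.
  by rewrite expr0n /= mul0r scale0r.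
have -> : log_part w m 0 = 0.
  by rewrite /log_part big1 ?oppr0 // => k _; rewrite expr0n mul0r mul0r.
rewrite [E 0 _](opexp0 hD) expr1n mulr1 expr0n mulr0 subr0; apply.
move=> r s r0 rs s1.
have hr : 0 <= r <= 1 by rewrite r0 (le_trans rs).
apply: le_trans (hK r s r0 rs s1) _; rewrite lerD2r -mulrBr -[M * (s - r) * _]mulrA -[M * eta m * _]mulrA.
rewrite ler_wpM2l ?expR_ge0 //.
have cr := cmod_1Mr_ge w1 wn1 hr.
set z := 1 - r%:C%C * w in cr *.
have zp : 0 < cmod z by apply: lt_le_trans cr.
have r0m : 0 <= r ^+ m by rewrite exprn_ge0.
(* Multiplied by 1 - r w, the two terms w D G coming from [dlog_partE] and [dG_eq] cancel, and what
   is left carries the factor r^m. *)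
have main : hnorm (dlog_part w m r *: D (G m r) + dG m r) <= r ^+ m * (m.+1%:R * eta m).
  rewrite -(ler_pM2l zp) -hnormZ scalerDr scalerA dlog_partE dG_eq.
  rewrite addrA -scalerDl mulrBr mulr1 mulNr opprK addrAC addNr add0r.
  apply: le_trans (ler_hnormB _ _) _.
  have e1 : hnorm ((w * (r%:C%C * w) ^+ m) *: D (G m r)) <= r ^+ m * (KD * g m).
    rewrite hnormZ cmodM cmodX cmodM w1 mul1r mulr1 cmod_real ger0_norm //.
    rewrite ler_wpM2l //; have [_ _ BD] := hD; apply: le_trans (BD _) _.
    by rewrite ler_wpM2l // G_le.
  have e2 : hnorm ((m.+1%:R * r ^+ m)%:C%C *: (w ^+ m.+1 *: y m.+1)) <= r ^+ m * (m.+1%:R * hnorm (y m.+1)).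
    rewrite hnormZr hnormZ cmodX w1 expr1n mul1r ger0_norm ?mulr_ge0 //.
    by rewrite [m.+1%:R * _]mulrC mulrA.
  apply: le_trans (lerD e1 e2) _.
  rewrite -mulrDr mulrCA ler_wpM2l //.
  apply: (@le_trans _ _ (c * (m.+1%:R * eta m))); last first.
    rewrite ler_wpM2r // mulr_ge0 // divr_ge0 ?(ltW c0) // addr_ge0 ?hnorm_ge0 //.
    by rewrite !mulr_ge0 // sumr_ge0 // => k _; exact: hnorm_ge0.
  rewrite le_eqVlt; apply/orP; left; apply/eqP; rewrite /eta; field.
  by rewrite gt_eqF //= nat1r pnatr_eq0.
apply: le_trans (ler_wpM2l _ main) _; first by rewrite subr_ge0.
have /andP[p0 _] := expr_taylor1 m r0 rs s1.
have eta0 : 0 <= eta m.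
  rewrite divr_ge0 ?(ltW c0) // addr_ge0 ?hnorm_ge0 //.
  by rewrite !mulr_ge0 // sumr_ge0 // => k _; exact: hnorm_ge0.
have p1 : (s - r) * (m.+1%:R * r ^+ m) <= s ^+ m.+1 - r ^+ m.+1 by rewrite -subr_ge0.
have := ler_wpM2l eta0 p1; congr (_ <= _); move: (eta m) => e; ring.
Qed.

(** By [exp_binomial_le], exp(a_m D) S_m tends to y_0, where a_m tends to ln(1 - w). Inverting
    exp(a_m D) is harmless because M bounds the inverses uniformly in m. *)
Lemma cvg_binomial_series :
  \sum_(0 <= k < m) w ^+ k *: y k @[m --> \oo] --> E (- cln (1 - w)) (y 0).
Proof.
rewrite -(cvg_shiftS (fun m => \sum_(0 <= k < m) w ^+ k *: y k)).
have ny : hnorm (y k) @[k --> \oo] --> (0 : R).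
  by have /hcvgP := y0; under eq_fun do rewrite subr0.
have eta0 : eta m @[m --> \oo] --> (0 : R).
  rewrite -(mul0r c^-1) /eta; apply: cvgMl; rewrite -[X in _ --> X]addr0; apply: cvgD; last first.
    by rewrite (cvg_shiftS (fun k => hnorm (y k))).
  rewrite -(mulr0 KD); apply: cvgMr.
  exact: (cesaro ny).
set l := cln (1 - w).
pose a m := log_part w m 1.
have am : cmod (a m - l) @[m --> \oo] --> (0 : R) by exact: cvg_log_part.
apply/hcvgP.
have z3 : M * (M * eta m) + expR (cmod (- l) * KD) * ((expR (cmod (a m - l) * KD) - 1) * hnorm (y 0))
    @[m --> \oo] --> (0 : R).
  rewrite -(addr0 0); apply: cvgD.
    by rewrite -{1}(mulr0 M) -{1}(mulr0 M); apply: cvgMr; apply: cvgMr.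
  rewrite -{1}(mulr0 (expR (cmod (- l) * KD))); apply: cvgMr.
  rewrite -{1}(mul0r (hnorm (y 0))); apply: cvgMl.
  suff : expR (cmod (a m - l) * KD) - 1 @[m --> \oo] --> expR 0 - 1 by rewrite expR0 subrr.
  apply: cvgB; last exact: cvg_cst.
  apply: continuous_cvg; first exact: continuous_expR.
  by rewrite -(mul0r KD); apply: cvgMl.
apply: (squeeze_cvgr _ (cvg_cst 0) z3); apply: nearW => m; rewrite hnorm_ge0 /=.
set S := \sum_(0 <= k < m.+1) _.
have hS := exp_binomial_le m; rewrite -/S -/(a m) in hS.
have -> : S = E (- a m) (E (a m) S) by rewrite /E (opexpK hD).
apply: le_trans (ler_hnorm_triangle (E (- a m) (y 0)) _ _) _; apply: lerD.
  rewrite -(linB (bop_lin (E_bop _))).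
  have [_ _ hE] := E_bop (- a m); apply: le_trans (hE _) _.
  have h1 : 0 <= (1 : R) <= 1 by rewrite ler01 lexx.
  have hM : expR (cmod (- a m) * KD) <= M by rewrite cmodN; exact: (M_ge m h1).
  exact: (ler_pM (expR_ge0 _) (hnorm_ge0 _) hM hS).
have -> : E (- a m) (y 0) = E (- l) (E (l - a m) (y 0)).
  by rewrite /E -(opexpD hD) addrA addNr add0r.
rewrite -(linB (bop_lin (E_bop _))).
have [_ _ hE] := E_bop (- l); apply: le_trans (hE _) _.
rewrite ler_wpM2l ?expR_ge0 //.
have := opexp_taylor0 (y 0) (bop_scale (l - a m) hD).
by rewrite -cmodN opprB.
Qed.

End BinomialSeries.

(** * Asymptotics of the binomial coefficients *)

Section RealSums.
Variable R : realType.

(** Telescoping, from 1 / t^2 <= 2 / t - 2 / (t + 1) for t >= 1. *)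
Lemma sum_inv_sqr_le k m : (k <= m)%N ->
  \sum_(k <= j < m) (j.+1%:R ^+ 2)^-1 <= 2 * k.+1%:R^-1 - 2 * m.+1%:R^-1 :> R.
Proof.
move=> /subnK <-; elim: (m - k)%N => [|n IH]; first by rewrite add0n big_geq // subrr.
rewrite addSn big_nat_recr ?leq_addl //=.
set j := (n + k)%N in IH *.
apply: le_trans (lerD IH (lexx _)) _.
have j0 : 0 < j.+1%:R :> R by rewrite ltr0n.
have -> : j.+2%:R = j.+1%:R + 1 :> R by rewrite natr1.
have j1 : 1 <= j.+1%:R :> R by rewrite ler1n.
move: (j.+1%:R) j0 j1 => t t0 t1.
have t0' : 0 < t + 1 by rewrite addr_gt0.
rewrite -subr_ge0; move: (2 / k.+1%:R) => u.
have -> : u - 2 / (t + 1) - (u - 2 / t + t ^- 2) = (t - 1) / (t ^+ 2 * (t + 1)).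
  by field; rewrite !gt_eqF.
by rewrite divr_ge0 ?subr_ge0 // mulr_ge0 ?sqr_ge0 // ltW.
Qed.

Lemma sum_inv_sqrt_le m :
  \sum_(0 <= k < m) k.+1%:R^-1 * (Num.sqrt k.+1%:R)^-1 <= 6 :> R.
Proof.
(* The strengthened bound makes the induction work. With a and b the square roots of m + 1 and m +
   2, the step needs b (a + b) <= 6 a^2, which follows from b <= 2 a; hence the constant 6. *)
suff : \sum_(0 <= k < m) k.+1%:R^-1 * (Num.sqrt k.+1%:R)^-1 <= 6 - 6 / Num.sqrt m.+1%:R :> R.
  by move/le_trans; apply; rewrite lerBlDr lerDl divr_ge0 // sqrtr_ge0.
elim: m => [|m IH]; first by rewrite big_nil sqrtr1 divr1 subrr.
rewrite big_nat_recr //=; apply: le_trans (lerD IH (lexx _)) _.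
have -> : m.+1%:R = Num.sqrt m.+1%:R ^+ 2 :> R by rewrite sqr_sqrtr.
rewrite sqrtr_sqr ger0_norm ?sqrtr_ge0 //.
set a := Num.sqrt m.+1%:R; set b := Num.sqrt m.+2%:R.
have a0 : 0 < a by rewrite sqrtr_gt0.
have b0 : 0 < b by rewrite sqrtr_gt0.
have a2 : a ^+ 2 = m.+1%:R by rewrite sqr_sqrtr.
have b2 : b ^+ 2 = a ^+ 2 + 1 by rewrite a2 sqr_sqrtr // natr1.
have ab : b <= 2 * a.
  have a1 : 1 <= a ^+ 2 by rewrite a2 ler1n.
  by rewrite -ler_sqr ?nnegrE ?mulr_ge0 ?ltW // b2 exprMn; lra.
clearbody a b; rewrite -subr_ge0.
have -> : 6 - 6 / b - (6 - 6 / a + a ^- 2 * a^-1) =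
    (6 * a ^+ 2 * (b - a) - b) / (a ^+ 3 * b).
  by field; rewrite !gt_eqF.
apply: divr_ge0; last by apply: mulr_ge0; rewrite ?exprn_ge0 // ltW.
rewrite subr_ge0.
have ab0 : 0 < a + b by rewrite addr_gt0.
rewrite -(ler_pM2r ab0).
have -> : 6 * a ^+ 2 * (b - a) * (a + b) = 6 * a ^+ 2 * (b ^+ 2 - a ^+ 2) by ring.
rewrite b2 addrAC subrr add0r mulr1; nra.
Qed.

(** For the lower bound, ln(1 + t) = - ln(1 - t / (1 + t)) >= t / (1 + t) >= t - t^2. *)
Lemma ln1D_bounds (t : R) : 0 <= t -> t - t ^+ 2 <= ln (1 + t) <= t.
Proof.
move=> t0; have t1 : 0 < 1 + t by rewrite ltr_pwDl.
rewrite le_ln1Dx ?(lt_le_trans _ t0) ?ltrN10 // andbT.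
have h : -1 < - (t / (1 + t)).
  by rewrite ltrN2 ltr_pdivrMr // mul1r ltrDr.
have := le_ln1Dx h.
have -> : 1 - t / (1 + t) = (1 + t)^-1 by field; rewrite gt_eqF.
rewrite lnV ?posrE // lerN2; apply: le_trans.
rewrite ler_pdivlMr //.
have : 0 <= t ^+ 3 by rewrite exprn_ge0.
have -> : (t - t ^+ 2) * (1 + t) = t - t ^+ 3 by ring.
by rewrite lerBlDr lerDl.
Qed.

End RealSums.

Section Coefficients.
Variables (R : realType) (H : completeNormedModType R[i]).
Variables (N : H -> H) (K : R) (hN : bop N K).

(* The coefficients of (1 - z)^(N - 1). *)
Fixpoint binom_coef (k : nat) (x : H) : H :=
  if k is k'.+1 then binom_coef k' x - (k%:R^-1 : R[i]) *: N (binom_coef k' x) else x.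

Let E (a : R[i]) := opexp (fun x => a *: N x).
Let K0 : 0 <= K. Proof. by case: hN. Qed.
Let lN := bop_lin hN.

Lemma bop_binom_coef k : bop (binom_coef k) ((1 + K) ^+ k).
Proof.
elim: k => [|k IH]; first exact: bop_id.
have := bop_sub IH (bop_scale (k.+1%:R^-1) (bop_comp hN IH)).
apply: bop_le; rewrite exprS mulrDl mul1r lerD2l.
rewrite ler_piMl ?mulr_ge0 ?exprn_ge0 ?addr_ge0 // cmodV cmod_nat invf_le1 ?ltr0n //.
by rewrite ler1n.
Qed.

Lemma binom_coefS k x :
  k.+1%:R *: binom_coef k.+1 x = k%:R *: binom_coef k x + (binom_coef k x - N (binom_coef k x)).
Proof.
by rewrite /= scalerBr scalerA divff ?pnatr_eq0 // scale1r addrA -natr1 scalerDl scale1r.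
Qed.

Lemma binom_coef_comm k x : N (binom_coef k x) = binom_coef k (N x).
Proof. by elim: k => //= k IH; rewrite (linB lN) (linZ lN) IH. Qed.

Lemma binom_coefSr k x : binom_coef k.+1 x = binom_coef k (x - (k.+1%:R^-1 : R[i]) *: N x).
Proof.
by rewrite /= (linB (bop_lin (bop_binom_coef k))) (linZ (bop_lin (bop_binom_coef k))) binom_coef_comm.
Qed.

(* Q k is the k-th coefficient multiplied by (k + 1)^N; by [QS] and [F_near] it is a product of factors
   Id + O(k^-2), hence converges, and its limit is the operator C of the theorem. *)
Let Q k x := binom_coef k (E (ln k.+1%:R)%:C%C x).
Let F k x := E (ln (1 + k.+1%:R^-1))%:C%C x - (k.+1%:R^-1 : R[i]) *: N (E (ln (1 + k.+1%:R^-1))%:C%C x).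

Let QS k x : Q k.+1 x = Q k (F k x).
Proof.
rewrite /Q binom_coefSr /F; congr binom_coef.
have -> : (ln k.+2%:R)%:C%C = (ln k.+1%:R)%:C%C + (ln (1 + k.+1%:R^-1))%:C%C :> R[i].
  rewrite -rmorphD -lnM ?posrE ?ltr0n ?ltr_wpDr //.
  by rewrite mulrDr mulr1 divff ?pnatr_eq0 // natr1.
have hE := bop_opexp (bop_scale (ln k.+1%:R)%:C%C hN).
rewrite /E (opexpD hN) (linB (bop_lin hE)) (linZ (bop_lin hE)).
rewrite (opexp_comm _ (bop_scale _ hN) hN) // => y.
by rewrite (linZ lN).
Qed.

(** The three summands bound, after division by t^2 with t = 1 / (k + 1): the Taylor remainder of
    the exponential, (ln(1 + t) - t) N, and t N applied to the increment of the exponential. *)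
Let L := K ^+ 2 * expR K + K + K ^+ 2 * expR K.

Let expR_sub1 (a : R) : 0 <= a -> expR a - 1 <= a * expR a.
Proof.
move=> a0; rewrite lerBlDr -lerBlDl -{1}[expR a]mul1r -mulrBl.
by rewrite -[leRHS]expR0 -(addNr a) expRD ler_wpM2r ?expR_ge0 // expR_ge1Dx.
Qed.

(** In (1 - t N) exp(ln(1 + t) N) the first-order terms cancel, since ln(1 + t) = t + O(t^2). *)
Let F_near k x : hnorm (F k x - x) <= L * (k.+1%:R ^+ 2)^-1 * hnorm x.
Proof.
rewrite /F; set t := k.+1%:R^-1 : R; set dl := ln (1 + t).
have -> : (k.+1%:R^-1 : R[i]) = t%:C%C by rewrite /t fmorphV rmorph_nat.
have t0 : 0 <= t by rewrite invr_ge0.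
have t1 : t <= 1 by rewrite invf_le1 ?ltr0n // ler1n.
have /andP[d1 d2] := ln1D_bounds t0; rewrite -/dl in d1 d2.
have d0 : 0 <= dl by apply: ln_ge0; rewrite lerDl.
have hd := bop_scale dl%:C%C hN.
rewrite cmod_real ger0_norm // in hd.
have dK : dl * K <= t * K by rewrite ler_wpM2r.
have dK1 : dl * K <= K by rewrite (le_trans dK) // ler_piMl.
have dK0 : 0 <= dl * K by rewrite mulr_ge0.
set Ex := E dl%:C%C x.
have T1 : hnorm (Ex - x - dl%:C%C *: N x) <= t ^+ 2 * (K ^+ 2 * expR K) * hnorm x.
  apply: le_trans (opexp_taylor1 x hd) _; rewrite ler_wpM2r ?hnorm_ge0 // mulrA -exprMn.
  apply: ler_pM; rewrite ?sqr_ge0 ?expR_ge0 ?ler_expR //.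
  by rewrite ler_sqr ?nnegrE // mulr_ge0.
have T2 : hnorm (Ex - x) <= t * K * expR K * hnorm x.
  apply: le_trans (opexp_taylor0 x hd) _; rewrite ler_wpM2r ?hnorm_ge0 //.
  apply: le_trans (expR_sub1 dK0) _.
  by apply: ler_pM; rewrite ?expR_ge0 ?ler_expR.
have -> : Ex - t%:C%C *: N Ex - x =
   (Ex - x - dl%:C%C *: N x) + (dl - t)%:C%C *: N x - t%:C%C *: N (Ex - x).
  rewrite (linB lN) scalerBr rmorphB scalerBl.
  by rewrite subrKA opprB [_ - _ + (_ - _)]addrA subrK addrAC.
have [_ _ BN] := hN.
apply: le_trans (ler_hnormB _ _) _.
have -> : L * k.+1%:R ^- 2 * hnorm x =
   t ^+ 2 * (K ^+ 2 * expR K) * hnorm x + t ^+ 2 * (K * hnorm x) + t * (K * (t * K * expR K * hnorm x)).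
  by rewrite /L -exprVn -/t; ring.
apply: lerD; last first.
  rewrite hnormZr ger0_norm // ler_wpM2l //; apply: le_trans (BN _) _.
  by rewrite ler_wpM2l.
apply: le_trans (ler_hnormD _ _) _; apply: lerD => //.
rewrite hnormZr; apply: ler_pM; rewrite ?hnorm_ge0 ?BN //.
by rewrite distrC ger0_norm ?subr_ge0 // lerBlDr addrC -lerBlDr.
Qed.

(** The product of the factors 1 + L / (j + 1)^2 is at most the exponential of L times the sum of
    the 1 / (j + 1)^2, and that sum is at most 2. *)
Let B := expR (2 * L).
Let L0 : 0 <= L. Proof. by rewrite !addr_ge0 ?mulr_ge0 ?sqr_ge0 ?expR_ge0. Qed.

Let Q_bop k : bop (Q k) B.
Proof.
have lF j : linear (F j).
  have hE := bop_opexp (bop_scale (ln (1 + j.+1%:R^-1))%:C%C hN).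
  exact: bop_lin (bop_sub hE (bop_scale (j.+1%:R^-1) (bop_comp hN hE))).
have hF j : bop (F j) (1 + L * (j.+1%:R ^+ 2)^-1).
  split=> [||x]; first exact: lF.
    by rewrite addr_ge0 // mulr_ge0 // invr_ge0 sqr_ge0.
  rewrite -[F j x](subrK x); apply: le_trans (ler_hnormD _ _) _.
  by rewrite addrC mulrDl mul1r lerD2l F_near.
have hQ : bop (Q k) (expR (\sum_(0 <= j < k) L * (j.+1%:R ^+ 2)^-1)).
  elim: k => [|k IH].
    rewrite big_nil expR0; have := @bop_id R H; congr bop; apply/funext => x.
    by rewrite /Q /= ln1 /E (opexp0 hN).
  have := bop_comp IH (hF k).
  rewrite (_ : (fun x => _) = Q k.+1); last by apply/funext => x; rewrite QS.
  apply: bop_le; rewrite big_nat_recr //= expRD ler_wpM2l ?expR_ge0 //.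
  exact: expR_ge1Dx.
apply: bop_le hQ; rewrite ler_expR -mulr_sumr mulrC ler_wpM2r //.
apply: le_trans (sum_inv_sqr_le R (leq0n k)) _.
by rewrite invr1 mulr1 lerBlDr lerDl divr_ge0.
Qed.

Let Q_cauchy k m x : (k <= m)%N ->
  hnorm (Q m x - Q k x) <= 2 * B * L * k.+1%:R^-1 * hnorm x.
Proof.
move=> km; apply: (@le_trans _ _ (B * L * (2 * k.+1%:R^-1 - 2 * m.+1%:R^-1) * hnorm x)); last first.
  rewrite ler_wpM2r ?hnorm_ge0 // -!mulrA [leRHS]mulrCA ler_wpM2l ?expR_ge0 //.
  by rewrite [leRHS]mulrCA ler_wpM2l // lerBlDr lerDl divr_ge0.
apply: le_trans (ler_wpM2r (hnorm_ge0 _) (ler_wpM2l _ (sum_inv_sqr_le R km))); last first.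
  by rewrite mulr_ge0 ?expR_ge0.
elim: m km => [|m IH]; first by rewrite leqn0 => /eqP ->; rewrite subrr hnorm0 big_geq // mulr0 mul0r.
rewrite leq_eqVlt => /predU1P[->|]; first by rewrite subrr hnorm0 big_geq // mulr0 mul0r.
rewrite ltnS => km; rewrite big_nat_recr //= mulrDr mulrDl.
apply: le_trans (ler_hnorm_triangle (Q m x) _ _) _; rewrite addrC; apply: lerD; first exact: IH.
have [lQ _ hQ] := Q_bop m.
rewrite QS -(linB lQ); apply: le_trans (hQ _) _; rewrite -!mulrA ler_wpM2l ?expR_ge0 //.
by rewrite mulrA F_near.
Qed.

Lemma cvg_inv_nat (c : R) : c * k.+1%:R^-1 @[k --> \oo] --> (0 : R).
Proof. by rewrite -(mulr0 c); apply: cvgMr; exact: cvg_harmonic. Qed.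

Hypothesis decay : forall s x, 0 <= s -> hnorm (E (- s%:C%C) x) <= expR (- (s * 2^-1)) * hnorm x.

Lemma nat_pow_opp_le k x : hnorm (nat_pow_opp N k x) <= (Num.sqrt k.+1%:R)^-1 * hnorm x.
Proof.
have l0 : 0 <= ln k.+1%:R :> R by rewrite ln_ge0 // ler1n.
apply: le_trans (decay x l0) _; rewrite ler_wpM2r ?hnorm_ge0 //.
have sq : 0 < Num.sqrt k.+1%:R :> R by rewrite sqrtr_gt0.
have -> : ln k.+1%:R * 2^-1 = ln (Num.sqrt k.+1%:R) :> R.
  have -> : ln k.+1%:R = ln (Num.sqrt k.+1%:R ^+ 2) :> R by rewrite sqr_sqrtr.
  by rewrite lnXn // -[ln _ *+ 2]mulr_natr -mulrA divff ?mulr1.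
by rewrite expRN lnK.
Qed.

Let QP k x : Q k (nat_pow_opp N k x) = binom_coef k x.
Proof. by rewrite /Q /nat_pow_opp /E -(opexpD hN) subrr (opexp0 hN). Qed.

(** The second clause compares the two vectors for each x, not only operator norms: this is what
    lets the square summability of the terms of Y pass to the b_k eps_0. *)
Lemma binom_coef_asymptotics : exists (C : H -> H) (B' : R) (del : nat -> R),
  [/\ bop C B',
      forall k x, hnorm (binom_coef k x) <= B' * hnorm (nat_pow_opp N k x),
      forall k, bop (fun x => binom_coef k x - C (nat_pow_opp N k x)) (del k) &
      exists c, forall m, \sum_(0 <= k < m) del k <= c].
Proof.
have hl x := @hcauchy_cvg R H (Q ^~ x) (fun k => 2 * B * L * k.+1%:R^-1 * hnorm x) (fun k m => @Q_cauchy k m x).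
have z (x : H) : 2 * B * L * k.+1%:R^-1 * hnorm x @[k --> \oo] --> (0 : R).
  by rewrite -(mul0r (hnorm x)); apply: cvgMl; exact: cvg_inv_nat.
have /choice[C hC] x := hl x (z x).
have bC : bop C B.
  by apply: (@bop_limit _ _ Q) => // x; have [] := hC x.
have B0 : 0 <= B by exact: expR_ge0.
exists C, B, (fun k => 2 * B * L * (k.+1%:R^-1 * (Num.sqrt k.+1%:R)^-1)); split => //.
- by move=> k x; rewrite -QP; have [_ _ ->] := Q_bop k.
- have hP k := bop_opexp (bop_scale (- (ln k.+1%:R)%:C%C) hN).
  move=> k; have [l _ _] := bop_sub (bop_binom_coef k) (bop_comp bC (hP k)).
  split => // [|x]; first by rewrite !mulr_ge0 ?invr_ge0 ?sqrtr_ge0.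
  rewrite -QP hnormBC; have [_ h] := hC (nat_pow_opp N k x); apply: le_trans (h k) _.
  rewrite mulrA -[leRHS]mulrA ler_wpM2l ?nat_pow_opp_le // !mulr_ge0 // invr_ge0 //.
- exists (2 * B * L * 6) => m; rewrite -mulr_sumr ler_wpM2l ?sum_inv_sqrt_le //.
  by rewrite !mulr_ge0.
Qed.

Lemma cvg_binom_coef x : binom_coef k x @[k --> \oo] --> (0 : H).
Proof.
have [C [B' [del [bC hb _ _]]]] := binom_coef_asymptotics.
have B'0 : 0 <= B' by case: bC.
apply/hcvgP; under eq_fun do rewrite subr0.
have h : B' * ((Num.sqrt k.+1%:R)^-1 * hnorm x) @[k --> \oo] --> (0 : R).
  rewrite -(mulr0 B') -(mul0r (hnorm x)); apply: cvgMr; apply: cvgMl.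
  have -> : (fun k => (Num.sqrt k.+1%:R)^-1 : R) = (fun k => Num.sqrt (k.+1%:R^-1)).
    by apply/funext => k; rewrite sqrtrV.
  rewrite -sqrtr0; apply: continuous_cvg; first exact: sqrt_continuous.
  exact: cvg_harmonic.
apply: (squeeze_cvgr _ (cvg_cst 0) h); apply: nearW => k; rewrite hnorm_ge0 /=.
by apply: le_trans (hb k x) _; rewrite ler_wpM2l ?nat_pow_opp_le.
Qed.

End Coefficients.

(** * Adjoints and positive operators *)

Section HilbertSpace.
Variables (R : realType) (H : completeNormedModType R[i]).
Variables (ip : {dot H for Num.conj}) (hip : induces_norm ip).
Implicit Types (x y z : H) (A B : H -> H).

Lemma ip_inj y z : (forall x, ip x y = ip x z) -> y = z.
Proof.
move=> h; apply/eqP; rewrite -subr_eq0 -hnorm_eq0 -sqrf_eq0 (hnorm_sqr hip).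
by rewrite ipBr h subrr.
Qed.

(** The representing vector minimizes J(x) = |x|^2 - 2 Re f(x). The first variation at the minimum
    identifies the real parts, and replacing x by - i x the imaginary parts. *)
Lemma riesz_representation (f : H -> R[i]) (K : R) :
  (forall a x y, f (a *: x + y) = a * f x + f y) ->
  (forall x, cmod (f x) <= K * hnorm x) ->
  exists u, forall x, f x = ip x u.
Proof.
move=> lf bf.
have f0 : f 0 = 0 by have := lf (-1) 0 0; rewrite scaler0 addr0 mulN1r addNr.
have fD x y : f (x + y) = f x + f y by have := lf 1 x y; rewrite scale1r mul1r.
have fZ a x : f (a *: x) = a * f x by have := lf a x 0; rewrite !addr0 f0 addr0.
have fN x : f (- x) = - f x by rewrite -scaleN1r fZ mulN1r.
pose J x := hnorm x ^+ 2 - 2 * complex.Re (f x).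
have J_lb x : - K ^+ 2 <= J x.
  have h1 : complex.Re (f x) <= K * hnorm x.
    by apply: le_trans (bf x); apply: le_trans (Re_le_cmod _); exact: ler_norm.
  have := sqr_ge0 (hnorm x - K); rewrite /J; nra.
pose I := inf (range J).
have hI : has_inf (range J).
  split; first by exists (J 0), 0.
  by exists (- K ^+ 2) => _ [x _ <-].
have I_le x : I <= J x by apply: ge_inf; [exact: hI.2|exists x].
have /choice[u hu] (n : nat) : exists x, J x < I + n.+1%:R^-1.
  have n0 : 0 < n.+1%:R^-1 :> R by rewrite invr_gt0.
  by have [_ [x _ <-] hx] := inf_adherent n0 hI; exists x.
have ud n m : (n <= m)%N -> hnorm (u m - u n) <= Num.sqrt (4 * n.+1%:R^-1).
  move=> nm; rewrite -ler_sqr ?nnegrE ?hnorm_ge0 ?sqrtr_ge0 // sqr_sqrtr ?mulr_ge0 //.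
  (* By the parallelogram law |u_m - u_n|^2 equals 2 J(u_m) + 2 J(u_n) - 4 J at the midpoint, and J
     at the midpoint is at least the infimum. *)
  have h1 := I_le ((2^-1 : R)%:C%C *: (u m + u n)).
  have := parallelogram hip (u m) (u n).
  have hm := hu m; have hn := hu n.
  have mn : m.+1%:R^-1 <= n.+1%:R^-1 :> R by rewrite lef_pV2 ?posrE // ler_nat.
  move: h1; rewrite /J hnormZr ger0_norm ?invr_ge0 // exprMn fZ ReM_real fD ReD.
  move: hm hn mn; rewrite /J.
  set a := hnorm (u m) ^+ 2; set b := hnorm (u n) ^+ 2; set c := complex.Re (f (u m)).
  set e := complex.Re (f (u n)); set p := hnorm (u m + u n) ^+ 2; set q := hnorm (u m - u n) ^+ 2.
  move: (n.+1%:R^-1) (m.+1%:R^-1) => s t; lra.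
have s0 : Num.sqrt (4 * n.+1%:R^-1) @[n --> \oo] --> (0 : R).
  rewrite -sqrtr0; apply: continuous_cvg; first exact: sqrt_continuous.
  by rewrite -(mulr0 4); apply: cvgMr; exact: cvg_harmonic.
have [l [ul _]] := hcauchy_cvg ud s0.
have fc : complex.Re (f (u n)) @[n --> \oo] --> complex.Re (f l).
  apply/cvgrPdist_le => e e0.
  have K0 : 0 < `|K| + 1 by rewrite ltr_wpDl.
  have := (hcvgP _ _).1 ul => /cvgrPdist_le/(_ (e / (`|K| + 1)) (divr_gt0 e0 K0)).
  apply: filterS => n; rewrite sub0r normrN ger0_norm ?hnorm_ge0 // ler_pdivlMr // => h.
  rewrite -ReN -fN -ReD -fD; apply: le_trans (Re_le_cmod _) _; apply: le_trans (bf _) _.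
  rewrite hnormBC; apply: le_trans h; rewrite mulrC ler_wpM2l ?hnorm_ge0 //.
  by rewrite (le_trans (ler_norm _)) // lerDl.
have Jl : J l <= I.
  have h1 : J (u n) @[n --> \oo] --> J l.
    apply: cvgB; last by apply: cvgMr.
    rewrite expr2; under eq_fun do rewrite expr2.
    by apply: cvgM; apply: continuous_cvg; try exact: hnorm_continuous; exact: ul.
  have h2 : I + n.+1%:R^-1 @[n --> \oo] --> I.
    by rewrite -[X in _ --> X]addr0; apply: cvgD; [exact: cvg_cst|exact: cvg_harmonic].
  by apply: (ler_cvg_to h1 h2); apply: nearW => n; apply: ltW.
have re x : complex.Re (f x) = complex.Re (ip x l).
  pose d := complex.Re (ip x l) - complex.Re (f x).
  have h (t : R) : 0 <= t ^+ 2 * hnorm x ^+ 2 + 2 * t * d.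
    have := le_trans Jl (I_le (l + t%:C%C *: x)).
    rewrite /J (hnorm_sqrD hip) hnormZr exprMn real_normK ?num_real // fD fZ ReD ReM_real.
    by rewrite (Re_ipC ip l) ipZl ReM_real /d; lra.
  suff d0 : d = 0 by apply/eqP; rewrite eq_sym -subr_eq0; apply/eqP.
  have n0 : 0 < hnorm x ^+ 2 + 1 by rewrite ltr_wpDl ?sqr_ge0.
  (* The optimal choice would be - d / |x|^2; adding 1 keeps the denominator positive when x = 0. *)
  have := h (- d / (hnorm x ^+ 2 + 1)).
  set w := hnorm x ^+ 2 in n0 *.
  have -> : (- d / (w + 1)) ^+ 2 * w + 2 * (- d / (w + 1)) * d = - (d ^+ 2 * ((w + 2) / (w + 1) ^+ 2)).
    by field; rewrite gt_eqF.
  have w2 : 0 < (w + 2) / (w + 1) ^+ 2.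
    by rewrite divr_gt0 ?exprn_gt0 // (lt_trans n0) // ltrD2l ltr1n.
  rewrite oppr_ge0 pmulr_lle0 // => h'; apply/eqP; rewrite -sqrf_eq0 eq_le h' sqr_ge0 //.
exists l => x; apply/eqP; rewrite eq_complex re eqxx /=; apply/eqP.
have := re (- 'i%C *: x); rewrite fZ ipZl.
by rewrite !mulNr !ReN ![('i%C) * _]mulrC !ReiNIm !opprK.
Qed.

Lemma adjoint_exists A K : bop A K -> exists B, is_adjoint ip A B /\ bop B K.
Proof.
move=> [lA K0 BA].
have /choice[B hB] y : exists u, forall x, ip (A x) y = ip x u.
  apply: (@riesz_representation _ (K * hnorm y)) => [a u v|x].
    by rewrite lA ipDl ipZl.
  apply: le_trans (ip_le hip _ _) _.
  by rewrite [K * _]mulrC -mulrA [leRHS]mulrC ler_wpM2r ?hnorm_ge0.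
have bB : bop B K.
  split=> // [a u v|y].
    apply: ip_inj => x; rewrite -hB ipDr ipZr.
    by rewrite ipDr ipZr !hB.
  have [->|y0] := eqVneq (B y) 0; first by rewrite hnorm0 mulr_ge0 ?hnorm_ge0.
  have p : 0 < hnorm (B y) by rewrite lt_def hnorm_eq0 y0 hnorm_ge0.
  rewrite -(ler_pM2l p) -expr2 (hnorm_sqr hip) -hB.
  apply: le_trans (Re_ip_le hip _ _) _; rewrite mulrA ler_wpM2r ?hnorm_ge0 //.
  by rewrite mulrC.
exists B; split => //; split; last by move=> x y; exact: hB.
exact: bop_bounded bB.
Qed.

Lemma adjointP A K : bop A K -> is_adjoint ip A (adjoint ip A) /\ bop (adjoint ip A) K.
Proof.
move=> hA; have [B [aB bB]] := adjoint_exists hA.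
have aA : is_adjoint ip A (adjoint ip A) by apply: (getPex (P := is_adjoint ip A)); exists B.
split=> //; suff -> : adjoint ip A = B by [].
apply/funext => y; apply: ip_inj => x.
by have [_ <-] := aA; have [_ <-] := aB.
Qed.

Lemma ip_adjoint A K x y : bop A K -> ip (A x) y = ip x (adjoint ip A y).
Proof. by move=> /adjointP[[_ ->]]. Qed.

(** Nonnegativity in [R[i]] includes being real, so the defect s vanishes on the diagonal.
    Polarization at (x, y) and (x, i y) then makes it both antisymmetric and symmetric. *)
Lemma positive_self_adjoint A x y : positive_op ip A -> ip (A x) y = ip x (A y).
Proof.
move=> [bA pA]; have [K hA] := (bounded_op_bop A).1 bA; have lA := bop_lin hA.
pose s x y := ip (A x) y - ip x (A y).
have sxx z : s z z = 0.
  have h : ip (A z) z = Num.conj (ip (A z) z).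
    by apply/esym; exact: (CrealP (ger0_real (pA z))).
  by rewrite /s h -ipC subrr.
have sDl u v z : s (u + v) z = s u z + s v z.
  by rewrite /s (linD lA) !ipDl opprD addrACA.
have sDr u v z : s z (u + v) = s z u + s z v.
  by rewrite /s (linD lA) !ipDr opprD addrACA.
have sC u v : s u v + s v u = 0.
  by have := sxx (u + v); rewrite sDl !sDr !sxx addr0 add0r.
have h1 := sC x y; have h2 := sC x ('i%C *: y).
have e : s x ('i%C *: y) + s ('i%C *: y) x = 'i%C * (s y x - s x y).
  rewrite /s (linZ lA) !ipZl !ipZr.
  have -> : Num.conj ('i%C : R[i]) = - 'i%C by apply/eqP; rewrite eq_complex /= oppr0 !eqxx.
  by ring.
rewrite e in h2; apply/eqP; rewrite -subr_eq0 -/(s x y).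
have i0 : ('i%C : R[i]) != 0 by rewrite eq_complex /= oner_eq0 andbF.
move/eqP: h2; rewrite mulf_eq0 (negbTE i0) /= subr_eq0 => /eqP yx.
by move/eqP: h1; rewrite yx -mulr2n -mulr_natl mulf_eq0 pnatr_eq0.
Qed.

(** Positivity of the form at x - K^(-1) A x, expanded; no square root of A is involved. *)
Lemma positive_norm_le A K x : 0 < K -> bop A K -> positive_op ip A ->
  hnorm (A x) ^+ 2 <= K * complex.Re (ip (A x) x).
Proof.
move=> Kp hA pA; have [_ /(_ (x - (K^-1)%:C%C *: A x))] := pA.
have lA := bop_lin hA.
rewrite lecE => /andP[_ /=]; rewrite (linB lA) (linZ lA) ipBl !ipBr.
rewrite !ipZl !ipZr /=.
have -> : Num.conj ((K^-1)%:C%C : R[i]) = (K^-1)%:C%C by exact: conjc_real.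
rewrite !ReD !ReN !ReD !ReN !ReM_real.
have -> : complex.Re (ip (A (A x)) x) = hnorm (A x) ^+ 2.
  by rewrite (positive_self_adjoint _ _ pA) -(hnorm_sqr hip).
rewrite -(hnorm_sqr hip).
have : complex.Re (ip (A (A x)) (A x)) <= K * hnorm (A x) ^+ 2.
  apply: le_trans (Re_ip_le hip _ _) _; have [_ _ hA'] := hA.
  by rewrite expr2 mulrA ler_wpM2r ?hnorm_ge0.
set p := complex.Re (ip (A (A x)) (A x)); set q := hnorm (A x) ^+ 2; set r := complex.Re (ip (A x) x).
move=> pq h.
have h2 : K^-1 * p <= q by rewrite ler_pdivrMl.
have h3 : K^-1 * (K^-1 * p) <= K^-1 * q by rewrite ler_wpM2l // invr_ge0 ltW.
rewrite -ler_pdivrMl //; lra.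
Qed.

Lemma positive_sqrt_unique A B : positive_op ip A -> positive_op ip B ->
  (forall x, B (B x) = A (A x)) -> B = A.
Proof.
(* With T = B - A one has B T = - T A, hence (1 + c B)^m T = T (1 - c A)^m is bounded in m. *)
suff key A' B' x : positive_op ip A' -> positive_op ip B' ->
    (forall x, B' (B' x) = A' (A' x)) -> B' (B' x - A' x) = 0.
  move=> pA pB BA; apply/funext => x.
  have [K hA] := (bounded_op_bop A).1 pA.1; have lA := bop_lin hA.
  have [L hB] := (bounded_op_bop B).1 pB.1; have lB := bop_lin hB.
  have h1 := key A B x pA pB BA.
  have h2 : A (B x - A x) = 0.
    have := key B A x pB pA (fun x => esym (BA x)).
    by rewrite -[A x - B x]opprB (linN lA) => /eqP; rewrite oppr_eq0 => /eqP.
  apply/eqP; rewrite -subr_eq0 -hnorm_eq0 -sqrf_eq0 (hnorm_sqr hip).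
  rewrite ipBl (positive_self_adjoint _ _ pA) (positive_self_adjoint _ _ pB).
  by rewrite h1 h2 !ip0r subrr.
move=> {A B} pA pB BA.
have [KA hA0] := (bounded_op_bop A').1 pA.1; have [KB hB] := (bounded_op_bop B').1 pB.1.
have {hA0} [K [K0 hA]] : exists K, 0 < K /\ bop A' K.
  exists (KA + 1); split; first by case: hA0 => _ KA0 _; rewrite ltr_wpDl.
  by apply: bop_le hA0; rewrite lerDl.
have lA := bop_lin hA; have lB := bop_lin hB.
pose c := K^-1; have c0 : 0 < c by rewrite invr_gt0.
pose T x := B' x - A' x.
have bT := bop_sub hB hA; have lT : linear T by exact: bop_lin bT.
have BT y : B' (T y) = - T (A' y) by rewrite /T (linB lB) BA opprB.
pose S y := y - c%:C%C *: A' y.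
have S_le y : hnorm (S y) <= hnorm y.
  rewrite -ler_sqr ?nnegrE ?hnorm_ge0 // (hnorm_sqrB hip) hnormZr gtr0_norm //.
  rewrite (Re_ipC ip) ipZl ReM_real exprMn.
  have := positive_norm_le y K0 hA pA.
  have r0 : 0 <= complex.Re (ip (A' y) y) by have := pA.2 y; rewrite lecE => /andP[].
  move=> h; have h2 : c * (c * hnorm (A' y) ^+ 2) <= c * complex.Re (ip (A' y) y).
    by rewrite ler_wpM2l ?(ltW c0) // /c ler_pdivrMl.
  have : 0 <= c * complex.Re (ip (A' y) y) by rewrite mulr_ge0 // ltW.
  nra.
pose G y := y + c%:C%C *: B' y.
have GT y : G (T y) = T (S y).
  by rewrite /S (linB lT) (linZ lT) /G BT scalerN.
have Gm m y : iter m G (T y) = T (iter m S y).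
  by elim: m => //= m ->; rewrite GT.
have Sm m y : hnorm (iter m S y) <= hnorm y.
  by elim: m => //= m; apply: le_trans; exact: S_le.
pose be y := complex.Re (ip (B' y) y).
have be0 y : 0 <= be y by have := pB.2 y; rewrite lecE => /andP[].
have beG y : be y <= be (G y).
  rewrite /be {2}/G (linD lB) (linZ lB) ipDl !ipDr !ipZl !ipZr.
  have -> : Num.conj (c%:C%C : R[i]) = c%:C%C by exact: conjc_real.
  rewrite !ReD !ReM_real.
  have -> : complex.Re (ip (B' (B' y)) y) = hnorm (B' y) ^+ 2.
    by rewrite (positive_self_adjoint _ _ pB) -(hnorm_sqr hip).
  rewrite -(hnorm_sqr hip); have := be0 (B' y); rewrite /be => h.
  by rewrite -addrA lerDl !addr_ge0 // ?mulr_ge0 ?sqr_ge0 ?hnorm_ge0 ?(ltW c0).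
have nG y : hnorm y ^+ 2 + 2 * c * be y <= hnorm (G y) ^+ 2.
  rewrite /G (hnorm_sqrD hip) (Re_ipC ip) ipZl ReM_real -/(be y) mulrA.
  by rewrite lerD2r lerDl sqr_ge0.
have beGm m y : be y <= be (iter m G y).
  by elim: m => //= m h; apply: le_trans h (beG _).
(* Each application of G adds at least 2 c be(y) to the squared norm, because be does not decrease
   along the orbit. On a bounded orbit this forces be = 0. *)
have low m y : hnorm y ^+ 2 + m%:R * (2 * c * be y) <= hnorm (iter m G y) ^+ 2.
  elim: m => [|m IH]; first by rewrite mul0r addr0.
  apply: le_trans (nG _); rewrite -natr1 mulrDl mul1r addrA lerD //.
  by apply: ler_wpM2l; [rewrite mulr_ge0 ?(ltW c0)|exact: beGm].
pose V := ((KB + K) * hnorm x) ^+ 2.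
have bound m : m%:R * (2 * c * be (T x)) <= V.
  have := low m (T x); rewrite Gm => h.
  apply: le_trans (_ : hnorm (T (iter m S x)) ^+ 2 <= _).
    by apply: le_trans h; rewrite lerDr sqr_ge0.
  have [_ KT hT] := bT.
  rewrite ler_sqr ?nnegrE ?mulr_ge0 ?hnorm_ge0 //; apply: le_trans (hT _) _.
  by rewrite ler_wpM2l.
have be00 : be (T x) = 0.
  apply/eqP; rewrite eq_le be0 andbT leNgt; apply/negP => bp.
  have bp2 : 0 < 2 * c * be (T x) by rewrite !mulr_gt0.
  have := bound (Num.truncn (V / (2 * c * be (T x)))).+1.
  by rewrite leNgt -ltr_pdivrMr // Num.Theory.truncnS_gt.
have KB1 : 0 < KB + 1 by case: hB => _ KB0 _; rewrite ltr_wpDl.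
have hB1 : bop B' (KB + 1) by apply: bop_le hB; rewrite lerDl.
have := positive_norm_le (T x) KB1 hB1 pB; rewrite -/(be _) be00 mulr0 => h.
by apply/eqP; rewrite -hnorm_eq0 -sqrf_eq0 eq_le h sqr_ge0.
Qed.

(** [absop] is a chosen positive square root of A^H A. A positive A is one such root, so uniqueness
    determines the choice. *)
Lemma absop_positive A : positive_op ip A -> absop ip A = A.
Proof.
move=> pA; have [K hA] := (bounded_op_bop A).1 pA.1.
have adj : adjoint ip A = A.
  apply/funext => y; apply: ip_inj => x.
  by rewrite -(ip_adjoint _ _ hA) (positive_self_adjoint _ _ pA).
have [pB BB] : [set B | positive_op ip B /\ B \o B = A \o A] (absop ip A).
  by rewrite /absop adj; apply: getPex; exists A.
apply: positive_sqrt_unique => // x.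
by have := congr1 (@^~ x) BB.
Qed.

Definition orthonormal_set (E : set H) := forall e f, E e -> E f -> ip e f = (e == f)%:R.

Lemma bessel (E : set H) (s : seq H) x : orthonormal_set E -> uniq s ->
  (forall e, e \in s -> E e) -> \sum_(e <- s) cmod (ip x e) ^+ 2 <= hnorm x ^+ 2.
Proof.
move=> oE; elim: s x => [|e s IH] x; first by rewrite big_nil sqr_ge0.
move=> /= /andP[es us] sE; rewrite big_cons.
(* Induction by removing from x its component along e, which leaves the coefficients along the other
   vectors unchanged. *)
have Ee : E e by apply: sE; rewrite mem_head.
have sE' f : f \in s -> E f by move=> fs; apply: sE; rewrite inE fs orbT.
set x' := x - ip x e *: e.
have e1 : hnorm e ^+ 2 = 1 by rewrite (hnorm_sqr hip) oE // eqxx.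
have -> : hnorm x ^+ 2 = cmod (ip x e) ^+ 2 + hnorm x' ^+ 2.
  rewrite /x' (hnorm_sqrB hip) hnormZ exprMn e1 mulr1 ipZr.
  by rewrite [Num.conj _ * _]mulrC Re_mul_conj; ring.
rewrite lerD2l; apply: le_trans (IH x' us sE').
rewrite le_eqVlt; apply/orP; left; apply/eqP; rewrite !big_seq.
apply: eq_bigr => f fs; rewrite /x' ipBl ipZl (oE e f Ee (sE' f fs)).
have -> : (e == f) = false by apply/negbTE; apply: contraNneq es => ->.
by rewrite mulr0 subr0.
Qed.

(** The basis in [trace] is a chosen one, so some basis must exist. Zorn's lemma gives a maximal
    orthonormal set; it is total because a nonzero vector orthogonal to it could be normalized and
    added. *)
Lemma onb_orthonormal : orthonormal_set (get (is_onb ip)).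
Proof.
suff [E hE] : exists E, is_onb ip E by have [] : is_onb ip (get (is_onb ip)) by apply: getPex; exists E.
have [|E [oE mE]] := @Zorn_bigcup H orthonormal_set.
  move=> F FP tF e f [X FX Xe] [Y FY Yf].
  have [XY|YX] := tF X Y FX FY.
    by apply: (FP Y FY) => //; exact: XY.
  by apply: (FP X FX) => //; exact: YX.
exists E; split=> // x xE; apply/eqP/negP => /negP x0.
have nx : 0 < hnorm x by rewrite lt_def hnorm_eq0 x0 hnorm_ge0.
pose u := ((hnorm x)^-1)%:C%C *: x.
have uu : ip u u = 1.
  rewrite (ipxx hip) /u hnormZr gtr0_norm ?invr_gt0 // mulVf ?gt_eqF //.
  by rewrite expr1n.
have uE e : E e -> ip u e = 0 by move=> Ee; rewrite /u ipZl xE // mulr0.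
have Eu : ~ E u by move=> Eu; have := uE u Eu; rewrite uu => /eqP; rewrite oner_eq0.
apply: (mE (E `|` [set u])).
  split; first exact: subsetUl.
  by move=> h; apply: Eu; apply: h; right.
move=> e f [Ee|->] [Ef|->].
- exact: oE.
- rewrite ipC uE // (_ : (e == u) = false) ?rmorph0 //.
  by apply/eqP => eu; apply: Eu; rewrite -eu.
- rewrite uE // (_ : (u == f) = false) //.
  by apply/eqP => eu; apply: Eu; rewrite eu.
- by rewrite eqxx.
Qed.

End HilbertSpace.

(** * Random vectors and white noise *)

Section Measurability.
Variables (R : realType) (d : measure_display) (T : measurableType d).

(* Trace norms of operator-valued functions are integrated below without being known to be measurable. *)
Lemma ge0_le_integral_nonmeasurable (mu : {measure set T -> \bar R}) (D : set T) (f g : T -> \bar R) :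
  (forall x, D x -> 0 <= f x)%E -> (forall x, D x -> f x <= g x)%E ->
  (\int[mu]_(x in D) f x <= \int[mu]_(x in D) g x)%E.
Proof.
move=> f0 fg; rewrite !ge0_integralE //; last by move=> x Dx; apply: le_trans (f0 x Dx) (fg x Dx).
apply: le_ereal_sup => _ [h hf <-]; exists h => // x; apply: le_trans (hf x) _.
by rewrite /patch; case: ifPn => // /set_mem; exact: fg.
Qed.

Variable H : completeNormedModType R[i].

Lemma hmeasurable_continuous_comp (D : set T) (f : T -> H) (phi : H -> R) :
  hmeasurable D f -> continuous phi -> measurable_fun D (phi \o f).
Proof.
move=> mf cphi mD.
apply: (measurability _ (RGenOInfty.measurableE R)) => //.
move=> _ [_ [x ->] <-]; rewrite comp_preimage; apply: mf => //.
apply: sub_sigma_algebra; apply: open_comp; last exact: interval_open.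
by move=> y _; exact: cphi.
Qed.

Lemma hmeasurable_comp (D : set T) (f : T -> H) (A : H -> H) :
  hmeasurable D f -> continuous A -> hmeasurable D (A \o f).
Proof.
move=> mf cA mD.
apply: (@measurability _ _ T (g_sigma_algebraType (@open H)) D _ (@open H) erefl) => //.
move=> _ [Op hOp <-]; rewrite comp_preimage; apply: mf => //.
by apply: sub_sigma_algebra; apply: open_comp => // y _; exact: cA.
Qed.

Hypothesis sepH : separable H.

Lemma dense_sequence : exists q : nat -> H, forall x e, 0 < e -> exists n, hnorm (x - q n) < e.
Proof.
have [Q cQ dQ] := sepH.
have near x e : 0 < e -> exists2 y, Q y & hnorm (x - y) < e.
  move=> e0; have e0' : 0 < e%:C%C by rewrite ltcR.
  have [|y [/= h Qy]] := dQ (ball x e%:C%C) _ (ball_open x _).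
    by exists x; exact: ballxx.
  by exists y => //; rewrite -ltcR -hnormE; move: h; rewrite -ball_normE.
have /pfcard_geP[Q0|[f]] := cQ.
  by have [y] := near 0 1 ltr01; rewrite Q0.
exists f => x e e0; have [y Qy xy] := near x e e0.
have [n _ fn] := @surj _ _ _ _ f y Qy.
by exists n; rewrite fn.
Qed.

(** By separability every open set is a countable union of balls with centers in a dense sequence
    and radii 1 / (j + 1), so distances to points decide measurability. *)
Lemma hmeasurableP (D : set T) (f : T -> H) :
  (forall y, measurable_fun D (fun w => hnorm (f w - y))) -> hmeasurable D f.
Proof.
move=> mf mD; have [q hq] := dense_sequence.
apply: (@measurability _ _ T (g_sigma_algebraType (@open H)) D _ (@open H) erefl) => //.
move=> _ [Op hOp <-].
pose ok (p : nat * nat) := forall x, hnorm (x - q p.1) < p.2.+1%:R^-1 -> Op x.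
have -> : D `&` f @^-1` Op =
    \bigcup_(i in [set: nat]) \bigcup_(j in [set j | ok (i, j)])
      (D `&` (fun w => hnorm (f w - q i)) @^-1` `]-oo, j.+1%:R^-1[).
  apply/seteqP; split => [w [Dw /= Ow]|w [i _ [j /= okij [Dw]]]].
    have [e0 e0p he] : exists2 e : R, 0 < e & forall x, hnorm (f w - x) < e -> Op x.
      have /nbhs_ballP[[e e'] /= ep he] : nbhs (f w) Op by apply: open_nbhs_nbhs.
      move: ep; rewrite ltcE /= => /andP[/eqP e'0 ep].
      exists e => // x hx; apply: he; rewrite -ball_normE /= hnormE e'0 ltcR //.
    pose j := Num.truncn (2 / e0).
    have je : j.+1%:R^-1 < e0 / 2.
      rewrite invf_plt ?posrE ?divr_gt0 // ?ltr0n // invf_div.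
      exact: Num.Theory.truncnS_gt.
    have [i hi] := hq (f w) (j.+1%:R^-1) (ltac:(by rewrite invr_gt0 ltr0n)).
    exists i => //; exists j; last by split => //=; rewrite in_itv.
    move=> x /= hx; apply: he; apply: le_lt_trans (ler_hnorm_triangle (q i) _ _) _.
    by rewrite [e0]splitr ltrD // ?(lt_trans hi) // hnormBC (lt_trans hx).
  rewrite /= in_itv /= => h; split => //; exact: okij.
apply: bigcup_measurable => i _; apply: bigcup_measurable => j _.
by apply: mf => //; exact: measurable_itv.
Qed.

(** |f + g - y| < r holds exactly when |f - q_n| + |g + q_n - y| < r for some point q_n of a dense
    sequence: a countable union, with f and g in separate terms. *)
Lemma hmeasurableD (D : set T) (f g : T -> H) :
  hmeasurable D f -> hmeasurable D g -> hmeasurable D (fun w => f w + g w).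
Proof.
move=> mf mg; apply: hmeasurableP => y mD.
have [q hq] := dense_sequence.
have nc (z : H) : continuous (fun x : H => hnorm (x + z)).
  move=> x; apply: continuous_comp; last exact: hnorm_continuous.
  by apply: cvgD; [exact: cvg_id|exact: cvg_cst].
have mh n : measurable_fun D (fun w => hnorm (f w - q n) + hnorm (g w + (q n - y))).
  apply: measurable_funD.
    exact: (hmeasurable_continuous_comp mf (nc (- q n))).
  exact: (hmeasurable_continuous_comp mg (nc (q n - y))).
apply: (measurability _ (RGenInftyO.measurableE R)) => //.
move=> _ [_ [r ->] <-].
have -> : D `&` (fun w => hnorm (f w + g w - y)) @^-1` `]-oo, r[ =
    \bigcup_n (D `&` (fun w => hnorm (f w - q n) + hnorm (g w + (q n - y))) @^-1` `]-oo, r[).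
  apply/seteqP; split => [w [Dw]|w [n _ [Dw]]] /=; rewrite !in_itv /= => h.
    have e0 : 0 < (r - hnorm (f w + g w - y)) / 2 by rewrite divr_gt0 ?subr_gt0.
    have [n hn] := hq (f w) _ e0.
    exists n => //; split => //=; rewrite in_itv /=.
    have h2 : hnorm (g w + (q n - y)) <= hnorm (f w + g w - y) + hnorm (f w - q n).
      have -> : g w + (q n - y) = (f w + g w - y) - (f w - q n).
        by rewrite opprB [f w + g w]addrC -!addrA; congr (_ + _);
          rewrite [RHS]addrCA [f w + _]addrCA subrr addr0 addrC.
      exact: ler_hnormB.
    by move: hn h2; lra.
  split => //; apply: le_lt_trans h.
  have -> : f w + g w - y = (f w - q n) + (g w + (q n - y)).
    by rewrite [g w + _]addrCA [RHS]addrA subrK addrA.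
  exact: ler_hnormD.
by apply: bigcupT_measurable => n; apply: mh => //; exact: measurable_itv.
Qed.

Lemma hmeasurable_sum (D : set T) (f : nat -> T -> H) m : (forall k, hmeasurable D (f k)) ->
  hmeasurable D (fun w => \sum_(0 <= k < m) f k w).
Proof.
move=> mf; elim: m => [|m IH].
  by apply: hmeasurableP => y; under eq_fun do rewrite big_nil; exact: measurable_cst.
under eq_fun do rewrite big_nat_recr //=.
exact: hmeasurableD.
Qed.

Lemma hmeasurable_limit (D : set T) (f : nat -> T -> H) (g : T -> H) :
  (forall m, hmeasurable D (f m)) -> (forall w, D w -> f m w @[m --> \oo] --> g w) ->
  hmeasurable D g.
Proof.
move=> mf fg; apply: hmeasurableP => y.
have nc : continuous (fun x : H => hnorm (x - y)).
  move=> x; apply: continuous_comp; last exact: hnorm_continuous.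
  by apply: cvgD; [exact: cvg_id|exact: cvg_cst].
apply: (@measurable_fun_cvg _ _ _ _ (fun m w => hnorm (f m w - y))) => [m|w Dw].
  exact: (hmeasurable_continuous_comp (mf m) nc).
exact: (cvg_comp _ _ (fg w Dw) (nc (g w))).
Qed.

End Measurability.

Section RealIntegralSums.
Variables (R : realType) (d : measure_display) (T : measurableType d).
Variables (mu : {measure set T -> \bar R}) (D : set T) (mD : measurable D).

Lemma integrable_rsum (I : Type) (s : seq I) (f : I -> T -> R) :
  (forall i, mu.-integrable D (EFin \o f i)) ->
  mu.-integrable D (EFin \o (fun x => \sum_(i <- s) f i x)).
Proof.
move=> hf; have := @integrable_sum _ _ _ mu D mD I s xpredT (fun i => EFin \o f i) (fun i _ => hf i).
by congr (mu.-integrable D _); apply/funext => x; rewrite /= sumEFin.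
Qed.

Lemma Rintegral_sum (I : Type) (s : seq I) (f : I -> T -> R) :
  (forall i, mu.-integrable D (EFin \o f i)) ->
  \int[mu]_(x in D) (\sum_(i <- s) f i x) = \sum_(i <- s) \int[mu]_(x in D) f i x.
Proof.
move=> hf; elim: s => [|i s IH].
  by rewrite big_nil; under eq_Rintegral do rewrite big_nil; rewrite Rintegral_cst // mul0r.
rewrite big_cons -IH -RintegralD //; last exact: integrable_rsum.
by apply: eq_Rintegral => x _; rewrite big_cons.
Qed.

End RealIntegralSums.

Section SecondMoments.
Variables (R : realType) (H : completeNormedModType R[i]).
Variables (ip : {dot H for Num.conj}) (hip : induces_norm ip).
Variables (d : measure_display) (Om : measurableType d) (P : probability Om R).
Implicit Types (X Y : Om -> H) (x y : H).

Definition msq X : \bar R := (\int[P]_w ((hnorm (X w)) ^+ 2)%:E)%E.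

Lemma msq_ge0 X : (0 <= msq X)%E.
Proof. by apply: integral_ge0 => w _; rewrite lee_fin sqr_ge0. Qed.

Lemma hnorm_sqr_continuous : continuous (fun x : H => hnorm x ^+ 2).
Proof.
move=> x; under eq_fun do rewrite expr2.
by apply: cvgM; exact: hnorm_continuous.
Qed.

Lemma measurable_hnorm_sqr X : hmeasurable setT X -> measurable_fun setT (fun w => hnorm (X w) ^+ 2).
Proof. by move=> mX; exact: (hmeasurable_continuous_comp mX hnorm_sqr_continuous). Qed.

Lemma measurable_msq X : hmeasurable setT X -> measurable_fun setT (fun w => (hnorm (X w) ^+ 2)%:E).
Proof. by move=> mX; apply/measurable_EFinP; exact: measurable_hnorm_sqr. Qed.

Lemma Im_ip x y : complex.Im (ip x y) = complex.Re (ip x ('i%C *: y)).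
Proof. by rewrite ipZr; case: (ip x y) => a b /=; rewrite mul0r mulN1r opprK add0r. Qed.

Lemma measurable_Re_ip X x : hmeasurable setT X -> measurable_fun setT (fun w => complex.Re (ip (X w) x)).
Proof. by move=> mX; exact: (hmeasurable_continuous_comp mX (ip_continuousl hip (y := x))). Qed.

Lemma measurable_Im_ip X x : hmeasurable setT X -> measurable_fun setT (fun w => complex.Im (ip (X w) x)).
Proof. by move=> mX; under eq_fun do rewrite Im_ip; exact: measurable_Re_ip. Qed.

Lemma Re_mul_conjE (a b : R[i]) : complex.Re (a * Num.conj b) =
  complex.Re a * complex.Re b + complex.Im a * complex.Im b.
Proof. by case: a b => a1 a2 [b1 b2] /=; ring. Qed.

Lemma integrable_ip_product X Y x y : hmeasurable setT X -> hmeasurable setT Y ->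
  (msq X < +oo)%E -> (msq Y < +oo)%E ->
  P.-integrable setT (EFin \o (fun w => complex.Re (ip (X w) x * Num.conj (ip (Y w) y)))).
Proof.
move=> mX mY fX fY.
pose g w := hnorm x * hnorm y * (hnorm (X w) ^+ 2 + hnorm (Y w) ^+ 2).
have ig : P.-integrable setT (EFin \o g).
  have i1 Z : hmeasurable setT Z -> (msq Z < +oo)%E -> P.-integrable setT (EFin \o (fun w => hnorm (Z w) ^+ 2)).
    move=> mZ fZ; apply/integrableP; split; first exact: measurable_msq.
    by apply: le_lt_trans fZ; rewrite /msq; under eq_integral do rewrite /= ger0_norm ?sqr_ge0 //.
  have := integrableZl measurableT (hnorm x * hnorm y) (integrableD measurableT (i1 X mX fX) (i1 Y mY fY)).
  by congr (P.-integrable _ _); apply/funext => w; rewrite /= -EFinD -EFinM.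
apply: (le_integrable measurableT _ _ ig).
  apply/measurable_EFinP; under eq_fun do rewrite Re_mul_conjE.
  by apply: measurable_funD; apply: measurable_funM;
    first [exact: measurable_Re_ip|exact: measurable_Im_ip].
move=> w _; rewrite /= lee_fin.
apply: le_trans (Re_le_cmod _) _; rewrite cmodM.
have -> : cmod (Num.conj (ip (Y w) y)) = cmod (ip (Y w) y) by rewrite /cmod normcJ.
apply: (@le_trans _ _ ((hnorm (X w) * hnorm x) * (hnorm (Y w) * hnorm y))).
  by apply: ler_pM; rewrite ?cmod_ge0 ?ip_le.
have -> : (hnorm (X w) * hnorm x) * (hnorm (Y w) * hnorm y) =
   hnorm x * hnorm y * (hnorm (X w) * hnorm (Y w)) by ring.
rewrite ger0_norm; last by rewrite /g !mulr_ge0 ?hnorm_ge0 ?addr_ge0 ?sqr_ge0.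
rewrite ler_wpM2l ?mulr_ge0 ?hnorm_ge0 //.
have := sqr_ge0 (hnorm (X w) - hnorm (Y w)).
have := sqr_ge0 (hnorm (X w)); have := sqr_ge0 (hnorm (Y w)).
nra.
Qed.

Lemma measurable_cmod_ip_sqr X x : hmeasurable setT X ->
  measurable_fun setT (fun w => ((cmod (ip (X w) x)) ^+ 2)%:E).
Proof.
move=> mX; apply/measurable_EFinP; under eq_fun do rewrite cmod_sqr.
apply: measurable_funD; apply: measurable_funX; first exact: measurable_Re_ip.
exact: measurable_Im_ip.
Qed.

(** Bessel's inequality under the expectation, for every finite part of the basis. *)
Lemma esum_cmod_ip_le (c : R) X : hmeasurable setT X -> 0 <= c ->
  (\esum_(e in get (is_onb ip)) (c%:E * \int[P]_w ((cmod (ip (X w) e)) ^+ 2)%:E) <= c%:E * msq X)%E.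
Proof.
move=> mX c0; apply: ge_ereal_sup => _ [A [fA AE] <-].
have f0 e : (0 <= \int[P]_w ((cmod (ip (X w) e)) ^+ 2)%:E)%E.
  by apply: integral_ge0 => w _; rewrite lee_fin sqr_ge0.
rewrite fsbig_finite //= -ge0_sume_distrr // lee_wpmul2l ?lee_fin //.
rewrite -ge0_integral_sum //; last 2 first.
- by move=> e; exact: measurable_cmod_ip_sqr.
- by move=> e w _; rewrite lee_fin sqr_ge0.
apply: ge0_le_integral_nonmeasurable => w _.
  by apply: sume_ge0 => e _; rewrite lee_fin sqr_ge0.
rewrite sumEFin lee_fin; apply: (bessel hip (E := get (is_onb ip))).
- exact: onb_orthonormal.
- exact: finmap.fset_uniq.
- by move=> e; rewrite in_fset_set // => /set_mem; exact: AE.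
Qed.

Lemma msq_bop_le A (K : R) X : hmeasurable setT X -> bop A K -> (msq (A \o X) <= (K ^+ 2)%:E * msq X)%E.
Proof.
move=> mX [lA K0 BA]; rewrite /msq -ge0_integralZl //.
- apply: ge0_le_integral_nonmeasurable => w _; first by rewrite lee_fin sqr_ge0.
  by rewrite -EFinM lee_fin -exprMn ler_sqr ?nnegrE ?mulr_ge0 ?hnorm_ge0 ?BA.
- exact: measurable_msq.
- by move=> w _; rewrite lee_fin sqr_ge0.
- by rewrite lee_fin sqr_ge0.
Qed.

Lemma msqD_le X Y : hmeasurable setT X -> hmeasurable setT Y ->
  (msq (fun w => (X w + Y w)%R) <= 2%:E * msq X + 2%:E * msq Y)%E.
Proof.
move=> mX mY.
have e2 Z : hmeasurable setT Z -> (2%:E * msq Z = \int[P]_w (2%:E * (hnorm (Z w) ^+ 2)%:E))%E.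
  move=> mZ; rewrite ge0_integralZl //; first exact: measurable_msq.
  by move=> w _; rewrite lee_fin sqr_ge0.
rewrite (e2 X mX) (e2 Y mY) /msq.
rewrite -ge0_integralD //; last 4 first.
- by move=> w _; rewrite mule_ge0 ?lee_fin ?sqr_ge0.
- by apply: measurable_funeM; exact: measurable_msq.
- by move=> w _; rewrite mule_ge0 ?lee_fin ?sqr_ge0.
- by apply: measurable_funeM; exact: measurable_msq.
apply: ge0_le_integral_nonmeasurable => w _; first by rewrite lee_fin sqr_ge0.
rewrite -!EFinM -EFinD lee_fin -(parallelogram hip) lerDl sqr_ge0 //.
Qed.

Lemma msq_as_eq X Y : hmeasurable setT X -> hmeasurable setT Y -> as_eq P X Y -> msq X = msq Y.
Proof.
move=> mX mY XY; apply: ae_eq_integral => //; try exact: measurable_msq.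
by apply: filterS XY => w + _ => ->.
Qed.

End SecondMoments.

Lemma measurable_torus (R : realType) : measurable (@torus R).
Proof. exact: measurable_itv. Qed.

Lemma measure_torus (R : realType) : (@lebesgue_measure R) (@torus R) = (2 * pi)%:E.
Proof.
rewrite /torus lebesgue_measure_itv /= lte_fin gtrN ?pi_gt0 // -EFinB opprK.
by rewrite -mulr2n mulr_natl.
Qed.

(** * Second-order structure of filtered white noise *)

Section WhiteNoise.
Variables (R : realType) (H : completeNormedModType R[i]).
Variables (ip : {dot H for Num.conj}) (hip : induces_norm ip) (sepH : separable H).
Variables (d : measure_display) (Om : measurableType d) (P : probability Om R).
Variables (eps : int -> Om -> H) (Sigma : H -> H).
Hypothesis heps : white_noise ip P eps Sigma.
Implicit Types (A : H -> H) (t s : int) (x y e : H).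

Let eM t : in_M ip P (eps t).
Proof. by have [[h _] _ _ _] := heps; exact: h. Qed.

Let eps_meas t : hmeasurable setT (eps t). Proof. by have [] := eM t. Qed.

Let eps_fin t : (msq P (eps t) < +oo)%E. Proof. by have [] := eM t. Qed.

Let eps_mean t x : cexpectation P (fun w => ip (eps t w) x) = 0.
Proof. by have [] := eM t. Qed.

Let Sigma_pos : positive_op ip Sigma. Proof. by have [_ []] := heps. Qed.

Let Sigma_bop : exists K, bop Sigma K.
Proof. by apply/bounded_op_bop; case: Sigma_pos. Qed.

Lemma white_noise_cov t s x y :
  \int[P]_w complex.Re (ip (eps t w) x * Num.conj (ip (eps s w) y)) =
  if t == s then complex.Re (ip (Sigma y) x) else 0.
Proof.
have cov S : is_cov ip P (eps t) (eps s) S ->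
    complex.Re (ip (S y) x) = \int[P]_w complex.Re (ip (eps t w) x * Num.conj (ip (eps s w) y)).
  move=> [_ ->]; rewrite /ccov !eps_mean {1}/cexpectation {1}/cintegral /=.
  by apply: eq_Rintegral => w _; rewrite !subr0.
have [_ _ c0 c1] := heps.
case: eqP => [ts|/eqP ts]; first by rewrite -(cov Sigma) // ts; exact: c1.
by rewrite -(cov (fun=> 0)) ?ip0l //; apply: c0; rewrite eq_sym.
Qed.

(** This is <A Sigma A^H e, e>, the variance of <A (eps t), e>. *)
Definition cov_form A e : R := complex.Re (ip (Sigma (adjoint ip A e)) (adjoint ip A e)).

Lemma cov_form_ge0 A e : 0 <= cov_form A e.
Proof. by have := Sigma_pos.2 (adjoint ip A e); rewrite lecE => /andP[]. Qed.

Let bop_eps_meas A K t : bop A K -> hmeasurable setT (A \o eps t).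
Proof. by move=> hA; apply: hmeasurable_comp => //; exact: bop_continuous hA. Qed.

Lemma filtered_meas (A : nat -> H -> H) (K : nat -> R) m t : (forall k, bop (A k) (K k)) ->
  hmeasurable setT (fun w => \sum_(0 <= k < m) A k (eps (t - k%:Z) w)).
Proof. by move=> hA; apply: hmeasurable_sum => // k; exact: bop_eps_meas (hA k). Qed.

(** The times t - k are pairwise distinct, so only the diagonal of the double sum survives, and the
    value does not depend on t. *)
Lemma expectation_filtered_ip (A : nat -> H -> H) (K : nat -> R) m t e :
  (forall k, bop (A k) (K k)) ->
  (\int[P]_w ((cmod (ip (\sum_(0 <= k < m) A k (eps (t - k%:Z) w)) e)) ^+ 2)%:E =
   (\sum_(0 <= k < m) cov_form (A k) e)%:E)%E.
Proof.
move=> hA.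
pose z k w := ip (eps (t - k%:Z) w) (adjoint ip (A k) e).
pose f j k w := complex.Re (z j w * Num.conj (z k w)).
have int_f j k : P.-integrable setT (EFin \o f j k) by apply: integrable_ip_product.
have E w : (cmod (ip (\sum_(0 <= k < m) A k (eps (t - k%:Z) w)) e)) ^+ 2 =
    \sum_(0 <= j < m) \sum_(0 <= k < m) f j k w.
  rewrite ip_suml.
  have -> : \sum_(0 <= k < m) ip (A k (eps (t - k%:Z) w)) e = \sum_(0 <= k < m) z k w.
    by apply: eq_bigr => k _; rewrite (ip_adjoint hip _ _ (hA k)).
  rewrite -Re_mul_conj rmorph_sum mulr_suml Re_sum; apply: eq_bigr => j _.
  by rewrite mulr_sumr Re_sum.
under eq_integral do rewrite E.
have int_ff : P.-integrable setT (EFin \o (fun w => \sum_(0 <= j < m) \sum_(0 <= k < m) f j k w)).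
  by apply: integrable_rsum => // j; apply: integrable_rsum.
have := integrable_fin_num measurableT int_ff.
rewrite -[X in X = _]fineK; last exact: integrable_fin_num int_ff.
move=> _; congr EFin.
rewrite -[LHS]/(\int[P]_w (\sum_(0 <= j < m) \sum_(0 <= k < m) f j k w)).
rewrite Rintegral_sum //; last by move=> j; apply: integrable_rsum.
rewrite !big_seq; apply: eq_bigr => j; rewrite mem_index_iota => /andP[_ jm].
rewrite Rintegral_sum // (bigD1_seq j) ?mem_index_iota ?iota_uniq //=.
rewrite white_noise_cov eqxx big1 ?addr0 // => k kj.
rewrite white_noise_cov; case: eqP => // /addrI/oppr_inj[] jk.
by rewrite jk eqxx in kj.
Qed.

Lemma expectation_bop_ip A (K : R) e : bop A K ->
  (\int[P]_w ((cmod (ip (A (eps 0 w)) e)) ^+ 2)%:E = (cov_form A e)%:E)%E.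
Proof.
move=> hA; have := @expectation_filtered_ip (fun=> A) (fun=> K) 1 0 e (fun=> hA).
by rewrite big_nat1 => <-; apply: eq_integral => w _; rewrite big_nat1 subr0.
Qed.

Let c : R := (2 * pi)^-1.
Let c0 : 0 < c. Proof. by rewrite invr_gt0 mulr_gt0 // pi_gt0. Qed.

(** Phi Sigma Phi^H is positive, hence its own absolute value. Writing its diagonal entries as
    expectations prepares the use of Bessel's inequality. *)
Lemma trace_norm_sandwich (Phi : R -> H -> H) l (K : R) : bop (Phi l) K ->
  trace_norm ip (sandwich ip Phi (noise_density Sigma) l) =
  (\esum_(e in get (is_onb ip)) (c%:E * \int[P]_w ((cmod (ip (Phi l (eps 0 w)) e)) ^+ 2)%:E))%E.
Proof.
move=> hPhi; set S := sandwich _ _ _ _.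
have [_ hadj] := adjointP hip hPhi.
have [L hS] := Sigma_bop.
have SE x y : ip (S x) y = c%:C%C * ip (Sigma (adjoint ip (Phi l) x)) (adjoint ip (Phi l) y).
  by rewrite /S /sandwich /= (ip_adjoint hip _ _ hPhi) /noise_density ipZl.
have pS : positive_op ip S.
  split=> [|x]; last by rewrite SE mulr_ge0 ?(Sigma_pos.2) // lecR ltW.
  exact: bop_bounded (bop_comp hPhi (bop_comp (bop_scale c%:C%C hS) hadj)).
rewrite /trace_norm (absop_positive hip pS) /trace; apply: eq_esum => e _.
by rewrite SE ReM_real (expectation_bop_ip e hPhi) -EFinM.
Qed.

Lemma trace_norm_sandwich_le (Phi : R -> H -> H) l (K : R) : bop (Phi l) K ->
  (trace_norm ip (sandwich ip Phi (noise_density Sigma) l) <=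
   c%:E * msq P (Phi l \o eps 0))%E.
Proof.
move=> hPhi; rewrite (trace_norm_sandwich hPhi); apply: esum_cmod_ip_le => //.
  exact: bop_eps_meas hPhi.
exact: ltW.
Qed.

Lemma trace_norm_sandwich_ge0 (Phi : R -> H -> H) l (K : R) : bop (Phi l) K ->
  (0 <= trace_norm ip (sandwich ip Phi (noise_density Sigma) l))%E.
Proof.
move=> hPhi; rewrite (trace_norm_sandwich hPhi); apply: esum_ge0 => e _.
by apply: mule_ge0; [rewrite lee_fin ltW|apply: integral_ge0 => w _; rewrite lee_fin sqr_ge0].
Qed.

Let mu : {measure set (measurableTypeR R) -> \bar R} := @lebesgue_measure R.

Let mu_torus : mu (@torus R) = (2 * pi)%:E. Proof. exact: measure_torus. Qed.

Variable I : (R -> H -> H) -> Om -> H.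
Hypothesis hI : spectral_integral ip P mu eps (noise_density Sigma) I.

Lemma bounded_admissible (Phi : R -> H -> H) (K : R) :
  (forall l, torus l -> bop (Phi l) K) ->
  (forall x, hmeasurable (@torus R) (fun l : measurableTypeR R => Phi l x)) ->
  admissible ip mu (noise_density Sigma) Phi.
Proof.
move=> bPhi mPhi; split=> //; first by move=> l tl; exact: bop_bounded (bPhi l tl).
have [r hr] : exists r, msq P (eps 0) = r%:E.
  have := eps_fin 0; have := msq_ge0 P (eps 0).
  by case: (msq P (eps 0)) => [r|//|//] _ _; exists r.
apply: (@le_lt_trans _ _ (\int[mu]_(l in @torus R) cst (c%:E * ((K ^+ 2)%:E * msq P (eps 0))) l)%E).
  apply: ge0_le_integral_nonmeasurable => l tl; first exact: trace_norm_sandwich_ge0 (bPhi l tl).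
  apply: le_trans (trace_norm_sandwich_le (bPhi l tl)) _.
  rewrite lee_wpmul2l ?lee_fin ?(ltW c0) //; apply: msq_bop_le => //; exact: bPhi.
rewrite (integral_cst mu (@measurable_torus R)) mu_torus hr -!EFinM ltry //.
Qed.

Let const_admissible A (K : R) : bop A K -> admissible ip mu (noise_density Sigma) (fun _ => A).
Proof.
by move=> hA; apply: (@bounded_admissible _ K) => // x; exact: measurable_cst.
Qed.

(* The trace of A Sigma A^* is the mean square of A (eps 0): Bessel's inequality gives one inequality, and
   the isometry property of the spectral integral of a constant filter the other. *)
Lemma msq_bop_eps A (K : R) : bop A K -> msq P (A \o eps 0) =
  ((2 * pi)%:E * \esum_(e in get (is_onb ip)) (c%:E * \int[P]_w ((cmod (ip (A (eps 0 w)) e)) ^+ 2)%:E))%E.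
Proof.
move=> hA; have [_ IM Ilin Iiso IA] := hI.
have aA := const_admissible hA.
have := IA 0 A (bop_bounded hA).
have -> : (fun l x => expi (0%:~R * l) *: A x) = (fun (_ : R) => A).
  by apply/funext => l; apply/funext => x; rewrite mul0r /expi cos0 sin0 scale1r.
move=> h.
have -> : msq P (A \o eps 0) = msq P (I (fun=> A)).
  apply/esym/msq_as_eq => //; first by have [] := IM _ aA.
  exact: bop_eps_meas hA.
rewrite {1}/msq (Iiso _ aA).
have h2 l : trace_norm ip (sandwich ip (fun=> A) (noise_density Sigma) l) =
  (\esum_(e in get (is_onb ip)) (c%:E * \int[P]_w ((cmod (ip (A (eps 0 w)) e)) ^+ 2)%:E))%E.
  exact: (@trace_norm_sandwich (fun=> A) l K hA).
under eq_integral do rewrite h2.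
by rewrite (integral_cst mu (@measurable_torus R)) mu_torus muleC.
Qed.

(** Each mean square is expanded along the basis with equality by [msq_bop_eps]; uncorrelatedness
    regroups the terms coordinate by coordinate, and Bessel's inequality bounds the result. It turns
    bounded partial sums into summable mean squares. *)
Lemma sum_msq_le (A : nat -> H -> H) (K : nat -> R) m t : (forall k, bop (A k) (K k)) ->
  (\sum_(0 <= k < m) msq P (A k \o eps 0) <=
   msq P (fun w => (\sum_(0 <= k < m) A k (eps (t - k%:Z) w))%R))%E.
Proof.
move=> hA; under eq_bigr do rewrite (msq_bop_eps (hA _)).
have f0 k e : (0 <= c%:E * \int[P]_w ((cmod (ip (A k (eps 0 w)) e)) ^+ 2)%:E)%E.
  by apply: mule_ge0; [rewrite lee_fin ltW|apply: integral_ge0 => w _; rewrite lee_fin sqr_ge0].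
rewrite -ge0_sume_distrr; last by move=> k _; apply: esum_ge0 => e _; exact: f0.
rewrite -esum_sum; last by move=> e k _ _; exact: f0.
pose X w := \sum_(0 <= k < m) A k (eps (t - k%:Z) w).
have -> : (\esum_(e in get (is_onb ip)) \sum_(0 <= k < m) c%:E * \int[P]_w ((cmod (ip (A k (eps 0 w)) e)) ^+ 2)%:E =
   \esum_(e in get (is_onb ip)) (c%:E * \int[P]_w ((cmod (ip (X w) e)) ^+ 2)%:E))%E.
  apply: eq_esum => e _; rewrite (expectation_filtered_ip _ _ _ hA).
  rewrite -sumEFin ge0_sume_distrr; last by move=> k _; rewrite lee_fin cov_form_ge0.
  by apply: eq_bigr => k _; rewrite (expectation_bop_ip e (hA k)).
have mX : hmeasurable setT X by exact: filtered_meas hA.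
have := esum_cmod_ip_le hip P mX (ltW c0).
have p0 : 0 < 2 * pi :> R by rewrite mulr_gt0 // pi_gt0.
have p0' : (0 <= (2 * pi)%:E :> \bar R)%E by rewrite lee_fin ltW.
move=> /(lee_wpmul2l p0') /le_trans; apply.
by rewrite muleA -EFinM /c divff ?gt_eqF // mul1e.
Qed.

End WhiteNoise.

(** * The spectral integral of a power series filter *)

Section TorusIntegrals.
Variable R : realType.
Let mu : {measure set (measurableTypeR R) -> \bar R} := @lebesgue_measure R.

Let npi_lt : - pi < pi :> R. Proof. by rewrite gtrN // pi_gt0. Qed.

Lemma continuous_integrable_torus (f : R -> R) : continuous f ->
  mu.-integrable (@torus R) (EFin \o f).
Proof.
move=> cf; apply: (@integrableS _ (measurableTypeR R) R mu `[(- pi), pi]%classic (@torus R)) => //.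
- exact: (@measurable_torus R).
- exact: subset_itv_oc_cc.
- apply: continuous_compact_integrable; first exact: segment_compact.
  exact: continuous_subspaceT.
Qed.

Lemma Rintegral_torus_FTC (f F : R -> R) : continuous f ->
  (forall x : R, is_derive x 1 F (f x)) ->
  \int[mu]_(x in @torus R) f x = F pi - F (- pi).
Proof.
move=> cf dF.
have cF : continuous F by move=> x; apply: differentiable_continuous; apply/derivable1_diffP; have [] := dF x.
rewrite /Rintegral /torus (@integral_itv_obnd_cbnd _ (- pi) (BRight pi)); last first.
  by apply/measurable_EFinP; apply: measurable_funTS; exact: continuous_measurable_fun.
rewrite (@continuous_FTC2 _ f F) //.
- exact: continuous_subspaceT.
- split.
  + by move=> x _; have [] := dF x.
  + by apply: cvg_at_right_filter; exact: cF.
  + by apply: cvg_at_left_filter; exact: cF.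
- by move=> x _; rewrite derive1E; have [_ ->] := dF x.
Qed.

Lemma cos_scale_continuous (a : R) : continuous (fun x : R => cos (a * x)).
Proof.
move=> x; apply: continuous_comp; last exact: continuous_cos.
by apply: cvgMr; exact: cvg_id.
Qed.

Lemma sin_scale_continuous (a : R) : continuous (fun x : R => sin (a * x)).
Proof.
move=> x; apply: continuous_comp; last exact: continuous_sin.
by apply: cvgMr; exact: cvg_id.
Qed.

Lemma sin_int_pi (z : int) : sin (z%:~R * pi) = 0 :> R.
Proof.
have nat_case (n : nat) : sin (n%:R * pi) = 0 :> R.
  by elim: n => [|n IH]; rewrite ?mul0r ?sin0 // -natr1 mulrDl mul1r sinDpi IH oppr0.
case: z => n; first exact: nat_case.
by rewrite NegzE rmorphN mulNr sinN -[X in X * _]/(n.+1%:R) nat_case oppr0.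
Qed.

Lemma Rintegral_torus_cos (z : int) :
  \int[mu]_(x in @torus R) cos (z%:~R * x) = if z == 0 then 2 * pi else 0.
Proof.
case: eqP => [->|/eqP z0].
  under eq_Rintegral do rewrite mul0r cos0.
  rewrite Rintegral_cst ?mul1r; last exact: (@measurable_torus R).
  by rewrite [X in fine X](_ : _ = (2 * pi)%:E) //; exact: (@measure_torus R).
have a0 : z%:~R != 0 :> R by rewrite intr_eq0.
have dF (x : R) : is_derive x 1 (fun x : R => z%:~R^-1 * sin (z%:~R * x)) (cos (z%:~R * x)).
  by apply: is_derive_eq; rewrite /GRing.scale /=; field; exact: a0.
rewrite (Rintegral_torus_FTC (@cos_scale_continuous _) dF).
by rewrite mulrN sinN sin_int_pi oppr0 mulr0 subrr.
Qed.

Lemma Rintegral_torus_sin (z : int) : \int[mu]_(x in @torus R) sin (z%:~R * x) = 0.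
Proof.
have [->|z0] := eqVneq z 0.
  under eq_Rintegral do rewrite mul0r sin0.
  by rewrite Rintegral_cst ?mul0r; last exact: (@measurable_torus R).
have a0 : z%:~R != 0 :> R by rewrite intr_eq0.
have dF (x : R) : is_derive x 1 (fun x : R => - z%:~R^-1 * cos (z%:~R * x)) (sin (z%:~R * x)).
  by apply: is_derive_eq; rewrite /GRing.scale /=; field; exact: a0.
rewrite (Rintegral_torus_FTC (@sin_scale_continuous _) dF).
by rewrite mulrN cosN subrr.
Qed.

End TorusIntegrals.

Section Expi.
Variable R : realType.
Implicit Types a b : R.

Lemma expiD a b : expi (a + b) = expi a * expi b :> R[i].
Proof.
by apply/eqP; rewrite eq_complex /= cosD sinD eqxx /=; apply/eqP; ring.
Qed.

Lemma cmod_expi a : cmod (expi a) = 1.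
Proof. by rewrite cmodE /= cos2Dsin2 sqrtr1. Qed.

Lemma expiX a k : expi a ^+ k = expi (k%:R * a) :> R[i].
Proof.
elim: k => [|k IH]; first by rewrite expr0 mul0r /expi cos0 sin0.
by rewrite exprS IH -expiD -natr1 mulrDl mul1r addrC.
Qed.

Lemma conj_expi a : Num.conj (expi a) = expi (- a) :> R[i].
Proof. by rewrite /expi cosN sinN. Qed.

End Expi.

(** * Mean squares of trigonometric polynomials with random vector coefficients *)

Section TrigonometricPolynomials.
Variables (R : realType) (H : completeNormedModType R[i]).
Variables (ip : {dot H for Num.conj}) (hip : induces_norm ip) (sepH : separable H).
Variables (d : measure_display) (Om : measurableType d) (P : probability Om R).
Implicit Types (X Y : Om -> H) (y : nat -> H) (s : seq nat) (l : R).

Let mu : {measure set (measurableTypeR R) -> \bar R} := @lebesgue_measure R.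

Lemma hnorm_trig_sqr y s l :
  hnorm (\sum_(k <- s) expi (- (k%:R * l)) *: y k) ^+ 2 =
  \sum_(j <- s) \sum_(k <- s)
    (cos ((k%:Z - j%:Z)%:~R * l) * complex.Re (ip (y j) (y k)) -
     sin ((k%:Z - j%:Z)%:~R * l) * complex.Im (ip (y j) (y k))).
Proof.
rewrite (hnorm_sqr hip) ip_suml Re_sum; apply: eq_bigr => j _.
rewrite ip_sumr Re_sum; apply: eq_bigr => k _.
rewrite ipZl ipZr conj_expi opprK mulrA -expiD.
have -> : - (j%:R * l) + k%:R * l = (k%:Z - j%:Z)%:~R * l.
  by rewrite rmorphB /= mulrBl addrC.
by rewrite /expi; case: (ip (y j) (y k)) => a b /=.
Qed.

Lemma measurable_Re_ip2 X Y : hmeasurable setT X -> hmeasurable setT Y ->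
  measurable_fun setT (fun w => complex.Re (ip (X w) (Y w))).
Proof.
move=> mX mY.
have -> : (fun w => complex.Re (ip (X w) (Y w))) =
    fun w => 2^-1 * (hnorm (X w + Y w) ^+ 2 - hnorm (X w) ^+ 2 - hnorm (Y w) ^+ 2).
  apply/funext => w; rewrite (hnorm_sqrD hip) [in RHS]addrAC -[_ + _ + _ - _]addrA.
  by field.
apply: measurable_funM; first exact: measurable_cst.
apply: measurable_funB; last exact: measurable_hnorm_sqr.
apply: measurable_funB; last exact: measurable_hnorm_sqr.
by apply: measurable_hnorm_sqr; exact: hmeasurableD.
Qed.

Lemma integrable_Re_ip X Y : hmeasurable setT X -> hmeasurable setT Y ->
  (msq P X < +oo)%E -> (msq P Y < +oo)%E ->
  P.-integrable setT (EFin \o (fun w => complex.Re (ip (X w) (Y w)))).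
Proof.
move=> mX mY fX fY.
pose g w := hnorm (X w) ^+ 2 + hnorm (Y w) ^+ 2.
have i1 (Z : Om -> H) : hmeasurable setT Z -> (msq P Z < +oo)%E -> P.-integrable setT (EFin \o (fun w => hnorm (Z w) ^+ 2)).
  move=> mZ fZ; apply/integrableP; split; first exact: measurable_msq.
  by apply: le_lt_trans fZ; rewrite /msq; under eq_integral do rewrite /= ger0_norm ?sqr_ge0 //.
have ig : P.-integrable setT (EFin \o g).
  have := integrableD measurableT (i1 X mX fX) (i1 Y mY fY).
  by congr (P.-integrable _ _); apply/funext => w; rewrite /= -EFinD.
apply: (le_integrable measurableT _ _ ig).
  by apply/measurable_EFinP; exact: measurable_Re_ip2.
move=> w _; rewrite /= lee_fin.
apply: le_trans (Re_le_cmod _) _; apply: le_trans (ip_le hip _ _) _.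
rewrite ger0_norm; last by rewrite /g ?addr_ge0 ?sqr_ge0.
have := sqr_ge0 (hnorm (X w) - hnorm (Y w)).
have := sqr_ge0 (hnorm (X w)); have := sqr_ge0 (hnorm (Y w)).
rewrite /g; nra.
Qed.

Variables (y : nat -> Om -> H).
Hypothesis my : forall k, hmeasurable setT (y k).
Hypothesis fy : forall k, (msq P (y k) < +oo)%E.

Let A j k := \int[P]_w complex.Re (ip (y j w) (y k w)).
Let B j k := \int[P]_w complex.Im (ip (y j w) (y k w)).

Let iy k : hmeasurable setT (fun w => 'i%C *: y k w) /\ (msq P (fun w => 'i%C *: y k w) < +oo)%E.
Proof.
split.
  by apply: (hmeasurable_comp (my k)); exact: (bop_continuous (bop_scale 'i%C (@bop_id R H))).
have -> : msq P (fun w => 'i%C *: y k w) = msq P (y k); last exact: fy.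
apply: eq_integral => w _; rewrite hnormZ (_ : cmod _ = 1) ?mul1r //.
by rewrite cmodE /= expr0n add0r expr1n sqrtr1.
Qed.

Let intRe j k : P.-integrable setT (EFin \o (fun w => complex.Re (ip (y j w) (y k w)))).
Proof. exact: integrable_Re_ip. Qed.

Let intIm j k : P.-integrable setT (EFin \o (fun w => complex.Im (ip (y j w) (y k w)))).
Proof.
under eq_fun do rewrite Im_ip.
by apply: integrable_Re_ip => //; have [] := iy k.
Qed.

(** Indexed by a list so as to cover the blocks p <= k < p + m of a tail. *)
Definition trig_poly s l w := \sum_(k <- s) expi (- (k%:R * l)) *: y k w.

(** Taking the expectation first, at fixed l, yields a real trigonometric polynomial in l. Its
    continuity gives measurability and integrability, without joint measurability in (l, w). *)
Let msq_trig_poly s l : msq P (trig_poly s l) =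
  (\sum_(j <- s) \sum_(k <- s)
    (cos ((k%:Z - j%:Z)%:~R * l) * A j k - sin ((k%:Z - j%:Z)%:~R * l) * B j k))%:E.
Proof.
pose f j k w := cos ((k%:Z - j%:Z)%:~R * l) * complex.Re (ip (y j w) (y k w)) -
     sin ((k%:Z - j%:Z)%:~R * l) * complex.Im (ip (y j w) (y k w)).
have i1 (c : R) g : P.-integrable setT (EFin \o g) -> P.-integrable setT (EFin \o (fun w => c * g w)).
  move=> hg; have := integrableZl measurableT c hg.
  by congr (P.-integrable _ _); apply/funext => w; rewrite /= -EFinM.
have i2 j k : P.-integrable setT (EFin \o f j k).
  have := integrableB measurableT (i1 (cos ((k%:Z - j%:Z)%:~R * l)) _ (intRe j k))
     (i1 (sin ((k%:Z - j%:Z)%:~R * l)) _ (intIm j k)).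
  by congr (P.-integrable _ _); apply/funext => w; rewrite /= -EFinB.
have i3 : P.-integrable setT (EFin \o (fun w => \sum_(j <- s) \sum_(k <- s) f j k w)).
  by apply: integrable_rsum => // j; apply: integrable_rsum.
rewrite /msq; under eq_integral do rewrite hnorm_trig_sqr.
rewrite -[LHS]fineK; last exact: integrable_fin_num i3.
congr EFin; rewrite -[LHS]/(\int[P]_w (\sum_(j <- s) \sum_(k <- s) f j k w)).
rewrite Rintegral_sum //; last by move=> j; apply: integrable_rsum.
apply: eq_bigr => j _; rewrite Rintegral_sum //; apply: eq_bigr => k _.
rewrite RintegralB //; try exact: i1.
by rewrite !RintegralZl.
Qed.

Let trig_continuous s : continuous (fun l => \sum_(j <- s) \sum_(k <- s)
    (cos ((k%:Z - j%:Z)%:~R * l) * A j k - sin ((k%:Z - j%:Z)%:~R * l) * B j k)).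
Proof.
have sum_cont (f : nat -> R -> R) (r : seq nat) : (forall k, continuous (f k)) ->
    continuous (fun l => \sum_(k <- r) f k l).
  move=> hf; elim: r => [|k r IH] x.
    under eq_fun do rewrite big_nil; exact: cvg_cst.
  under eq_fun do rewrite big_cons.
  by apply: cvgD; [exact: hf|exact: IH].
apply: (sum_cont) => j; apply: (sum_cont) => k x.
by apply: cvgB; apply: cvgMl; [exact: cos_scale_continuous|exact: sin_scale_continuous].
Qed.

Lemma measurable_msq_trig_poly s : measurable_fun (@torus R) (fun l : measurableTypeR R => msq P (trig_poly s l)).
Proof.
under eq_fun do rewrite msq_trig_poly.
by apply/measurable_EFinP; apply: measurable_funTS; apply: continuous_measurable_fun; exact: trig_continuous.
Qed.

Lemma integral_msq_trig_poly s : uniq s ->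
  (\int[mu]_(l in @torus R) msq P (trig_poly s l) = (2 * pi)%:E * \sum_(k <- s) msq P (y k))%E.
Proof.
move=> us.
have mE k : msq P (y k) = (A k k)%:E.
  rewrite /msq; under eq_integral do rewrite (hnorm_sqr hip).
  by rewrite -[LHS]fineK //; exact: integrable_fin_num (intRe k k).
have ->: (\sum_(k <- s) msq P (y k) = (\sum_(k <- s) A k k)%R%:E)%E.
  by rewrite -sumEFin; apply: eq_bigr => k _; exact: mE.
rewrite -EFinM; under eq_integral do rewrite msq_trig_poly.
have mT := @measurable_torus R.
have i1 (c : R) (g : R -> R) : continuous g -> mu.-integrable (@torus R) (EFin \o (fun l => g l * c)).
  by move=> cg; apply: continuous_integrable_torus => x; apply: cvgMl; exact: cg.
pose f j k l := cos ((k%:Z - j%:Z)%:~R * l) * A j k - sin ((k%:Z - j%:Z)%:~R * l) * B j k.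
have i2 j k : mu.-integrable (@torus R) (EFin \o f j k).
  apply: continuous_integrable_torus => x.
  by apply: cvgB; apply: cvgMl; [exact: cos_scale_continuous|exact: sin_scale_continuous].
have i3 := continuous_integrable_torus (@trig_continuous s).
rewrite -[LHS]fineK; last exact: integrable_fin_num i3.
congr EFin; rewrite -[LHS]/(\int[mu]_(l in @torus R) (\sum_(j <- s) \sum_(k <- s) f j k l)).
rewrite Rintegral_sum //; last by move=> j; apply: integrable_rsum.
rewrite mulr_sumr !big_seq; apply: eq_bigr => j js.
rewrite Rintegral_sum // (bigD1_seq j) //=.
have fjk k : \int[mu]_(x in @torus R) f j k x = (if k == j then 2 * pi else 0) * A j k.
  rewrite RintegralB //; try (by apply: i1; first [exact: cos_scale_continuous|exact: sin_scale_continuous]).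
  rewrite !RintegralZr //; try (by apply: continuous_integrable_torus; first [exact: cos_scale_continuous|exact: sin_scale_continuous]).
  by rewrite Rintegral_torus_cos Rintegral_torus_sin mul0r subr0 subr_eq0.
rewrite fjk eqxx big1 ?addr0 // => k kj.
by rewrite fjk (negbTE kj) mul0r.
Qed.

End TrigonometricPolynomials.

Lemma limn_einf_le (R : realType) (u : nat -> \bar R) (M : \bar R) :
  (forall n, u n <= M)%E -> (limn_einf u <= M)%E.
Proof.
move=> uM; rewrite limn_einf_lim; apply: lime_le; first exact: is_cvg_einfs.
by apply: nearW => n; apply: le_trans (uM n); apply: ereal_inf_lbound; exists n => /=.
Qed.

Section MeasurableCharacters.
Variables (R : realType) (H : completeNormedModType R[i]).

Lemma expi_scale_continuous (a : R) (y : H) : continuous (fun l : R => expi (a * l) *: y).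
Proof.
move=> l; apply/cvgrPdist_lt => -[e e'] /[dup] e0; rewrite ltcE /= => /andP[/eqP -> e0'].
pose g (s : R) := (`|cos (a * l) - cos (a * s)| + `|sin (a * l) - sin (a * s)|) * hnorm y.
have cg : g s @[s --> l] --> (0 : R).
  have -> : 0 = g l by rewrite /g !subrr normr0 addr0 mul0r.
  apply: cvgMl; apply: cvgD; apply: cvg_norm; apply: cvgB; try exact: cvg_cst.
    exact: cos_scale_continuous.
  exact: sin_scale_continuous.
near=> s; rewrite hnormE ltcR -scalerBl hnormZ.
apply: (@le_lt_trans _ _ (g s)).
  apply: ler_wpM2r; first exact: hnorm_ge0.
  have -> : expi (a * l) - expi (a * s) =
      (cos (a * l) - cos (a * s))%:C%C + 'i%C * (sin (a * l) - sin (a * s))%:C%C.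
    by apply/eqP; rewrite eq_complex /=; apply/andP; split; apply/eqP; ring.
  apply: le_trans (ler_cmodD _ _) _; rewrite cmodM !cmod_real.
  by rewrite [cmod 'i%C]cmodE /= expr0n expr1n add0r sqrtr1 mul1r.
have : `|0 - g s| < e by near: s; move/cvgrPdist_lt: cg; apply.
by rewrite sub0r normrN ger0_norm // mulr_ge0 ?hnorm_ge0 ?addr_ge0.
Unshelve. all: by end_near. Qed.

Lemma expi_scale_measurable (D : set (measurableTypeR R)) (a : R) (y : H) :
  hmeasurable D (fun l : measurableTypeR R => expi (a * l) *: y).
Proof.
move=> mD.
apply: (@measurability _ _ (measurableTypeR R) (g_sigma_algebraType (@open H)) D _ (@open H) erefl) => //.
move=> _ [V hV <-]; apply: measurableI => //.
by apply: open_measurable; apply: open_comp => // l _; exact: expi_scale_continuous.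
Qed.

End MeasurableCharacters.

Section CenteredVectors.
Variables (R : realType) (H : completeNormedModType R[i]).
Variables (ip : {dot H for Num.conj}) (hip : induces_norm ip) (sepH : separable H).
Variables (d : measure_display) (Om : measurableType d) (P : probability Om R).
Implicit Types X Y : Om -> H.

Lemma in_M_bop X (A : H -> H) (K : R) : in_M ip P X -> bop A K -> in_M ip P (fun w => A (X w)).
Proof.
move=> [mX fX eX] hA; split.
- exact: (hmeasurable_comp mX (bop_continuous hA)).
- apply: le_lt_trans (msq_bop_le P mX hA) _.
  by rewrite lte_mul_pinfty ?lee_fin ?sqr_ge0.
- by move=> x; under eq_fun do rewrite (ip_adjoint hip _ _ hA); exact: eX.
Qed.

Lemma in_MB X Y : in_M ip P X -> in_M ip P Y -> in_M ip P (fun w => X w - Y w).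
Proof.
move=> [mX fX eX] [mY fY eY].
have mNY : hmeasurable setT (fun w => - Y w).
  exact: (hmeasurable_comp mY (bop_continuous (bop_opp (@bop_id R H)))).
have nNY : msq P (fun w => - Y w) = msq P Y by apply: eq_integral => w _; rewrite hnormN.
split.
- exact: hmeasurableD.
- apply: le_lt_trans (msqD_le hip P mX mNY) _; rewrite nNY.
  by rewrite lte_add_pinfty // lte_mul_pinfty // lee_fin.
- move=> x.
  have mc (z : H) : hmeasurable [set: Om] (fun=> z) by exact: measurable_cst.
  have fc (z : H) : (msq P (fun=> z) < +oo)%E.
    have -> : msq P (fun=> z) = ((hnorm z ^+ 2)%:E * 1)%E.
      by rewrite -(probability_setT P); exact: integral_cst.
    by rewrite mule1 ltry.
  have iRe Z z : hmeasurable setT Z -> (msq P Z < +oo)%E ->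
      P.-integrable setT (EFin \o (fun w => complex.Re (ip (Z w) z))).
    by move=> mZ fZ; apply: (integrable_Re_ip hip sepH mZ (mc z) fZ (fc z)).
  have z (Z : Om -> H) v : cexpectation P (fun w => ip (Z w) v) = 0 -> \int[P]_w complex.Re (ip (Z w) v) = 0.
    by move=> /(congr1 (@complex.Re R)).
  have e v : \int[P]_w complex.Re (ip (X w - Y w) v) = 0.
    under eq_Rintegral do rewrite ipBl ReD ReN.
    by rewrite RintegralB ?z ?subrr //; exact: iRe.
  rewrite /cexpectation /cintegral e; under eq_Rintegral do rewrite Im_ip.
  by rewrite e.
Qed.

End CenteredVectors.

(** * Mean-square limit of the truncated filters *)

Section FilterLimit.
Variables (R : realType) (H : completeNormedModType R[i]).
Variables (ip : {dot H for Num.conj}) (hip : induces_norm ip) (sepH : separable H).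
Variables (d : measure_display) (Om : measurableType d) (P : probability Om R).
Variables (eps : int -> Om -> H) (Sigma : H -> H).
Hypothesis heps : white_noise ip P eps Sigma.
Variable I : (R -> H -> H) -> Om -> H.
Let mu : {measure set (measurableTypeR R) -> \bar R} := @lebesgue_measure R.
Hypothesis hI : spectral_integral ip P mu eps (noise_density Sigma) I.
Variables (b : nat -> H -> H) (Kb : nat -> R).
Hypothesis hb : forall k, bop (b k) (Kb k).
Variable M : R.
Hypothesis hM : forall m, (\sum_(0 <= k < m) msq P (b k \o eps 0) <= M%:E)%E.
Variable Phi : R -> H -> H.
Hypothesis bPhi : forall l, torus l -> bounded_op (Phi l).
Hypothesis PhiE : forall l x, torus l -> l != 0 ->
  \sum_(0 <= k < m) expi (- (k%:R * l)) *: b k x @[m --> \oo] --> Phi l x.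
Implicit Types (t : int) (l : R) (x : H) (p m : nat).

Let eM t : in_M ip P (eps t). Proof. by have [[h _] _ _ _] := heps; exact: h. Qed.
Let meps t : hmeasurable setT (eps t). Proof. by have [] := eM t. Qed.
Let y k := b k \o eps 0.
Let my k : hmeasurable setT (y k).
Proof. exact: (hmeasurable_comp (meps 0) (bop_continuous (hb k))). Qed.
Let fy k : (msq P (y k) < +oo)%E.
Proof. by have [_ + _] := in_M_bop hip (eM 0) (hb k). Qed.

Let S p l x := \sum_(0 <= k < p) expi (- (k%:R * l)) *: b k x.

Let bS p l : bop (S p l) (\sum_(0 <= k < p) Kb k).
Proof.
apply: bop_sum => k; have := bop_scale (expi (- (k%:R * l))) (hb k).
by rewrite cmod_expi mul1r.
Qed.

(** The error of the p-th truncation at time t. For p = 0 the sum is empty and this is the integrand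
    of [filtered], whose admissibility is thus a special case. *)
Let Psi t p l x := expi (t%:~R * l) *: (Phi l x - S p l x).

Let bPsi t p l : torus l -> exists K, bop (Psi t p l) K.
Proof.
move=> /bPhi/bounded_op_bop[K hK].
by eexists; exact: bop_scale (bop_sub hK (bS p l)).
Qed.

Let u k := fine (msq P (y k)).
Let uE k : msq P (y k) = (u k)%:E.
Proof. by rewrite fineK // ge0_fin_numE ?msq_ge0. Qed.
Let u0 k : 0 <= u k. Proof. by rewrite fine_ge0 // msq_ge0. Qed.
Let u_bound m : \sum_(0 <= k < m) u k <= M.
Proof. by rewrite -lee_fin -sumEFin; apply: le_trans (hM m); rewrite le_eqVlt (eq_bigr _ (fun k _ => uE k)) eqxx. Qed.

Let u_cvg : cvgn (series u).
Proof.
apply: nondecreasing_is_cvgn; first by apply: nondecreasing_series.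
by exists M => _ [m _ <-]; exact: u_bound.
Qed.

(** The tail of the sum of the E|b_k eps_0|^2 from k = p on. *)
Let r p : R := limn (series u) - series u p.

Let r_cvg : r p @[p --> \oo] --> (0 : R).
Proof.
rewrite -(subrr (limn (series u))); apply: cvgB; [exact: cvg_cst|exact: u_cvg].
Qed.

Let sum_le_r p m : \sum_(p <= k < p + m) u k <= r p.
Proof.
rewrite -sub_series_geq ?leq_addr // lerD2r; apply: nondecreasing_cvgn_le => //.
by apply: nondecreasing_series.
Qed.

Let c : R := (2 * pi)^-1.
Let c0 : 0 < c. Proof. by rewrite invr_gt0 mulr_gt0 // pi_gt0. Qed.

Let h p m l := msq P (trig_poly y (index_iota p (p + m)) l).

Let S_sub p m l w : trig_poly y (index_iota p (p + m)) l w = S (p + m) l (eps 0 w) - S p l (eps 0 w).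
Proof. by rewrite /S (@big_cat_nat _ _ _ p) ?leq_addr //= [RHS]addrAC subrr add0r. Qed.

(** Fatou's lemma in w at fixed l: as m grows, the block from p to p + m converges to Phi - S_p, and
    the character in [Psi] has modulus 1. *)
Let Psi_fatou t p l : torus l -> l != 0 ->
  (c%:E * msq P (Psi t p l \o eps 0) <= limn_einf (fun m => c%:E * h p m l))%E.
Proof.
move=> tl l0.
pose f m w := (c * hnorm (trig_poly y (index_iota p (p + m)) l w) ^+ 2)%:E.
have mtp m : hmeasurable setT (trig_poly y (index_iota p (p + m)) l).
  have -> : trig_poly y (index_iota p (p + m)) l = fun w => (S (p + m) l (eps 0 w) - S p l (eps 0 w)).
    by apply/funext => w; exact: S_sub.
  exact: (hmeasurable_comp (meps 0) (bop_continuous (bop_sub (bS _ _) (bS _ _)))).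
have mf m : measurable_fun setT (f m).
  by apply/measurable_EFinP; apply: measurable_funM => //; exact: measurable_hnorm_sqr.
have f0 m w : setT w -> (0 <= f m w)%E by move=> _; rewrite lee_fin mulr_ge0 ?sqr_ge0 ?ltW.
have [K hK] := bPsi t p tl.
have mPsi : hmeasurable setT (Psi t p l \o eps 0).
  exact: (hmeasurable_comp (meps 0) (bop_continuous hK)).
have cE (X : Om -> H) : hmeasurable setT X -> (c%:E * msq P X = \int[P]_w (c * hnorm (X w) ^+ 2)%:E)%E.
  move=> mX; rewrite /msq -ge0_integralZl //.
  - exact: measurable_msq.
  - by move=> w _; rewrite lee_fin sqr_ge0.
  - by rewrite lee_fin ltW.
have := @fatou _ _ _ P setT measurableT f mf f0.
have -> : (fun m => \int[P]_w f m w)%E = (fun m => c%:E * h p m l)%E.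
  by apply/funext => m; rewrite cE.
apply: le_trans; rewrite cE // le_eqVlt; apply/orP; left; apply/eqP.
apply: eq_integral => w _.
suff cf : f m w @[m --> \oo] --> (c * hnorm (Psi t p l (eps 0 w)) ^+ 2)%:E.
  by rewrite (cvg_limn_einf_sup cf).1.
apply: cvg_EFin; first by near=> m.
apply: cvgMr; rewrite /Psi hnormZ cmod_expi mul1r.
have cS : trig_poly y (index_iota p (p + m)) l w @[m --> \oo] --> Phi l (eps 0 w) - S p l (eps 0 w).
  under eq_fun do rewrite S_sub.
  apply: cvgB; last exact: cvg_cst.
  under eq_fun do rewrite addnC.
  by have := @PhiE l (eps 0 w) tl l0; rewrite -(cvg_shiftn p).
exact: (cvg_comp _ _ cS (@hnorm_sqr_continuous R H _)).
Unshelve. all: by end_near. Qed.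

Let h0 p m l : (0 <= h p m l)%E. Proof. exact: msq_ge0. Qed.

Let mh p m : measurable_fun (@torus R) (fun l : measurableTypeR R => h p m l).
Proof. exact: (measurable_msq_trig_poly hip sepH my fy). Qed.

Let int_h p m : (\int[mu]_(l in @torus R) (c%:E * h p m l) <= (r p)%:E)%E.
Proof.
rewrite ge0_integralZl ?lee_fin ?(ltW c0) //; last exact: measurable_torus.
rewrite (integral_msq_trig_poly hip sepH my fy) ?iota_uniq //.
rewrite muleA -EFinM mulVf ?gt_eqF ?mulr_gt0 ?pi_gt0 // mul1e.
rewrite (eq_bigr _ (fun k _ => uE k)) sumEFin lee_fin; exact: sum_le_r.
Qed.

(* [Psi_fatou] fails at the singularity [l = 0] of the filter; adding [+oo * \1_[set 0]], whose integral
   vanishes, makes it hold everywhere. *)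
Let Psi_trace t p :
  (\int[mu]_(l in @torus R) trace_norm ip (sandwich ip (Psi t p) (noise_density Sigma) l) <= (r p)%:E)%E.
Proof.
have mT := @measurable_torus R.
pose g (l : measurableTypeR R) : \bar R := (+oo * (\1_[set (0 : R)] l)%:E)%E.
pose f m (l : measurableTypeR R) := (c%:E * h p m l + g l)%E.
have m1 : measurable_fun (@torus R) (fun l : measurableTypeR R => (\1_[set (0 : R)] l)%:E : \bar R).
  by apply/measurable_EFinP; exact: measurable_indic.
have mg : measurable_fun (@torus R) g by exact: measurable_funeM.
have g0 l : (0 <= g l)%E by rewrite mule_ge0 // lee_fin.
have ch0 m l : (0 <= c%:E * h p m l)%E by rewrite mule_ge0 // lee_fin ltW.
have mch m : measurable_fun (@torus R) (fun l : measurableTypeR R => (c%:E * h p m l)%E) by exact: measurable_funeM.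
have mf m : measurable_fun (@torus R) (f m) by exact: emeasurable_funD.
have f0 m l : torus l -> (0 <= f m l)%E by move=> _; rewrite adde_ge0.
have ig : (\int[mu]_(l in @torus R) g l = 0)%E.
  rewrite ge0_integralZl //.
  rewrite (integral_indic _ mT (measurable_set1 _)) setIidl; last first.
    by move=> _ ->; rewrite /torus /= in_itv /= oppr_lt0 pi_ge0 pi_gt0.
  by rewrite [mu _]lebesgue_measure_set1 mule0.
have if_le m : (\int[mu]_(l in @torus R) f m l <= (r p)%:E)%E.
  by rewrite ge0_integralD // ig adde0; exact: int_h.
(* Fatou's lemma a second time, now in l; the integrals of the blocks are at most r p for every
   m. *)
have := @fatou _ _ _ mu _ mT f mf f0; move=> /le_trans/(_ (limn_einf_le if_le)).
apply: le_trans; apply: ge0_le_integral_nonmeasurable => l tl.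
  have [K hK] := bPsi t p tl; exact: (trace_norm_sandwich_ge0 hip heps hK).
have [K hK] := bPsi t p tl.
rewrite /f /g indicE; have [->|l0] := eqVneq l 0.
  rewrite mem_set //= mule1.
  have -> : (fun m => c%:E * h p m 0%R + +oo)%E = fun=> +oo%E.
    by apply/funext => m; rewrite addeC addye // gt_eqF // (lt_le_trans _ (ch0 _ _)).
  have -> : limn_einf (fun=> +oo%E : \bar R) = +oo%E.
    by rewrite (cvg_limn_einf_sup (cvg_cst _)).1.
  exact: leey.
rewrite memNset /=; last by apply/eqP.
rewrite mule0; under [X in limn_einf X]eq_fun do rewrite adde0.
exact: le_trans (trace_norm_sandwich_le hip heps hK) (Psi_fatou t p tl l0).
Qed.

Let trig_measurable t p m x : hmeasurable (@torus R)
  (fun l : measurableTypeR R => \sum_(0 <= k < m) expi ((t - (p + k)%:Z)%:~R * l) *: b (p + k) x).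
Proof. apply: (hmeasurable_sum sepH) => k; exact: expi_scale_measurable. Qed.

(** The partial sums converge only away from l = 0, so this point is split off; on a singleton every
    function is measurable. *)
Let Psi_measurable t p x : hmeasurable (@torus R) (fun l : measurableTypeR R => Psi t p l x).
Proof.
have mT := @measurable_torus R.
have z0 : @torus R = [set (0 : measurableTypeR R)] `|` (@torus R `\ (0 : measurableTypeR R)).
  rewrite setDUK // => _ ->; by rewrite /torus /= in_itv /= oppr_lt0 pi_ge0 pi_gt0.
have m0 : measurable [set (0 : measurableTypeR R)] by exact: measurable_set1.
rewrite z0; apply/measurable_funU => //; first exact: measurableD.
split; first exact: measurable_fun_set1.
apply: (@hmeasurable_limit _ _ _ _ sepH _
  (fun m (l : measurableTypeR R) => \sum_(0 <= k < m) expi ((t - (p + k)%:Z)%:~R * l) *: b (p + k) x)).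
  by move=> m; apply: measurable_funS mT _ (trig_measurable t p m x); exact: subDsetl.
move=> l [tl /eqP l0].
have -> : (fun m => \sum_(0 <= k < m) expi ((t - (p + k)%:Z)%:~R * l) *: b (p + k) x) =
    fun m => expi (t%:~R * l) *: (S (m + p) l x - S p l x).
  apply/funext => m; rewrite addnC /S (@big_cat_nat _ _ _ p 0 (p + m)) ?leq_addr //= [in RHS]addrAC subrr add0r.
  rewrite -[in RHS](add0n p) big_addn add0n addKn scaler_sumr; apply: eq_bigr => k _.
  by rewrite scalerA -expiD [in LHS]addnC intrB mulrBl.
rewrite /Psi; apply: cvgZr; apply: cvgB; last exact: cvg_cst.
by have := @PhiE l x tl l0; rewrite -(cvg_shiftn p).
Qed.

Let Psi_admissible t p : admissible ip mu (noise_density Sigma) (Psi t p).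
Proof.
split.
- by move=> l /(bPsi t p)[K hK]; exact: bop_bounded hK.
- exact: Psi_measurable.
- exact: le_lt_trans (Psi_trace t p) (ltry _).
Qed.

Let trig_admissible t p :
  admissible ip mu (noise_density Sigma) (fun l x => expi (t%:~R * l) *: S p l x).
Proof.
apply: (bounded_admissible hip heps (K := \sum_(0 <= k < p) Kb k)) => [l _|x].
  by have := bop_scale (expi (t%:~R * l)) (bS p l); rewrite cmod_expi mul1r.
have -> : (fun l : measurableTypeR R => expi (t%:~R * l) *: S p l x) =
    fun l => \sum_(0 <= k < p) expi ((t - (0 + k)%:Z)%:~R * l) *: b (0 + k) x.
  apply/funext => l; rewrite scaler_sumr; apply: eq_bigr => k _.
  by rewrite add0n scalerA -expiD intrB mulrBl.
exact: trig_measurable.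
Qed.

Let I_trig t p : as_eq P (I (fun l x => expi (t%:~R * l) *: S p l x))
  (fun w => \sum_(0 <= k < p) b k (eps (t - k%:Z) w)).
Proof.
have [_ _ Ilin _ IA] := hI.
elim: p => [|p IH].
  (* The integral of the zero filter is obtained from the rule for constant operators with A = 0. *)
  have := IA 0 (fun=> 0) (bop_bounded (@bop_zero R H)).
  have -> : (fun l x => expi (0%:~R * l) *: (0 : H)) = (fun l x => expi (t%:~R * l) *: S 0 l x).
    by apply/funext => l; apply/funext => x; rewrite /S big_nil !scaler0.
  by apply: filterS => w ->; rewrite big_nil.
have -> : (fun l x => expi (t%:~R * l) *: S p.+1 l x) =
    fun l x => 1 *: (expi ((t - p%:Z)%:~R * l) *: b p x) + expi (t%:~R * l) *: S p l x.
  apply/funext => l; apply/funext => x; rewrite /S big_nat_recr //= scalerDr scalerA -expiD.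
  by rewrite scale1r intrB mulrBl addrC.
have ab : admissible ip mu (noise_density Sigma) (fun l x => expi ((t - p%:Z)%:~R * l) *: b p x).
  apply: (bounded_admissible hip heps (K := Kb p)) => [l _|x]; last exact: expi_scale_measurable.
  by have := bop_scale (expi ((t - p%:Z)%:~R * l)) (hb p); rewrite cmod_expi mul1r.
have e1 := Ilin 1 _ _ ab (trig_admissible t p).
have e2 := IA (t - p%:Z) _ (bop_bounded (hb p)).
near=> w.
rewrite big_nat_recr //=.
have -> : I (fun l x => 1 *: (expi ((t - p%:Z)%:~R * l) *: b p x) + expi (t%:~R * l) *: S p l x) w =
  1 *: I (fun l x => expi ((t - p%:Z)%:~R * l) *: b p x) w + I (fun l x => expi (t%:~R * l) *: S p l x) w.
  by near: w.
have -> : I (fun l x => expi ((t - p%:Z)%:~R * l) *: b p x) w = b p (eps (t - p%:Z) w) by near: w.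
have -> : I (fun l x => expi (t%:~R * l) *: S p l x) w = \sum_(0 <= k < p) b k (eps (t - k%:Z) w) by near: w.
by rewrite scale1r addrC.
Unshelve. all: by end_near. Qed.

Let I_Psi t p : as_eq P (I (Psi t p))
  (fun w => filtered I Phi t w - \sum_(0 <= k < p) b k (eps (t - k%:Z) w)).
Proof.
have [_ _ Ilin _ _] := hI.
have Psi0 : Psi t 0 = fun l x => expi (t%:~R * l) *: Phi l x.
  by apply/funext => l; apply/funext => x; rewrite /Psi /S big_nil subr0.
have e := Ilin (-1) _ _ (trig_admissible t p) (Psi_admissible t 0).
have PE : (fun l x => -1 *: (expi (t%:~R * l) *: S p l x) + Psi t 0 l x) = Psi t p.
  by apply/funext => l; apply/funext => x; rewrite Psi0 scaleN1r /Psi scalerBr addrC.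
rewrite PE in e; near=> w.
have -> : I (Psi t p) w = -1 *: I (fun l x => expi (t%:~R * l) *: S p l x) w + I (Psi t 0) w by near: w.
have -> : I (fun l x => expi (t%:~R * l) *: S p l x) w = \sum_(0 <= k < p) b k (eps (t - k%:Z) w).
  by near: w; exact: I_trig.
by rewrite Psi0 scaleN1r addrC.
Unshelve. all: by end_near. Qed.

Lemma filter_limit t : M_sum ip P (fun k w => b k (eps (t - k%:Z) w)) (filtered I Phi t).
Proof.
have [_ IM _ Iiso _] := hI.
have mk k : in_M ip P (fun w => b k (eps (t - k%:Z) w)) by exact: (in_M_bop hip (eM _) (hb k)).
have fM : in_M ip P (filtered I Phi t).
  have := IM _ (Psi_admissible t 0).
  suff -> : Psi t 0 = fun l x => expi (t%:~R * l) *: Phi l x by [].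
  by apply/funext => l; apply/funext => x; rewrite /Psi /S big_nil subr0.
have [mF _ _] := fM.
split => //.
apply: (@squeeze_cvge _ _ _ _ (fun=> 0%E) _ (fun m => (r m)%:E)); last 2 first.
- exact: cvg_cst.
- by apply: cvg_EFin; [near=> m|exact: r_cvg].
apply: nearW => m; apply/andP; split; first exact: msq_ge0.
apply: le_trans (Psi_trace t m); rewrite -(Iiso _ (Psi_admissible t m)).
have ms : hmeasurable setT (fun w => \sum_(0 <= k < m) b k (eps (t - k%:Z) w)).
  by apply: (hmeasurable_sum sepH) => k; have [] := mk k.
rewrite -/(msq P _) -/(msq P _).
have [mI _ _] := IM _ (Psi_admissible t m).
rewrite (msq_as_eq mI _ (I_Psi t m)); last first.
  apply: hmeasurableD => //; exact: (hmeasurable_comp ms (bop_continuous (bop_opp (@bop_id R H)))).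
by rewrite le_eqVlt; apply/orP; left; apply/eqP; apply: eq_integral => w _; rewrite hnormBC.
Unshelve. all: by end_near. Qed.

End FilterLimit.

(** * Assembling the decomposition *)

Section AccretiveOperator.
Variables (R : realType) (H : completeNormedModType R[i]).
Variables (ip : {dot H for Num.conj}) (hip : induces_norm ip).
Variables (dV : measure_display) (V : measurableType dV).
Variable xi : {measure set V -> \bar R}.
Implicit Types f g : V -> R[i].

Lemma integrable_Re_mul_conj f g : in_L2 xi f -> in_L2 xi g ->
  xi.-integrable setT (EFin \o (fun v => complex.Re (f v * Num.conj (g v)))).
Proof.
have i1 f' : in_L2 xi f' -> xi.-integrable setT (EFin \o (fun v => cmod (f' v) ^+ 2)).
  move=> [[mr mi] ff]; apply/integrableP; split.
    apply/measurable_EFinP; under eq_fun do rewrite cmod_sqr.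
    by apply: measurable_funD; apply: measurable_funX.
  by apply: le_lt_trans ff; under eq_integral do rewrite /= ger0_norm ?sqr_ge0 //.
move=> hf hg.
have ig : xi.-integrable setT (EFin \o (fun v => cmod (f v) ^+ 2 + cmod (g v) ^+ 2)).
  have := integrableD measurableT (i1 f hf) (i1 g hg).
  by congr (xi.-integrable _ _); apply/funext => v; rewrite /= -EFinD.
have [[mfr mfi] _] := hf; have [[mgr mgi] _] := hg.
apply: (le_integrable measurableT _ _ ig).
  apply/measurable_EFinP; under eq_fun do rewrite Re_mul_conjE.
  by apply: measurable_funD; apply: measurable_funM.
move=> v _; rewrite /= lee_fin [leRHS]ger0_norm ?addr_ge0 ?sqr_ge0 //.
apply: le_trans (Re_le_cmod _) _; rewrite cmodM.
have -> : cmod (Num.conj (g v)) = cmod (g v) by rewrite /cmod normcJ.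
have := sqr_ge0 (cmod (f v) - cmod (g v)).
have := sqr_ge0 (cmod (f v)); have := sqr_ge0 (cmod (g v)).
nra.
Qed.

Lemma sv_decomposition_accretive (N : H -> H) n U :
  sv_decomposition ip xi N n U ->
  {ae xi, forall v, 2^-1 < complex.Re (n v)} ->
  forall x, 2^-1 * hnorm x ^+ 2 <= complex.Re (ip (N x) x).
Proof.
move=> [_ [L2 _ ipE _] NE] hn x; rewrite (hnorm_sqr hip) !ipE /=.
have ix := integrable_Re_mul_conj (L2 x) (L2 x).
have iN := integrable_Re_mul_conj (L2 (N x)) (L2 x).
have ih : xi.-integrable setT (EFin \o (fun v => 2^-1 * complex.Re (U x v * Num.conj (U x v)))).
  have := integrableZl measurableT 2^-1 ix.
  by congr (xi.-integrable _ _); apply/funext => v; rewrite /= -EFinM.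
rewrite -RintegralZl // -subr_ge0 -RintegralB //.
pose f v := complex.Re (U (N x) v * Num.conj (U x v)) - 2^-1 * complex.Re (U x v * Num.conj (U x v)).
have mf : measurable_fun setT (EFin \o f).
  have := measurable_int _ (integrableB measurableT iN ih).
  by congr (measurable_fun _ _); apply/funext => v; rewrite /= -EFinB.
rewrite /Rintegral -[X in fine X]/(\int[xi]_v (EFin \o f) v)%E.
(* The integrand is nonnegative only almost everywhere, so it is replaced by its absolute value. *)
rewrite (@ae_eq_integral _ _ _ xi setT (fun v => `|(EFin \o f) v|%E)) //.
- by apply: fine_ge0; apply: integral_ge0.
- exact: measurableT_comp.
have h := NE (U x) x (L2 x) (nearW _ (fun v => erefl)).
near=> v => _; rewrite gee0_abs //= lee_fin /f.
have -> : U (N x) v = n v * U x v by near: v; exact: h.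
have : 2^-1 < complex.Re (n v) by near: v.
case: (n v) (U x v) => a a' [u u'] /= ha.
have -> : (a * u - a' * u') * u - (a * u' + a' * u) * - u' - 2^-1 * (u * u - u' * - u') =
  (a - 2^-1) * (u ^+ 2 + u' ^+ 2) by ring.
by apply: mulr_ge0; [rewrite subr_ge0 ltW|rewrite addr_ge0 ?sqr_ge0].
Unshelve. all: by end_near. Qed.

End AccretiveOperator.

Lemma torus_expi_neq1 (R : realType) (l : R) : torus l -> l != 0 -> expi (- l) != 1.
Proof.
rewrite /torus /= in_itv /= => /andP[lpi pil] l0.
apply/eqP => /(congr1 (@complex.Re R)) /=; rewrite cosN => c1.
have [l1|l1] := leP 0 l.
  by move/eqP: l0; apply; apply: cos_inj; rewrite ?in_itv /= ?l1 ?lexx ?pi_ge0 // cos0.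
have : - l = 0.
  apply: cos_inj; rewrite ?in_itv /= ?lexx ?pi_ge0 // ?cosN ?cos0 //.
  by rewrite oppr_ge0 ltW //= lerNl ltW.
by move/eqP; rewrite oppr_eq0 (negbTE l0).
Qed.

Section MeanSquareSeries.
Variables (R : realType) (H : completeNormedModType R[i]).
Variables (ip : {dot H for Num.conj}) (hip : induces_norm ip) (sepH : separable H).
Variables (d : measure_display) (Om : measurableType d) (P : probability Om R).

Lemma msq_le_scale (X Z : Om -> H) (K : R) : hmeasurable setT Z ->
  (forall w, hnorm (X w) <= K * hnorm (Z w)) -> (msq P X <= (K ^+ 2)%:E * msq P Z)%E.
Proof.
move=> mZ XZ; rewrite /msq -ge0_integralZl //.
- apply: ge0_le_integral_nonmeasurable => w _; first by rewrite lee_fin sqr_ge0.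
  by rewrite -EFinM lee_fin -exprMn ler_sqr ?nnegrE ?(le_trans _ (XZ w)) ?hnorm_ge0.
- exact: measurable_msq.
- by move=> w _; rewrite lee_fin sqr_ge0.
- by rewrite lee_fin sqr_ge0.
Qed.

Lemma M_sum_bounded (u : nat -> Om -> H) Y : M_sum ip P u Y ->
  exists M : R, exists m0, forall m, (m0 <= m)%N -> (msq P (fun w => \sum_(0 <= k < m) u k w)%R <= M%:E)%E.
Proof.
move=> [uM [mY fY _] cu].
have yE : msq P Y = (fine (msq P Y))%:E by rewrite fineK // ge0_fin_numE ?msq_ge0.
have [m0 _ h] : \forall m \near \oo, (msq P (fun w => \sum_(0 <= k < m) u k w - Y w)%R < 1)%E.
  have n0 : nbhs (0%E : \bar R) [set y | (y < 1)%E] by apply: open_ereal_lt'; rewrite lte_fin.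
  exact: cu _ n0.
(* From |S_m|^2 <= 2 |S_m - Y|^2 + 2 |Y|^2, the first mean square being below 1 from m0 on. *)
exists (2 + 2 * fine (msq P Y)), m0 => m m0m.
have ms : hmeasurable setT (fun w => \sum_(0 <= k < m) u k w).
  by apply: (hmeasurable_sum sepH) => k; have [] := uM k.
have mD : hmeasurable setT (fun w => \sum_(0 <= k < m) u k w - Y w).
  by apply: hmeasurableD => //; exact: (hmeasurable_comp mY (bop_continuous (bop_opp (@bop_id R H)))).
have -> : (fun w => \sum_(0 <= k < m) u k w)%R = (fun w => (\sum_(0 <= k < m) u k w - Y w) + Y w)%R.
  by apply/funext => w; rewrite subrK.
apply: le_trans (msqD_le hip P mD mY) _.
rewrite [leRHS]EFinD EFinM -yE; apply: leeD => //.
by rewrite -[leRHS]mule1 lee_wpmul2l ?lee_fin //; exact/ltW/h.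
Qed.

Lemma M_sum_diff (u v : nat -> Om -> H) X Y (C : H -> H) (K : R) :
  bop C K -> M_sum ip P u X -> M_sum ip P v Y ->
  M_sum ip P (fun k w => u k w - C (v k w)) (fun w => X w - C (Y w)).
Proof.
move=> hC [uM XM cu] [vM YM cv].
have lC := bop_lin hC.
split=> [k||].
- exact: (in_MB hip sepH (uM k) (in_M_bop hip (vM k) hC)).
- exact: (in_MB hip sepH XM (in_M_bop hip YM hC)).
have mD (w : nat -> Om -> H) Z m : (forall k, in_M ip P (w k)) -> in_M ip P Z ->
    hmeasurable setT (fun o => \sum_(0 <= k < m) w k o - Z o).
  move=> wM [mZ _ _]; apply: hmeasurableD => //; last first.
    exact: (hmeasurable_comp mZ (bop_continuous (bop_opp (@bop_id R H)))).
  by apply: (hmeasurable_sum sepH) => k; have [] := wM k.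
have h : (2%:E * msq P (fun o => \sum_(0 <= k < m) u k o - X o)%R +
     2%:E * ((K ^+ 2)%:E * msq P (fun o => \sum_(0 <= k < m) v k o - Y o)%R))%E @[m --> \oo] --> 0%E.
  have -> : (0 = 2%:E * 0 + 2%:E * ((K ^+ 2)%:E * 0) :> \bar R)%E by rewrite !mule0 adde0.
  by apply: cvgeD; [rewrite !mule0|apply: cvgeZl|apply: cvgeZl => //; apply: cvgeZl].
apply: (squeeze_cvge _ (cvg_cst 0%E) h); apply: nearW => m; apply/andP; split; first exact: msq_ge0.
have mv := mD v Y m vM YM.
apply: (@le_trans _ _ (2%:E * msq P (fun o => \sum_(0 <= k < m) u k o - X o)%R +
   2%:E * msq P ((fun x => - C x) \o (fun o => \sum_(0 <= k < m) v k o - Y o))%R)%E).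
  have -> : (fun o => (hnorm (\sum_(0 <= k < m) (u k o - C (v k o)) - (X o - C (Y o))) ^+ 2)%:E) =
    (fun o => (hnorm ((\sum_(0 <= k < m) u k o - X o) - C (\sum_(0 <= k < m) v k o - Y o)) ^+ 2)%:E).
    apply/funext => o; congr ((hnorm _ ^+ 2)%:E).
    rewrite sumrB (linB lC) (lin_sum lC) !opprB -!addrA; congr (_ + _).
    by rewrite addrC [RHS]addrCA addrA.
  apply: (msqD_le hip P (mD u X m uM XM)).
  exact: (hmeasurable_comp mv (bop_continuous (bop_opp hC))).
by rewrite leeD2l // lee_wpmul2l ?lee_fin // (msq_bop_le P mv (bop_opp hC)).
Qed.

End MeanSquareSeries.

Lemma opnorm_bop (R : realType) (H : completeNormedModType R[i]) (A : H -> H) (K : R) :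
  bop A K -> (0 <= opnorm A <= K%:E)%E.
Proof.
move=> [_ K0 hA]; apply/andP; split.
  apply: le_trans (_ : (_ <= (hnorm (A 0))%:E)%E) _; first by rewrite lee_fin hnorm_ge0.
  by apply: ereal_sup_ubound; exists 0 => //=; rewrite hnorm0.
apply: ge_ereal_sup => _ [x x1 <-]; rewrite lee_fin; apply: le_trans (hA x) _.
by rewrite -[leRHS]mulr1 ler_wpM2l.
Qed.

Theorem proposition3p6 (R : realType)
  (H : completeNormedModType R[i]) (ip : {dot H for Num.conj})
  (hip : induces_norm ip) (hsep : separable H)
  (d : measure_display) (Om : measurableType d) (P : probability Om R)
  (eps : int -> Om -> H) (Sigma : H -> H)
  (heps : white_noise ip P eps Sigma)
  (N : H -> H) (hN : bounded_op N) (hNn : normal_op ip N)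
  (dV : measure_display) (V : measurableType dV)
  (xi : {sigma_finite_measure set V -> \bar R})
  (n : V -> R[i]) (U : H -> V -> R[i])
  (hU : sv_decomposition ip xi N n U)
  (W : V * Om -> R[i]) (hW : joint_version xi P U (eps 0) W)
  (hn : {ae xi, forall v, 2^-1 < complex.Re (n v)})
  (hint : (\int[xi]_v (sigma2 P W v *
             ((2 * complex.Re (n v) - 1)^-1)%:E) < +oo)%E)
  (Y : int -> Om -> H)
  (hY : forall t : int,
     M_sum ip P (fun (k : nat) w => nat_pow_opp N k (eps (t - k%:Z) w)) (Y t))
  (I : (R -> H -> H) -> Om -> H)
  (hI : spectral_integral ip P (@lebesgue_measure R) eps
          (noise_density Sigma) I) :
  exists (C : H -> H) (Delta : nat -> H -> H) (Z : int -> Om -> H),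
    [/\ bounded_op C,
        forall k : nat, bounded_op (Delta k),
        (\sum_(0 <= k <oo) opnorm (Delta k) < +oo)%E,
        forall t : int,
          M_sum ip P (fun (k : nat) w => Delta k (eps (t - k%:Z) w)) (Z t) &
        forall t : int,
          as_eq P (filtered I (FI (fun x => x - N x)) t)
                  (fun w => C (Y t w) + Z t w)].
Proof.
have [K hK] := (bounded_op_bop N).1 hN.
have acc := sv_decomposition_accretive hip hU hn.
have h0 : (0 : R) <= 2^-1 by rewrite invr_ge0.
have decay s x : 0 <= s -> _ := accretive_exp_le hip hK h0 acc x.
have [C [B [del [hC b_le hdel [c hc]]]]] := binom_coef_asymptotics hK decay.
have hD := bop_sub (@bop_id R H) hK.
have hE k : bop (nat_pow_opp N k) _ := bop_opexp (bop_scale (- (ln k.+1%:R)%:C%C) hK).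
have PhiE l x : torus l -> l != 0 ->
    \sum_(0 <= k < m) expi (- (k%:R * l)) *: binom_coef N k x @[m --> \oo] --> FI (fun x => x - N x) l x.
  move=> tl l0; have w1 := torus_expi_neq1 tl l0.
  have := cvg_binomial_series hD (cmod_expi (- l)) w1 (binom_coefS N ^~ x) (cvg_binom_coef hK decay x).
  rewrite /FI (negbTE w1) /one_minus_pow.
  under eq_fun do under eq_bigr do rewrite expiX mulrN.
  suff -> : (fun z => - cln (1 - expi (- l)) *: (z - N z)) = fun z => cln (1 - expi (- l)) *: - (z - N z) by [].
  by apply/funext => z; rewrite scaleNr scalerN.
have bPhi l : torus l -> bounded_op (FI (fun x => x - N x) l).
  move=> _; rewrite /FI; case: ifP => _; first exact: bop_bounded (@bop_zero R H).
  exact: bop_bounded (bop_opexp (bop_scale _ (bop_opp hD))).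
have meps : hmeasurable setT (eps 0) by have [[/(_ 0)[]]] := heps.
have mE k : hmeasurable setT (nat_pow_opp N k \o eps 0).
  exact: (hmeasurable_comp meps (bop_continuous (hE k))).
have [M hM] : exists M : R, forall m, (\sum_(0 <= k < m) msq P (binom_coef N k \o eps 0%R) <= M%:E)%E.
  (* The comparison of b_k x with (k + 1)^(-N) x reduces the claim to the terms of Y_0. Their mean
     squares are summed by [sum_msq_le] up to the maximum of m and m0, since the partial sums are
     bounded only from m0 on. *)
  have [M [m0 hM]] := M_sum_bounded hip hsep (hY 0).
  exists (B ^+ 2 * M) => m.
  apply: le_trans (_ : (_ <= \sum_(0 <= k < m) (B ^+ 2)%:E * msq P (nat_pow_opp N k \o eps 0%R))%E) _.
    by apply: lee_sum => k _; apply: msq_le_scale => // w; exact: b_le.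
  rewrite -ge0_sume_distrr; last by move=> k _; exact: msq_ge0.
  rewrite [leRHS]EFinM lee_wpmul2l ?lee_fin ?sqr_ge0 //.
  apply: le_trans (hM _ (leq_maxr m m0)).
  apply: le_trans (sum_msq_le hip hsep heps hI (maxn m m0) 0 hE).
  rewrite [leRHS](@big_cat_nat _ _ _ m) ?leq_maxl //= leeDl //.
  by apply: sume_ge0 => k _; exact: msq_ge0.
have hF := filter_limit hip hsep heps hI (bop_binom_coef hK) hM bPhi PhiE.
exists C, (fun k x => binom_coef N k x - C (nat_pow_opp N k x)).
(* With Z defined as the difference, the decomposition is immediate; the content is that Z is the
   mean-square sum of the Delta_k eps_(t - k), obtained by subtracting C applied to the series of Y
   from that of the filter. *)
exists (fun t w => filtered I (FI (fun x => x - N x)) t w - C (Y t w)).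
split.
- exact: bop_bounded hC.
- by move=> k; exact: bop_bounded (hdel k).
- apply: le_lt_trans (ltry c).
  apply: lime_le.
    by apply: is_cvg_nneseries => k _ _; have /andP[] := opnorm_bop (hdel k).
  apply: nearW => m; apply: le_trans (_ : (_ <= (\sum_(0 <= k < m) del k)%:E)%E) _; last by rewrite lee_fin.
  by rewrite -sumEFin; apply: lee_sum => k _; have /andP[] := opnorm_bop (hdel k).
- by move=> t; exact: (M_sum_diff hip hsep hC (hF t) (hY t)).
- by move=> t; apply: nearW => w; rewrite subrKC.
Qed.
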